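(* Let $1\le m\le n$ and let $\varkappa$, $\sigma_j,\tau_j$ ($m\le j\le n$), $\theta_{j\alpha}$ ($m\le j\le n-1$, $1\le\alpha\le j$) be complex numbers. Put $\theta_{(m-1)\alpha}:=\varkappa$ for $1\le\alpha\le m-1$. Assume that $\operatorname{Re}\varkappa>0$, $\operatorname{Re}\theta_{j\alpha}>0$, $\operatorname{Re}\sigma_j>0$ for all admissible indices, $\operatorname{Re}\bigl(\tau_j-\sigma_j-\sum_{\alpha=1}^{j-1}\theta_{(j-1)\alpha}\bigr)>0$ for $m\le j\le n$, and $\operatorname{Re}\bigl(\tau_m-\sigma_m-(m+j-1)\varkappa\bigr)>0$ for $1\le j\le m-1$. Then $$\int_{\mathcal R^m_n[0,\infty)}\ \prod_{j=m}^{n-1}\prod_{\alpha=1}^{j}\frac{\lambda_{j\alpha}^{\sigma_j-\sigma_{j+1}-\theta_{j\alpha}}}{(1+\lambda_{j\alpha})^{\tau_j-\tau_{j+1}+\theta_{j\alpha}}}\cdot\prod_{p=1}^{n}\frac{\lambda_{np}^{\sigma_n-1}}{(1+\lambda_{np})^{\tau_n}}\cdot\prod_{1\le\alpha<\beta\le m}(\lambda_{m\beta}-\lambda_{m\alpha})^{2\varkappa-1}$$ $$\times\prod_{j=m}^{n-1}\frac{\prod_{1\le\alpha\le j,\,1\le p\le j+1}|\lambda_{j\alpha}-\lambda_{(j+1)p}|^{\theta_{j\alpha}-1}}{\prod_{1\le\alpha<\beta\le j}(\lambda_{j\beta}-\lambda_{j\alpha})^{\theta_{j\alpha}+\theta_{j\beta}-2}}\cdot\prod_{1\le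 p<q\le n}(\lambda_{nq}-\lambda_{np})\,d\mathcal L$$ $$=\prod_{j=1}^{m-1}\frac{\Gamma((j+1)\varkappa)\,\Gamma(\sigma_m+j\varkappa)\,\Gamma(\tau_m-\sigma_m-(m+j-1)\varkappa)}{\Gamma(\varkappa)\,\Gamma(\tau_m-j\varkappa)}\cdot\prod_{j=m}^{n-1}\prod_{\alpha=1}^{j}\Gamma(\theta_{j\alpha})\cdot\prod_{j=m}^{n}\frac{\Gamma(\sigma_j)\,\Gamma\bigl(\tau_j-\sigma_j-\sum_{\alpha=1}^{j-1}\theta_{(j-1)\alpha}\bigr)}{\Gamma(\tau_j)}.$$
   Context: A Rayleigh trapezoid is a collection of real numbers $\lambda_{jk}$, $m\le j\le n$, $1\le k\le j$, with $\lambda_{j1}\le\dots\le\lambda_{jj}$ in each row and satisfying the interlacing inequalities $\lambda_{(j+1)k}\le\lambda_{jk}\le\lambda_{(j+1)(k+1)}$ for all $m\le j\le n-1$, $1\le k\le j$. $\mathcal R^m_n[0,\infty)$ is the set of such trapezoids with all entries in $[0,\infty)$, and $d\mathcal L=\prod_{j=m}^n\prod_{\alpha=1}^j d\lambda_{j\alpha}$ is Lebesgue measure. Complex powers of positive numbers are $x^s=e^{s\ln x}$; empty sums are $0$ and empty products are $1$. *)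

(* Defs.v *)
From HB Require Import structures.
From mathcomp Require Import all_boot all_order all_algebra.
From mathcomp Require Import complex.
From mathcomp Require Import all_classical all_reals all_analysis.

Set Implicit Arguments.
Unset Strict Implicit.
Unset Printing Implicit Defensive.

Import Order.TTheory GRing.Theory Num.Theory.
Import numFieldNormedType.Exports.

Local Open Scope classical_set_scope.
Local Open Scope complex_scope.
Local Open Scope ring_scope.

Section complex_analysis.
Context {R : realType}.

Definition cexp (z : R[i]) : R[i] :=
  (expR (complex.Re z))%:C * (cos (complex.Im z) +i* sin (complex.Im z)).

(* x^s = e^{s ln x} for 0 < x.  Since ln x = 0 for x <= 0, the value there is 1;
   in the integrals below this only concerns Lebesgue-null sets. *)
Definition cpowR (x : R) (s : R[i]) : R[i] := cexp (s * (ln x)%:C).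

Context d (T : measurableType d) (mu : {measure set T -> \bar R}).

Definition cintegrable (D : set T) (f : T -> R[i]) : Prop :=
  mu.-integrable D (fun x => (complex.Re (f x))%:E) /\
  mu.-integrable D (fun x => (complex.Im (f x))%:E).

Definition cintegral (D : set T) (f : T -> R[i]) : R[i] :=
  (\int[mu]_(x in D) complex.Re (f x)) +i* (\int[mu]_(x in D) complex.Im (f x)).

End complex_analysis.

(* Euler's integral, i.e. the Gamma function on the half-plane 0 < Re s;
   the values for Re s <= 0 are not meaningful. *)
Definition cGamma {R : realType} (s : R[i]) : R[i] :=
  cintegral (@lebesgue_measure R) `]0, +oo[
    (fun t : R => cpowR t (s - 1) * (expR (- t))%:C).

Section lebesgue_tuple.
Context {R : realType}.

Definition tuple_cons n (p : measurableTypeR R * n.-tuple (measurableTypeR R)) :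
  n.+1.-tuple (measurableTypeR R) := [tuple of p.1 :: p.2].

Lemma measurable_tuple_cons n : measurable_fun [set: _] (@tuple_cons n).
Proof. by apply: measurable_cons; [exact: measurable_fst|exact: measurable_snd]. Qed.

Section cons_measure.
Variables (n : nat)
  (mu : {sigma_finite_measure set (n.-tuple (measurableTypeR R)) -> \bar R}).

Definition lebesgue_cons : set (n.+1.-tuple (measurableTypeR R)) -> \bar R :=
  pushforward (lebesgue_measure \x mu)%E (@tuple_cons n).

Let lebesgue_cons0 : lebesgue_cons set0 = 0%E.
Proof. by rewrite /lebesgue_cons /pushforward preimage_set0 measure0. Qed.

Let lebesgue_cons_ge0 A : (0 <= lebesgue_cons A)%E.
Proof. by rewrite /lebesgue_cons /pushforward; apply: measure_ge0. Qed.

Let lebesgue_cons_sigma_additive : semi_sigma_additive lebesgue_cons.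
Proof.
have mc A : measurable A -> measurable (@tuple_cons n @^-1` A).
  by move=> mA; rewrite -[X in measurable X]setTI; exact: measurable_tuple_cons.
move=> F mF tF mUF; rewrite /lebesgue_cons /pushforward preimage_bigcup.
apply: measure_semi_sigma_additive.
- by move=> k; exact: mc.
- apply/trivIsetP => /= i j _ _ ij; rewrite -preimage_setI.
  by move/trivIsetP : tF => /(_ _ _ _ _ ij) ->//; rewrite preimage_set0.
- by rewrite -preimage_bigcup; exact: mc.
Qed.

HB.instance Definition _ := isMeasure.Build _ _ _ lebesgue_cons
  lebesgue_cons0 lebesgue_cons_ge0 lebesgue_cons_sigma_additive.

Let lebesgue_cons_sigma_finite : sigma_finite setT lebesgue_cons.
Proof.
have /sigma_finiteP[F [FT ndF mF]] := sigma_finiteT (@lebesgue_measure R).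
have /sigma_finiteP[G [GT ndG mG]] := sigma_finiteT mu.
pose u (t : n.+1.-tuple (measurableTypeR R)) := (thead t, [tuple of behead t]).
have uK p : u (tuple_cons p) = p.
  case: p => x t; rewrite /u /tuple_cons theadE; congr pair.
  exact: val_inj.
have measu : measurable_fun [set: _] u.
  apply/measurable_fun_pair; first exact: measurable_tnth.
  exact: measurable_behead.
exists (fun k => u @^-1` (F k `*` G k)).
  rewrite -preimage_bigcup -[LHS](preimage_setT u); congr (_ @^-1` _).
  rewrite -setXTT FT GT; apply/seteqP; split=> -[x t]; last first.
    by move=> [k _ [? ?]]; split; exists k.
  move=> [/= [k _ Fx] [l _ Gt]]; exists (maxn k l) => //; split.
    by move: x Fx; exact/subsetPset/ndF/leq_maxl.
  by move: t Gt; exact/subsetPset/ndG/leq_maxr.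
move=> k; have [mFk Fk] := mF k; have [mGk Gk] := mG k.
have mFGk : measurable (F k `*` G k) by exact: measurableX.
split; first by rewrite -[X in measurable X]setTI; exact: measu.
have -> : lebesgue_cons (u @^-1` (F k `*` G k)) =
    (lebesgue_measure \x mu)%E (F k `*` G k).
  rewrite /lebesgue_cons /pushforward; congr (_ _).
  rewrite -comp_preimage (_ : u \o _ = id) ?preimage_id//.
  by apply/funext => p; exact: uK.
by rewrite product_measure1E// lte_mul_pinfty// ge0_fin_numE.
Qed.

HB.instance Definition _ := Measure_isSigmaFinite.Build _ _ _ lebesgue_cons
  lebesgue_cons_sigma_finite.

End cons_measure.

(* Lebesgue measure on R^n: the n-fold product of one-dimensional Lebesgue
   measure, transported along R * R^n = R^(n+1). *)
Fixpoint lebesgue_tuple n :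
    {sigma_finite_measure set (n.-tuple (measurableTypeR R)) -> \bar R} :=
  match n with
  | 0 => \d_[tuple]
  | n'.+1 => lebesgue_cons (lebesgue_tuple n')
  end.

End lebesgue_tuple.

Arguments lebesgue_tuple {R} n.

Section rayleigh.
Context {R : realType}.

(* Number of entries l_{jk}, m <= j <= n, 1 <= k <= j. *)
Definition trap_size (m n : nat) : nat := (\sum_(m <= j < n.+1) j)%N.

(* The entries are stored row after row, rows m, m+1, ..., n, so that l_{jk}
   is at position m + (m+1) + ... + (j-1) + (k-1). *)
Definition trap_entry (m : nat) (t : seq R) (j k : nat) : R :=
  nth 0 t ((\sum_(m <= i < j) i) + k.-1)%N.

Definition is_rayleigh_trapezoid (m n : nat) (l : nat -> nat -> R) : Prop :=
  (forall j k, (m <= j <= n)%N -> (1 <= k < j)%N -> l j k <= l j k.+1) /\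
  (forall j k, (m <= j < n)%N -> (1 <= k <= j)%N ->
    l j.+1 k <= l j k <= l j.+1 k.+1).

(* The set R^m_n[0, +oo) of the trapezoids with entries in [0, +oo). *)
Definition rayleigh_nonneg (m n : nat) :
    set ((trap_size m n).-tuple (measurableTypeR R)) :=
  [set t | is_rayleigh_trapezoid m n (trap_entry m t) /\
    forall j k, (m <= j <= n)%N -> (1 <= k <= j)%N -> 0 <= trap_entry m t j k].

(* Extension of theta to the row m - 1 by theta_{(m-1)a} := kappa. *)
Definition theta_ext (m : nat) (kappa : R[i]) (theta : nat -> nat -> R[i])
  (j a : nat) : R[i] := if (j < m)%N then kappa else theta j a.

Definition rayleigh_integrand (m n : nat) (kappa : R[i])
    (sigma tau : nat -> R[i]) (theta : nat -> nat -> R[i])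
    (l : nat -> nat -> R) : R[i] :=
  (\prod_(m <= j < n) \prod_(1 <= a < j.+1)
     (cpowR (l j a) (sigma j - sigma j.+1 - theta j a)
      / cpowR (1 + l j a) (tau j - tau j.+1 + theta j a)))
  * (\prod_(1 <= p < n.+1)
       (cpowR (l n p) (sigma n - 1) / cpowR (1 + l n p) (tau n)))
  * (\prod_(1 <= b < m.+1) \prod_(1 <= a < b)
       cpowR (l m b - l m a) (2 * kappa - 1))
  * (\prod_(m <= j < n)
       ((\prod_(1 <= a < j.+1) \prod_(1 <= p < j.+2)
           cpowR `|l j a - l j.+1 p| (theta j a - 1))
        / (\prod_(1 <= b < j.+1) \prod_(1 <= a < b)
             cpowR (l j b - l j a) (theta j a + theta j b - 2))))
  * (\prod_(1 <= q < n.+1) \prod_(1 <= p < q) (l n q - l n p)%:C).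

End rayleigh.

Arguments rayleigh_nonneg {R} m n.

(* Main.v *)
Require Import Defs.
From HB Require Import structures.
From mathcomp Require Import all_boot all_order all_algebra.
From mathcomp Require Import complex ring lra zify.
From mathcomp Require Import all_classical all_reals all_analysis measurable_realfun.

Set Implicit Arguments.
Unset Strict Implicit.
Unset Printing Implicit Defensive.

Import Order.TTheory GRing.Theory Num.Theory.
Import numFieldNormedType.Exports.
Import Normc.

Local Open Scope classical_set_scope.
Local Open Scope complex_scope.
Local Open Scope ring_scope.

(** Write y = (y_1 < ... < y_n) for the row n and x for the row n+1 of a trapezoid.
    Given y, the integral over x is a Dixon-Anderson integral.  The substitution
    prod_i (x_i - t) / prod_j (a_j - t) = 1 + sum_j w_j / (a_j - t), with poles
    a = (0, y), maps the interlacing sequences x bijectively to the positive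
    orthant of residues w; its Jacobian is a ratio of Vandermonde products, so the
    integral over x becomes a Dirichlet integral, whose factor (1 + sum_j c_j w_j)
    comes from t = -1.  The result is a product of Gamma functions times exactly
    the weight that makes y the last row of the same integral for n instead of
    n+1, so the rows are removed one by one.  What is left at row m is a Selberg
    integral, computed in the same way: a double integral over two interlacing
    rows is a Dixon-Anderson integral in each order, and comparing the two orders
    relates m to m - 1.

    Absolute convergence comes for free: the absolute value of each integrand is
    the integrand with all parameters replaced by their real parts.  The
    computation is carried out on strictly interlacing trapezoids; the rest of the
    region lies in the null set of the tuples with two equal or one zero entry. *)

(** No change of variables theorem in several dimensions is used. The Dixon-Anderson map is composed
    of rescalings of residues and one-dimensional increasing substitutions, each justified by the
    fundamental theorem of calculus; Tonelli's theorem glues them together, and the Jacobian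
    accumulates as a product.

    Cancelling Gamma factors in the Dirichlet integrals and dividing in the Selberg recursion both
    need that Gamma has no zero with positive real part. Gamma being only Euler's integral here,
    this is drawn from the beta integral, which until then is kept in the multiplied form
    [Gamma(p + q) B(p, q) = Gamma(p) Gamma(q)]. A zero at [s] would propagate to all [s + n], where
    the Gamma density becomes too concentrated for the phase to cancel the integral.

    Every region of integration is encoded by letting the integrand vanish outside it. All integrals
    then run over full product spaces, every section is integrable, and Fubini's theorem applies
    without exceptional sets. *)

Section complex_functions.
Context {R : realType}.
Implicit Types (z s : R[i]) (x : R).

Lemma cexpD z w : cexp (z + w) = cexp z * cexp w :> R[i].
Proof.
case: z w => [a b] [c d]; rewrite /cexp /= expRD cosD sinD; simpc.
by apply/eqP; rewrite eq_complex /=; apply/andP; split; apply/eqP; ring.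
Qed.

Lemma cexp0 : cexp 0 = 1 :> R[i].
Proof. by rewrite /cexp /= expR0 cos0 sin0; simpc. Qed.

Lemma normc_cexp z : normc (cexp z) = expR (complex.Re z).
Proof.
case: z => [a b]; rewrite /cexp normcM /= expr0n /= addr0 cos2Dsin2 sqrtr1 mulr1.
by rewrite sqrtr_sqr ger0_norm // expR_ge0.
Qed.

Lemma cexp_neq0 z : cexp z != 0.
Proof.
apply/eqP => /(congr1 (@normc R)); rewrite normc_cexp normc0 => e.
by have := expR_gt0 (complex.Re z); rewrite e ltxx.
Qed.

Lemma cexpN z : cexp (- z) = (cexp z)^-1.
Proof.
by apply: (mulfI (cexp_neq0 z)); rewrite -cexpD addrN cexp0 mulfV ?cexp_neq0.
Qed.

Lemma cexp_real x : cexp x%:C = (expR x)%:C.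
Proof. by rewrite /cexp /= cos0 sin0; simpc. Qed.

Lemma cpowRD x s t : cpowR x (s + t) = cpowR x s * cpowR x t.
Proof. by rewrite /cpowR mulrDl cexpD. Qed.

Lemma cpowRN x s : cpowR x (- s) = (cpowR x s)^-1.
Proof. by rewrite /cpowR mulNr cexpN. Qed.

Lemma cpowR0 x : cpowR x 0 = 1 :> R[i].
Proof. by rewrite /cpowR mul0r cexp0. Qed.

Lemma cpow1R s : cpowR 1 s = 1 :> R[i].
Proof. by rewrite /cpowR ln1 mulr0 cexp0. Qed.

Lemma cpowR1 x : 0 < x -> cpowR x 1 = x%:C.
Proof. by move=> x0; rewrite /cpowR mul1r cexp_real lnK. Qed.

Lemma cpowRM x y s : 0 < x -> 0 < y -> cpowR (x * y) s = cpowR x s * cpowR y s.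
Proof. by move=> x0 y0; rewrite /cpowR lnM // rmorphD mulrDr cexpD. Qed.

Lemma cpowRV x s : 0 < x -> cpowR x^-1 s = cpowR x (- s).
Proof. by move=> x0; rewrite /cpowR lnV // rmorphN mulrN mulNr. Qed.

Lemma cpowR_prod I (r : seq I) (P : pred I) (F : I -> R) s :
  (forall i, P i -> 0 < F i) ->
  cpowR (\prod_(i <- r | P i) F i) s = \prod_(i <- r | P i) cpowR (F i) s.
Proof.
move=> F0; suff [] : 0 < \prod_(i <- r | P i) F i /\
  cpowR (\prod_(i <- r | P i) F i) s = \prod_(i <- r | P i) cpowR (F i) s by [].
elim/big_rec2 : _ => [|i y1 y2 Pi [y10 <-]]; first by rewrite cpow1R.
by rewrite mulr_gt0 ?F0 // cpowRM ?F0.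
Qed.

Lemma normc_cpowR x s : normc (cpowR x s) = expR (complex.Re s * ln x).
Proof. by rewrite /cpowR normc_cexp; case: s => a b /=; rewrite mulr0 subr0. Qed.

Lemma cpowR_real x (a : R) : cpowR x a%:C = (expR (a * ln x))%:C.
Proof. by rewrite /cpowR -rmorphM cexp_real. Qed.

Lemma normc_cpowRE x s : (normc (cpowR x s))%:C = cpowR x (complex.Re s)%:C.
Proof. by rewrite cpowR_real normc_cpowR. Qed.

Lemma normc_real x : 0 <= x -> normc x%:C = x.
Proof. by move=> x0 /=; rewrite expr0n addr0 sqrtr_sqr ger0_norm. Qed.

Lemma normc_ge0 z : 0 <= normc z.
Proof. by case: z => a b /=; exact: sqrtr_ge0. Qed.

Lemma normc_prod I (r : seq I) (P : pred I) (F : I -> R[i]) :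
  normc (\prod_(i <- r | P i) F i) = \prod_(i <- r | P i) normc (F i).
Proof. by apply: (big_morph _ (@normcM R)); exact: normc1. Qed.

Lemma normr_Re_le z : `|complex.Re z| <= normc z.
Proof.
case: z => a b /=; rewrite -sqrtr_sqr ler_wsqrtr //.
by rewrite lerDl sqr_ge0.
Qed.

Lemma normr_Im_le z : `|complex.Im z| <= normc z.
Proof.
case: z => a b /=; rewrite -sqrtr_sqr ler_wsqrtr //.
by rewrite lerDr sqr_ge0.
Qed.

Lemma ReD z w : complex.Re (z + w) = complex.Re z + complex.Re w.
Proof. by case: z w => [? ?] [? ?]. Qed.

Lemma ReN z : complex.Re (- z) = - complex.Re z.
Proof. by case: z. Qed.

Lemma ReB z w : complex.Re (z - w) = complex.Re z - complex.Re w.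
Proof. by rewrite ReD ReN. Qed.

Lemma Re_nat n : complex.Re (n%:R : R[i]) = n%:R.
Proof. by rewrite -(rmorph_nat (real_complex R)). Qed.

Lemma Re_sum I (r : seq I) (P : pred I) (F : I -> R[i]) :
  complex.Re (\sum_(i <- r | P i) F i) = \sum_(i <- r | P i) complex.Re (F i).
Proof. by apply: (big_morph _ ReD). Qed.

End complex_functions.

(** * Measurability of complex-valued functions *)

Section complex_measurability.
Context {R : realType} d (T : measurableType d).
Implicit Types f g : T -> R[i].

Definition cmeasurable f :=
  measurable_fun setT (fun x => complex.Re (f x)) /\
  measurable_fun setT (fun x => complex.Im (f x)).

Lemma cmeasurable_cst z : cmeasurable (fun=> z).
Proof. by split; exact: measurable_cst. Qed.

Lemma cmeasurable_real (f : T -> R) :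
  measurable_fun setT f -> cmeasurable (fun x => (f x)%:C).
Proof. by move=> mf; split => //=; exact: measurable_cst. Qed.

Lemma cmeasurableM f g : cmeasurable f -> cmeasurable g ->
  cmeasurable (fun x => f x * g x).
Proof.
move=> [mf1 mf2] [mg1 mg2]; split.
  rewrite (_ : (fun _ => _) =
    ((fun x => complex.Re (f x)) \* (fun x => complex.Re (g x))) \-
    ((fun x => complex.Im (f x)) \* (fun x => complex.Im (g x)))).
    by apply: measurable_funB; exact: measurable_funM.
  by apply/funext => x /=; case: (f x) (g x) => [? ?] [? ?].
rewrite (_ : (fun _ => _) =
  ((fun x => complex.Re (f x)) \* (fun x => complex.Im (g x))) \+
  ((fun x => complex.Im (f x)) \* (fun x => complex.Re (g x)))).
  by apply: measurable_funD; exact: measurable_funM.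
by apply/funext => x /=; case: (f x) (g x) => [? ?] [? ?].
Qed.

Lemma cmeasurable_prod I (r : seq I) (P : pred I) (F : I -> T -> R[i]) :
  (forall i, cmeasurable (F i)) ->
  cmeasurable (fun x => \prod_(i <- r | P i) F i x).
Proof.
move=> mF; elim: r => [|i r ih].
  rewrite (_ : (fun _ => _) = fun=> 1); first exact: cmeasurable_cst.
  by apply/funext => x; rewrite big_nil.
rewrite (_ : (fun _ => _) =
  fun x => (if P i then F i x else 1) * \prod_(j <- r | P j) F j x); last first.
  by apply/funext => x; rewrite big_cons; case: ifP; rewrite ?mul1r.
by apply: cmeasurableM => //; case: (P i) => //; exact: cmeasurable_cst.
Qed.

Lemma cmeasurable_cexp f : cmeasurable f -> cmeasurable (fun x => cexp (f x)).
Proof.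
move=> [mf1 mf2]; apply: cmeasurableM.
  by apply: cmeasurable_real; exact: measurableT_comp.
split => /=.
  apply: (@measurableT_comp _ _ _ _ _ _ cos) => //.
  by apply: continuous_measurable_fun; exact: continuous_cos.
apply: (@measurableT_comp _ _ _ _ _ _ sin) => //.
by apply: continuous_measurable_fun; exact: continuous_sin.
Qed.

Lemma cmeasurable_cpowR (f : T -> R) s :
  measurable_fun setT f -> cmeasurable (fun x => cpowR (f x) s).
Proof.
move=> mf; apply: cmeasurable_cexp; apply: cmeasurableM.
  exact: cmeasurable_cst.
apply: cmeasurable_real; apply: (@measurableT_comp _ _ _ _ _ _ (@ln R)) => //.
Qed.

Lemma cmeasurable_if (b : T -> bool) f g : measurable_fun setT b ->
  cmeasurable f -> cmeasurable g ->
  cmeasurable (fun x => if b x then f x else g x).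
Proof.
move=> mb [mf1 mf2] [mg1 mg2]; split.
  rewrite (_ : (fun _ => _) =
    fun x => if b x then complex.Re (f x) else complex.Re (g x)).
    exact: measurable_fun_ifT.
  by apply/funext => x; case: ifP.
rewrite (_ : (fun _ => _) =
  fun x => if b x then complex.Im (f x) else complex.Im (g x)).
  exact: measurable_fun_ifT.
by apply/funext => x; case: ifP.
Qed.

Lemma measurable_normc f : cmeasurable f ->
  measurable_fun setT (fun x => normc (f x)).
Proof.
move=> [mf1 mf2].
rewrite (_ : (fun _ => _) = fun x => Num.sqrt (((fun x => complex.Re (f x) ^+ 2) \+
    (fun x => complex.Im (f x) ^+ 2)) x)); last first.
  by apply/funext => x /=; case: (f x).
apply: (@measurableT_comp _ _ _ _ _ _ (@Num.sqrt R)).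
  by apply: continuous_measurable_fun; exact: sqrt_continuous.
by apply: measurable_funD; exact: measurable_funX.
Qed.

End complex_measurability.

Lemma cmeasurable_comp {R : realType} d1 d2 (T1 : measurableType d1)
    (T2 : measurableType d2) (f : T2 -> R[i]) (h : T1 -> T2) :
  cmeasurable f -> measurable_fun setT h -> cmeasurable (f \o h).
Proof.
move=> [mf1 mf2] mh; split.
- exact: (@measurableT_comp _ _ _ _ _ _ (fun x => complex.Re (f x))).
- exact: (@measurableT_comp _ _ _ _ _ _ (fun x => complex.Im (f x))).
Qed.

(** * Real integrals: linearity, Fubini, change of variables *)

Section real_integrals.
Context {R : realType} d (T : measurableType d) (mu : {measure set T -> \bar R}).
Implicit Types f g : T -> R.

(** Integrability and value travel together, so that each rule below transports both at once. *)
Definition hasR f v := mu.-integrable setT (EFin \o f) /\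
  (\int[mu]_x (f x)%:E = v%:E)%E.

Lemma hasR_ge0 f v : measurable_fun setT f -> (forall x, 0 <= f x) ->
  (\int[mu]_x (f x)%:E = v%:E)%E -> hasR f v.
Proof.
move=> mf f0 fv; split => //; apply/integrableP; split; first exact/measurable_EFinP.
under eq_integral do rewrite /= ger0_norm //.
by rewrite fv ltry.
Qed.

Lemma hasR_int f : mu.-integrable setT (EFin \o f) -> hasR f (\int[mu]_x f x).
Proof.
move=> fi; split => //; rewrite /Rintegral fineK //.
exact: (integrable_fin_num measurableT fi).
Qed.

Lemma hasR_uniq f v w : hasR f v -> hasR f w -> v = w.
Proof. by move=> [_ fv] [_ fw]; apply: EFin_inj; rewrite -fv fw. Qed.

Lemma hasRD f g v w : hasR f v -> hasR g w -> hasR (fun x => f x + g x) (v + w).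
Proof.
move=> [fi fv] [gi gw]; split.
  by have := integrableD measurableT fi gi.
by have := integralD measurableT fi gi; rewrite /= fv gw -EFinD.
Qed.

Lemma hasRZ k f v : hasR f v -> hasR (fun x => k * f x) (k * v).
Proof.
move=> [fi fv]; split; first by have := integrableZl measurableT k fi.
by have := integralZl measurableT fi k; rewrite fv.
Qed.

Lemma hasRN f v : hasR f v -> hasR (fun x => - f x) (- v).
Proof.
move=> /(hasRZ (-1)); rewrite mulN1r => h.
by rewrite (_ : (fun _ => _) = fun x => -1 * f x) //; apply/funext => x; rewrite mulN1r.
Qed.

Lemma hasR0 : hasR (fun=> 0) 0.
Proof. by split; [exact: integrable0|rewrite integral0]. Qed.

Lemma hasR_dom f g w : measurable_fun setT f -> (forall x, `|f x| <= g x) ->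
  hasR g w -> exists v, hasR f v.
Proof.
move=> mf fg [gi _]; exists (\int[mu]_x f x); apply: hasR_int.
apply: le_integrable gi => //; first exact/measurable_EFinP.
by move=> x _ /=; rewrite lee_fin (le_trans (fg x)) // ler_norm.
Qed.

Lemma hasR_le f g v w : (forall x, f x <= g x) -> hasR f v -> hasR g w -> v <= w.
Proof.
move=> fg [fi fv] [gi gw]; rewrite -lee_fin -fv -gw; apply: le_integral => //.
by move=> x _; rewrite lee_fin.
Qed.

Lemma hasR_ae f g v : measurable_fun setT g ->
  {ae mu, forall x, f x = g x} -> hasR f v -> hasR g v.
Proof.
move=> mg fg [fi fv].
have mf : measurable_fun setT (EFin \o f) by case/integrableP: fi.
have mg' : measurable_fun setT (EFin \o g) by exact/measurable_EFinP.
have gi : mu.-integrable setT (EFin \o g).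
  apply/integrableP; split => //.
  rewrite (@ae_eq_integral _ _ _ mu setT (abse \o (EFin \o f))) //.
  - by case/integrableP: fi.
  - exact: measurableT_comp.
  - exact: measurableT_comp.
  - by apply: filterS fg => x /= + _ => ->.
split => //; rewrite -fv; apply/esym/ae_eq_integral => //.
by apply: filterS fg => x /= + _ => ->.
Qed.

End real_integrals.

Section real_fubini.
Context {R : realType} d1 d2 (T1 : measurableType d1) (T2 : measurableType d2).
Variables (m1 : {sigma_finite_measure set T1 -> \bar R})
          (m2 : {sigma_finite_measure set T2 -> \bar R}).
Implicit Types f : T1 * T2 -> R.

(** Tonelli's condition is supplied by the integrals [G] of the absolute values of the sections;
    only the integrability of [G] matters, not its value. *)
Lemma hasR_fubini f g G v V : measurable_fun setT f ->
  (forall x, hasR m2 (fun y => f (x, y)) (g x)) ->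
  (forall x, hasR m2 (fun y => `|f (x, y)|) (G x)) ->
  hasR m1 G V -> hasR m1 g v -> hasR (m1 \x m2)%E f v.
Proof.
move=> mf fg fG [_ GV] [_ gv].
have mf' : measurable_fun setT (EFin \o f) by exact/measurable_EFinP.
have fi : (m1 \x m2)%E.-integrable setT (EFin \o f).
  apply/(integrable12ltyP _ _ mf') => /=.
  under eq_integral => x _ do rewrite (fG x).2.
  by rewrite GV ltry.
split => //; rewrite -(integral12_prod_meas1 fi) -gv.
by apply: eq_integral => x _; rewrite -(fg x).2.
Qed.

Lemma hasR_fubini_swap f g G v V : measurable_fun setT f ->
  (forall y, hasR m1 (fun x => f (x, y)) (g y)) ->
  (forall y, hasR m1 (fun x => `|f (x, y)|) (G y)) ->
  hasR m2 G V -> hasR m2 g v -> hasR (m1 \x m2)%E f v.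
Proof.
move=> mf fg fG [_ GV] [_ gv].
have mf' : measurable_fun setT (EFin \o f) by exact/measurable_EFinP.
have fi : (m1 \x m2)%E.-integrable setT (EFin \o f).
  apply/(integrable21ltyP _ _ mf') => /=.
  under eq_integral => x _ do rewrite (fG x).2.
  by rewrite GV ltry.
split => //; rewrite -(integral21_prod_meas1 fi) -gv.
by apply: eq_integral => y _; rewrite -(fg y).2.
Qed.

Lemma hasR_section f g v : hasR (m1 \x m2)%E f v ->
  (forall x, hasR m2 (fun y => f (x, y)) (g x)) -> hasR m1 g v.
Proof.
move=> [fi fv] fg.
have e : (fubini_F m2 (EFin \o f)) = EFin \o g.
  by apply/funext => x; rewrite /fubini_F /= (fg x).2.
split; first by rewrite -e; exact: integrable_fubini_F.
by rewrite -fv -(integral12_prod_meas1 fi); apply: eq_integral => x _; rewrite e.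
Qed.

Lemma hasR_section_swap f g v : hasR (m1 \x m2)%E f v ->
  (forall y, hasR m1 (fun x => f (x, y)) (g y)) -> hasR m2 g v.
Proof.
move=> [fi fv] fg.
have e : (fubini_G m1 (EFin \o f)) = EFin \o g.
  by apply/funext => x; rewrite /fubini_G /= (fg x).2.
have mf := measurable_int _ fi.
split.
  apply/integrableP; split; first by rewrite -e; exact: measurable_fubini_G fi.
  apply: le_lt_trans ((integrable21ltyP _ _ mf).1 fi).
  apply: ge0_le_integral => //.
  - by rewrite -e; apply: measurableT_comp => //; exact: measurable_fubini_G fi.
  - apply: (@measurable_fun_fubini_tonelli_G _ _ _ _ _ m1 (abse \o (EFin \o f))) => //.
      exact: measurableT_comp.
    by move=> z; rewrite lee_fin.
  - move=> y _; rewrite [X in (`|X| <= _)%E](_ : _ = (g y)%:E) // -(fg y).2; apply: le_abse_integral => //.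
    exact: (measurable_int _ (fg y).1).
by rewrite -fv -(integral21_prod_meas1 fi); apply: eq_integral => x _; rewrite e.
Qed.

End real_fubini.

Section change_of_variables.
Context {R : realType} d1 d2 (T1 : measurableType d1) (T2 : measurableType d2).
Variables (mu : {measure set T1 -> \bar R}) (nu : {measure set T2 -> \bar R}).
Variables (phi : T1 -> T2) (D : T1 -> R) (E : T2 -> R).

(** The image under [phi] of the measure with density [D] is the measure with density [E], expressed
    by testing on nonnegative functions. The densities also encode the domain and the range of the
    substitution by vanishing outside them. In this form changes of variables can be combined by
    Tonelli's theorem. *)
Definition chvar := forall f : T2 -> \bar R,
  measurable_fun setT f -> (forall y, (0 <= f y)%E) ->
  (\int[mu]_x (f (phi x) * (D x)%:E) = \int[nu]_y (f y * (E y)%:E))%E.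

Hypothesis phiDE : chvar.
Hypothesis mphi : measurable_fun setT phi.
Hypothesis mD : measurable_fun setT D.
Hypothesis mE : measurable_fun setT E.
Hypothesis D0 : forall x, 0 <= D x.
Hypothesis E0 : forall y, 0 <= E y.

Lemma hasR_chvar (g : T2 -> R) (v : R) : measurable_fun setT g ->
  hasR mu (fun x => g (phi x) * D x) v <-> hasR nu (fun y => g y * E y) v.
Proof.
move=> mg.
have mgD : measurable_fun setT (fun x => g (phi x) * D x).
  by apply: measurable_funM => //; exact: measurableT_comp.
have mgE : measurable_fun setT (fun y => g y * E y) by exact: measurable_funM.
have abs : (\int[mu]_x `|(g (phi x) * D x)%:E| = \int[nu]_y `|(g y * E y)%:E|)%E.
  under eq_integral do rewrite abse_EFin normrM (ger0_norm (D0 _)) EFinM.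
  under [RHS]eq_integral do rewrite abse_EFin normrM (ger0_norm (E0 _)) EFinM.
  apply: (phiDE (f := fun y => `|g y|%:E)) => //.
  by apply/measurable_EFinP; exact: measurableT_comp.
have iff : mu.-integrable setT (fun x => (g (phi x) * D x)%:E) <->
    nu.-integrable setT (fun y => (g y * E y)%:E).
  by split => /integrableP [_]; rewrite ?abs => h; apply/integrableP;
    split; rewrite ?abs //; exact/measurable_EFinP.
(* A nonnegative density factors out of the positive part, so [chvar] applies to the positive and
   negative parts of [g] separately. *)
have pos (h c : R) : 0 <= c -> maxe (h * c)%:E 0 = ((Num.max h 0)%:E * c%:E)%E.
  by move=> c0; rewrite -EFinM maxr_pMl // mul0r EFin_max.
have val : (\int[mu]_x (g (phi x) * D x)%:E = \int[nu]_y (g y * E y)%:E)%E.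
  rewrite integralE [RHS]integralE; congr (_ - _)%E.
    under eq_integral do rewrite funeposE pos //.
    under [RHS]eq_integral do rewrite funeposE pos //.
    apply: (phiDE (f := fun y => (Num.max (g y) 0)%:E)) => //.
      by apply/measurable_EFinP; exact: measurable_maxr.
    by move=> y; rewrite lee_fin le_max lexx orbT.
  under eq_integral do rewrite funenegE -EFinN -mulNr pos //.
  under [RHS]eq_integral do rewrite funenegE -EFinN -mulNr pos //.
  apply: (phiDE (f := fun y => (Num.max (- g y) 0)%:E)) => //.
    by apply/measurable_EFinP; apply: measurable_maxr => //; exact: measurableT_comp.
  by move=> y; rewrite lee_fin le_max lexx orbT.
by split => -[/iff i e]; split => //; rewrite -e -?val ?val.
Qed.

End change_of_variables.

(** * Complex integrals *)

Section complex_integrals.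
Context {R : realType} d (T : measurableType d) (mu : {measure set T -> \bar R}).
Implicit Types f g : T -> R[i].

Definition hasC f v := hasR mu (fun x => complex.Re (f x)) (complex.Re v) /\
  hasR mu (fun x => complex.Im (f x)) (complex.Im v).

Lemma hasC_uniq f v w : hasC f v -> hasC f w -> v = w.
Proof.
case: v w => [a b] [c e] [/= f1 f2] [/= g1 g2].
by rewrite (hasR_uniq f1 g1) (hasR_uniq f2 g2).
Qed.

Lemma hasC0 : hasC (fun=> 0) 0.
Proof. by split; exact: hasR0. Qed.

Lemma hasCD f g v w : hasC f v -> hasC g w -> hasC (fun x => f x + g x) (v + w).
Proof.
move=> [f1 f2] [g1 g2]; split.
  rewrite (_ : (fun _ => _) = fun x => complex.Re (f x) + complex.Re (g x)).
    by rewrite ReD; exact: hasRD.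
  by apply/funext => x; exact: ReD.
rewrite (_ : (fun _ => _) = fun x => complex.Im (f x) + complex.Im (g x)).
  by case: v w f1 f2 g1 g2 => [? ?] [? ?] /= *; exact: hasRD.
by apply/funext => x; case: (f x) (g x) => [? ?] [? ?].
Qed.

Lemma hasCZ k f v : hasC f v -> hasC (fun x => k * f x) (k * v).
Proof.
case: k v => [a b] [c e] [/= f1 f2]; split => /=.
  rewrite (_ : (fun _ => _) = fun x => a * complex.Re (f x) + - (b * complex.Im (f x))).
    by apply: hasRD; [|apply: hasRN]; exact: hasRZ.
  by apply/funext => x; case: (f x).
rewrite (_ : (fun _ => _) = fun x => a * complex.Im (f x) + b * complex.Re (f x)).
  by apply: hasRD; exact: hasRZ.
by apply/funext => x; case: (f x).
Qed.

Lemma hasCZ_inv k f v : k != 0 -> hasC (fun x => k * f x) v -> hasC f (k^-1 * v).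
Proof.
move=> k0 /(hasCZ k^-1) h.
rewrite (_ : f = fun x => k^-1 * (k * f x)) //.
by apply/funext => x; rewrite mulKf.
Qed.

Lemma hasC_dom f (g : T -> R) w : cmeasurable f -> (forall x, normc (f x) <= g x) ->
  hasR mu g w -> exists v, hasC f v.
Proof.
move=> [mf1 mf2] fg gw.
have [v1 h1] := hasR_dom mf1 (fun x => le_trans (normr_Re_le _) (fg x)) gw.
have [v2 h2] := hasR_dom mf2 (fun x => le_trans (normr_Im_le _) (fg x)) gw.
by exists (v1 +i* v2).
Qed.

Lemma hasC_ae f g v : cmeasurable g ->
  {ae mu, forall x, f x = g x} -> hasC f v -> hasC g v.
Proof.
move=> [mg1 mg2] fg [f1 f2]; split.
  by apply: hasR_ae f1 => //; apply: filterS fg => x ->.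
by apply: hasR_ae f2 => //; apply: filterS fg => x ->.
Qed.

End complex_integrals.

Section complex_fubini.
Context {R : realType} d1 d2 (T1 : measurableType d1) (T2 : measurableType d2).
Variables (m1 : {sigma_finite_measure set T1 -> \bar R})
          (m2 : {sigma_finite_measure set T2 -> \bar R}).
Implicit Types f : T1 * T2 -> R[i].

Lemma hasR_fubini_ge0 (f : T1 * T2 -> R) G V : measurable_fun setT f ->
  (forall z, 0 <= f z) ->
  (forall x, hasR m2 (fun y => f (x, y)) (G x)) -> hasR m1 G V ->
  hasR (m1 \x m2)%E f V.
Proof.
move=> mf f0 fG GV; apply: hasR_fubini (GV) (GV) => // x.
by under eq_fun do rewrite ger0_norm //.
Qed.

Lemma hasR_fubini_ge0_swap (f : T1 * T2 -> R) G V : measurable_fun setT f ->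
  (forall z, 0 <= f z) ->
  (forall y, hasR m1 (fun x => f (x, y)) (G y)) -> hasR m2 G V ->
  hasR (m1 \x m2)%E f V.
Proof.
move=> mf f0 fG GV; apply: hasR_fubini_swap (GV) (GV) => // x.
by under eq_fun do rewrite ger0_norm //.
Qed.

Let integrable_normc f v : cmeasurable f -> hasR (m1 \x m2)%E (fun z => normc (f z)) v ->
  exists w, hasC (m1 \x m2)%E f w.
Proof. by move=> mf; apply: hasC_dom => // x; exact: lexx. Qed.

(** The converse of Fubini's computation: once the double integral is known from one order, the
    iterated integral in the other order has the same value. The Selberg integral is obtained in
    this way, and the beta integral from the mirrored version. *)
Lemma hasC_section f g v : hasC (m1 \x m2)%E f v ->
  (forall x, hasC m2 (fun y => f (x, y)) (g x)) -> hasC m1 g v.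
Proof.
by move=> [f1 f2] fg; split; [apply: (hasR_section f1)|apply: (hasR_section f2)] => x;
  have [] := fg x.
Qed.

Lemma hasC_section_swap f g v : hasC (m1 \x m2)%E f v ->
  (forall y, hasC m1 (fun x => f (x, y)) (g y)) -> hasC m2 g v.
Proof.
by move=> [f1 f2] fg; split; [apply: (hasR_section_swap f1)|apply: (hasR_section_swap f2)]
  => x; have [] := fg x.
Qed.

(** In the applications [G] is the same closed formula as [g], taken at the real parts of the
    parameters. Integrability gives some value for the double integral, and [hasC_section]
    identifies it with [v]. *)
Lemma hasC_fubini f g G v V : cmeasurable f ->
  (forall x, hasC m2 (fun y => f (x, y)) (g x)) ->
  (forall x, hasR m2 (fun y => normc (f (x, y))) (G x)) ->
  hasR m1 G V -> hasC m1 g v -> hasC (m1 \x m2)%E f v.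
Proof.
move=> mf fg fG GV gv.
have nf : hasR (m1 \x m2)%E (fun z => normc (f z)) V.
  apply: (@hasR_fubini_ge0 (fun z => normc (f z))) (GV) => //.
    exact: measurable_normc.
  by move=> z; exact: normc_ge0.
have [w fw] := integrable_normc mf nf.
by rewrite (hasC_uniq gv (hasC_section fw fg)).
Qed.

Lemma hasC_fubini_swap f g G v V : cmeasurable f ->
  (forall y, hasC m1 (fun x => f (x, y)) (g y)) ->
  (forall y, hasR m1 (fun x => normc (f (x, y))) (G y)) ->
  hasR m2 G V -> hasC m2 g v -> hasC (m1 \x m2)%E f v.
Proof.
move=> mf fg fG GV gv.
have nf : hasR (m1 \x m2)%E (fun z => normc (f z)) V.
  apply: (@hasR_fubini_ge0_swap (fun z => normc (f z))) (GV) => //.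
    exact: measurable_normc.
  by move=> z; exact: normc_ge0.
have [w fw] := integrable_normc mf nf.
by rewrite (hasC_uniq gv (hasC_section_swap fw fg)).
Qed.

End complex_fubini.

Lemma hasC_chvar {R : realType} d1 d2 (T1 : measurableType d1)
    (T2 : measurableType d2) (mu : {measure set T1 -> \bar R})
    (nu : {measure set T2 -> \bar R}) (phi : T1 -> T2) (D : T1 -> R) (E : T2 -> R) (g : T2 -> R[i]) v :
  chvar mu nu phi D E ->
  measurable_fun setT phi -> measurable_fun setT D -> measurable_fun setT E ->
  (forall x, 0 <= D x) -> (forall y, 0 <= E y) -> cmeasurable g ->
  hasC mu (fun x => g (phi x) * (D x)%:C) v <-> hasC nu (fun y => g y * (E y)%:C) v.
Proof.
move=> DE mphi mD mE D0 E0 [mg1 mg2].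
have re T (x : R[i]) (c : T -> R) t : complex.Re (x * (c t)%:C) = complex.Re x * c t.
  by case: x => ? ?; rewrite /= mulr0 subr0.
have im T (x : R[i]) (c : T -> R) t : complex.Im (x * (c t)%:C) = complex.Im x * c t.
  by case: x => ? ?; rewrite /= mulr0 add0r.
rewrite /hasC.
under eq_fun do rewrite re.
under [X in hasR mu X (complex.Im v)]eq_fun do rewrite im.
under [X in hasR nu X (complex.Re v)]eq_fun do rewrite re.
under [X in hasR nu X (complex.Im v)]eq_fun do rewrite im.
have h1 := hasR_chvar DE mphi mD mE D0 E0 (complex.Re v) mg1.
have h2 := hasR_chvar DE mphi mD mE D0 E0 (complex.Im v) mg2.
by split => -[/h1 ? /h2 ?].
Qed.

(** * One-dimensional changes of variables *)

Lemma ge0_integral_mrestr {R : realType} d (T : measurableType d)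
    (m : {measure set T -> \bar R}) (S : set T) (mS : measurable S) (f : T -> \bar R) :
  measurable_fun setT f -> (forall x, (0 <= f x)%E) ->
  (\int[mrestr m mS]_x f x = \int[m]_(x in S) f x)%E.
Proof.
move=> mf f0.
rewrite -(setUv S) ge0_integral_setU //; last first.
- exact/disj_setPCl.
- exact: measurable_funTS.
- exact: measurableC.
rewrite [X in (_ + X)%E](_ : _ = 0%E) ?adde0; last first.
  rewrite -[LHS]gee0_abs ?integral_ge0 //.
  rewrite (eq_integral (fun x => `|f x|%E)); last by move=> x _; rewrite gee0_abs.
  rewrite gee0_abs ?integral_ge0 //; apply: integral_abs_eq0.
  - exact: measurableC.
  - exact: measurable_funTS.
  - by rewrite /= /mrestr setICl measure0.
by apply: eq_measure_integral => A mA AS; rewrite /= /mrestr setIidl.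
Qed.

(* The image of the measure with density [D] is realised as the image of the
   product measure of the region under the graph of [D]. *)
Lemma density_pushforward {R : realType} d1 d2 (T1 : measurableType d1)
    (T2 : measurableType d2) (mu : {sigma_finite_measure set T1 -> \bar R})
    (phi : T1 -> T2) (D : T1 -> R) :
  measurable_fun setT phi -> measurable_fun setT D -> (forall x, 0 <= D x) ->
  exists m : {measure set T2 -> \bar R}, forall f : T2 -> \bar R,
    measurable_fun setT f -> (forall y, (0 <= f y)%E) ->
    (\int[m]_y f y = \int[mu]_x (f (phi x) * (D x)%:E))%E.
Proof.
move=> mphi mD D0.
pose S : set (T1 * measurableTypeR R) := [set z | (0 <= z.2) && (z.2 < D z.1)].
have mb : measurable_fun setT (fun z : T1 * measurableTypeR R => (0 <= z.2) && (z.2 < D z.1)).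
  apply: measurable_and; first exact: measurable_fun_ler.
  by apply: measurable_fun_ltr => //; exact: measurableT_comp.
have mS : measurable S.
  by have := mb measurableT [set true]; rewrite setTI; apply.
have mpsi : measurable_fun setT (fun z : T1 * measurableTypeR R => phi z.1).
  exact: measurableT_comp.
pose psi (z : T1 * measurableTypeR R) := phi z.1.
pose m0 : {measure set T2 -> \bar R} :=
  pushforward (mrestr (mu \x lebesgue_measure)%E mS) psi.
pose m := m0 mpsi.
exists m => f mf f0.
rewrite /m /m0 ge0_integral_pushforward //.
rewrite preimage_setT ge0_integral_mrestr; last 2 first.
- exact: measurableT_comp.
- by move=> z; exact: f0.
rewrite integral_mkcond.
have mF : measurable_fun setT (((f \o psi) \_ S) : T1 * measurableTypeR R -> \bar R).
  apply/(measurable_restrictT _ mS).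
  by apply: measurable_funTS; exact: measurableT_comp.
rewrite (fubini_tonelli1 ((f \o psi) \_ S)) //; last first.
  by move=> z; apply: erestrict_ge0 => y _ /=; exact: f0.
apply: eq_integral => x _; rewrite /fubini_F.
transitivity (\int[@lebesgue_measure R]_y
    (f (phi x) * (\1_(`[0%R, D x[%classic : set (measurableTypeR R)) y)%:E))%E.
  apply: eq_integral => y _; rewrite patchE indicE /=.
  rewrite (_ : ((x, y) \in S) = (y \in `[0%R, D x[%classic)); last first.
    by apply/idP/idP; rewrite !inE /S /= ?in_itv /=.
  by case: (_ \in _); rewrite ?mule1 ?mule0.
rewrite ge0_integralZl //; last first.
- by apply/measurable_EFinP; exact: measurable_indic.
rewrite integral_indic // setIT.
rewrite [X in (_ * X)%E](lebesgue_measure_itv `[0%R, D x[) /= lte_fin.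
case: ltP => [//|]; first by rewrite sube0.
by move=> Dx0; rewrite (_ : D x = 0) //; apply/eqP; rewrite eq_le Dx0 D0.
Qed.

(** Both sides integrate [f] against a measure on the line: the image under [phi] of the measure
    with density [D], and Lebesgue measure on the positive half-line. Half-open intervals form a
    generating family stable under intersection, so it is enough that the two measures agree
    there. *)
Lemma chvar_lebesgue {R : realType} d1 (T1 : measurableType d1)
    (mu : {sigma_finite_measure set T1 -> \bar R}) (phi : T1 -> measurableTypeR R)
    (D : T1 -> R) :
  measurable_fun setT phi -> measurable_fun setT D -> (forall x, 0 <= D x) ->
  (forall u v : R, 0 <= u -> u < v ->
     (\int[mu]_x (if ((u < phi x) && (phi x <= v))%R then D x else 0)%R%:E = (v - u)%:E)%E) ->
  (forall x, phi x <= 0 -> D x = 0) ->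
  chvar mu lebesgue_measure phi D (fun y => if 0 < y then 1 else 0).
Proof.
move=> mphi mD D0 Duv Dneg.
pose E (y : measurableTypeR R) : R := if 0 < y then 1 else 0.
have mE : measurable_fun setT E.
  by apply: measurable_fun_ifT => //; exact: measurable_fun_ltr.
have E0 y : 0 <= E y by rewrite /E; case: ifP.
have [m1 m1E] := density_pushforward mu mphi mD D0.
have [m2 m2E] := @density_pushforward _ _ _ _ _ (@lebesgue_measure R) _ E
   (@measurable_id _ _ setT) mE E0.
move=> f mf f0; rewrite -m1E // -[RHS]m2E //.
have msr (A : set (measurableTypeR R)) (m : {measure set (measurableTypeR R) -> \bar R}) :
    measurable A -> m A = (\int[m]_y (\1_A y)%:E)%E.
  by move=> mA; rewrite integral_indic // setIT.
have i0 (A : set (measurableTypeR R)) y : (0 <= (\1_A y)%:E :> \bar R)%E.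
  by rewrite lee_fin.
have mi (A : set (measurableTypeR R)) : measurable A ->
    measurable_fun setT (fun y => (\1_A y)%:E : \bar R).
  by move=> mA; apply/measurable_EFinP; exact: measurable_indic.
have ocE (u v : R) : m1 `]u, v]%classic = m2 `]u, v]%classic.
  rewrite !msr // m1E ?m2E //; try exact: mi.
  (* Both measures are carried by the positive half-line, so the end points may be truncated at 0,
     where the hypothesis on [D] applies. *)
  pose u' := Num.max u 0; pose v' := Num.max v 0.
  have u'v' : u' <= u' /\ 0 <= u' by split => //; rewrite /u' le_max lexx orbT.
  have [uv|vu] := ltP u' v'; last first.
    rewrite !integral0_eq // => x _; rewrite indicE.
      case: (boolP (x \in _)) => [|_]; last by rewrite mul0e.
      rewrite inE /= in_itv /= => /andP[ux xv]; rewrite /E ltNge.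
      suff -> : x <= 0 by rewrite mule0.
      rewrite leNgt; apply/negP => x0; move: vu; rewrite leNgt => /negP; apply.
      by rewrite /u' /v' gt_max !lt_max (lt_le_trans ux xv) (lt_le_trans x0 xv).
    case: (boolP (_ \in _)) => [|_]; last by rewrite mul0e.
    rewrite inE /= in_itv /= => /andP[ux xv].
    rewrite Dneg ?mule0 //.
    rewrite leNgt; apply/negP => x0; move: vu; rewrite leNgt => /negP; apply.
    by rewrite /u' /v' gt_max !lt_max (lt_le_trans ux xv) (lt_le_trans x0 xv).
  have key (y : R) : 0 < y -> ((u < y) && (y <= v)) = ((u' < y) && (y <= v')).
    by move=> y0; rewrite /u' /v' gt_max le_max y0 andbT [y <= 0]leNgt y0 orbF.
  transitivity ((v' - u')%:E : \bar R).
    rewrite -(Duv u' v' u'v'.2 uv); apply: eq_integral => x _.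
    rewrite indicE mem_setE in_itv /=.
    have [p0|p0] := ltP 0 (phi x); last by rewrite (Dneg _ p0) mule0 if_same.
    by rewrite key //; case: ifP; rewrite ?mul1e ?mul0e.
  transitivity (\int[lebesgue_measure]_x (\1_(`]u', v']%classic : set R) x)%:E)%E.
    rewrite integral_indic // setIT.
    by rewrite [RHS](lebesgue_measure_itv `]u', v']) /= lte_fin uv EFinB.
  apply: eq_integral => x _; rewrite !indicE !mem_setE !in_itv /= /E.
  have [p0|p0] := ltP 0 x; first by rewrite key // mule1.
  rewrite mule0 (_ : (u' < x) = false) //.
  by apply/negbTE; rewrite -leNgt (le_trans p0 u'v'.2).
apply: eq_measure_integral => A mA _.
pose g (k : nat) : set (measurableTypeR R) := `]- k%:R, k%:R]%classic.
apply: (@measure_unique _ _ (measurableTypeR R) (@ocitv R) g _ _ _ _ m1 m2) => //.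
- exact: ocitvI.
- by move=> k; exact: is_ocitv.
- apply/seteqP; split => // x _; exists (Num.truncn `|x|).+1 => //.
  have := truncnS_gt `|x|; rewrite ltr_norml => /andP[x1 x2].
  by rewrite /g /= in_itv /= x1 ltW.
- by move=> _ [[a b]] _ <-; exact: ocE.
- move=> k; rewrite ocE msr // m2E //; last exact: mi.
  apply: (@le_lt_trans _ _ (\int[lebesgue_measure]_x (\1_(g k) x)%:E)%E).
    apply: ge0_le_integral => //.
    + by move=> x _; rewrite mule_ge0 // lee_fin.
    + apply: emeasurable_funM; first exact: mi.
      exact/measurable_EFinP.
    + by apply: mi; exact: measurable_itv.
    + move=> x _; rewrite -EFinM lee_fin ler_piMr // /E.
      by case: ifP.
  rewrite integral_indic //; last exact: measurable_itv.
  rewrite setIT.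
  rewrite [X in (X < _)%E](lebesgue_measure_itv `]- k%:R, k%:R]) /=.
  by case: ifP => _ //; rewrite -EFinB ltry.
Qed.

(** Inversion is discontinuous at 0, where it takes the value 0, so a formula through [expR] and
    [ln] is used on each sign. *)
Lemma measurable_invr {R : realType} : measurable_fun setT (@GRing.inv R).
Proof.
rewrite (_ : GRing.inv = fun x : R => if 0 < x then expR (- ln x)
    else if x < 0 then - expR (- ln (- x)) else 0); last first.
  apply/funext => x; have [x0|x0|->] := ltgtP x 0; last by rewrite invr0.
    by rewrite expRN lnK ?posrE ?oppr_gt0 // invrN opprK.
  by rewrite expRN lnK ?posrE.
apply: measurable_fun_ifT.
- exact: measurable_fun_ltr.
- apply: (@measurableT_comp _ _ _ _ _ _ (@expR R)) => //.
  by apply: measurableT_comp => //; exact: measurable_ln.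
- apply: measurable_fun_ifT => //; first exact: measurable_fun_ltr.
  apply: measurableT_comp => //.
  apply: (@measurableT_comp _ _ _ _ _ _ (@expR R)) => //.
  apply: measurableT_comp => //.
  by apply: (@measurableT_comp _ _ _ _ _ _ (@ln R)).
Qed.

Lemma measurable_funV {R : realType} d (T : measurableType d) (f : T -> R) :
  measurable_fun setT f -> measurable_fun setT (fun x => (f x)^-1).
Proof. by move=> mf; apply: measurableT_comp => //; exact: measurable_invr. Qed.

(** The preimage of []u, v]] is an interval []x, y]] with [h x = u] and [h y = v], over which [h']
    integrates to [v - u]. Regularity is assumed at the left end [a] as well, so that [u = 0] is
    reached; the density leaves [a] out because it has to vanish wherever [h] is not positive. *)
Lemma chvar_increasing {R : realType} (h h' : R -> R) (a : R) (b : itv_bound R) :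
  measurable_fun setT h -> measurable_fun setT h' ->
  h a = 0 ->
  {in Interval (BLeft a) b, forall x : R, is_derive x (1 : R) h (h' x)} ->
  {in Interval (BLeft a) b, continuous h'} ->
  {in Interval (BLeft a) b, forall x, 0 <= h' x} ->
  {in Interval (BLeft a) b &, {homo h : x y / x < y}} ->
  (forall v, 0 <= v -> exists2 x, x \in Interval (BLeft a) b & h x = v) ->
  chvar (@lebesgue_measure R) (@lebesgue_measure R) h
    (fun x => if x \in Interval (BRight a) b then h' x else 0)
    (fun y => if 0 < y then 1 else 0).
Proof.
move=> mh mh' ha dh ch' h'0 hmono hsurj.
have sub x : x \in Interval (BRight a) b -> x \in Interval (BLeft a) b.
  by move: b {dh ch' h'0 hmono hsurj} => [[] b|[]]; rewrite !in_itv /= => /andP[/ltW ->].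
have aI0 x : x \in Interval (BRight a) b -> a \in Interval (BLeft a) b.
  move=> /sub; move: b {dh ch' h'0 hmono hsurj sub} => [[] b|[]]; rewrite !in_itv /= ?lexx //=.
  - by case/andP => /le_lt_trans /[apply].
  - by case/andP => /le_trans /[apply].
  - by rewrite andbF.
have ltI x : x \in Interval (BRight a) b -> a < x.
  by move: b {dh ch' h'0 hmono hsurj sub aI0} => [[] b|[]]; rewrite !in_itv /= => /andP[].
have hpos x : x \in Interval (BRight a) b -> 0 < h x.
  by move=> xI; rewrite -ha; apply: hmono; [exact: aI0 xI|exact: sub|exact: ltI].
have aI x : x \in Interval (BLeft a) b -> a <= x.
  by move: b {dh ch' h'0 hmono hsurj sub aI0 ltI hpos} => [[] b|[]]; rewrite !in_itv /= => /andP[].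
have conv x y z : x \in Interval (BLeft a) b -> y \in Interval (BLeft a) b ->
    x <= z <= y -> z \in Interval (BLeft a) b.
  move: b {dh ch' h'0 hmono hsurj sub aI0 ltI hpos aI} => [[] b|[]]; rewrite !in_itv //=.
  - by move=> /andP[ax _] /andP[_ yb] /andP[xz zy]; rewrite (le_trans ax xz) (le_lt_trans zy yb).
  - by move=> /andP[ax _] /andP[_ yb] /andP[xz zy]; rewrite (le_trans ax xz) (le_trans zy yb).
  - by move=> /andP[_ ].
  - by rewrite !andbT => ax _ /andP[xz _]; rewrite (le_trans ax xz).
have mI : measurable_fun setT (fun x : R => x \in Interval (BRight a) b).
  apply: (measurable_fun_bool true); rewrite setTI.
  rewrite (_ : _ @^-1` _ = [set` Interval (BRight a) b]); last first.
    by apply/seteqP; split => x /=.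
  exact: measurable_itv.
apply: chvar_lebesgue => //.
- exact: measurable_fun_ifT.
- by move=> x; case: ifP => // /sub /h'0.
- move=> u v u0 uv.
  have [x xI hx] := hsurj u u0.
  have [y yI hy] := hsurj v (le_trans u0 (ltW uv)).
  have xy : x < y.
    rewrite ltNge; apply/negP; rewrite le_eqVlt => /predU1P[yx|yx].
      by move: uv; rewrite -hx -hy yx ltxx.
    by have := hmono _ _ yI xI yx; rewrite hx hy ltNge (ltW uv).
  have ch x0 : x0 \in Interval (BLeft a) b -> {for x0, continuous h}.
    by move=> x0I; apply: differentiable_continuous; apply/derivable1_diffP;
      have := dh _ x0I; case.
  have inI z : z \in `[x, y] -> z \in Interval (BLeft a) b.
    by rewrite in_itv /= => /(conv _ _ _ xI yI).
  transitivity (\int[@lebesgue_measure R]_(z in `]x, y]) (h' z)%:E)%E.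
    rewrite [RHS]integral_mkcond; apply: eq_integral => z _.
    rewrite patchE mem_setE.
    have -> : (z \in `]x, y]) =
        ((z \in Interval (BRight a) b) && ((u < h z) && (h z <= v))).
      rewrite [LHS]in_itv /=; apply/idP/idP.
        move=> /andP[xz zy].
        have zI : z \in Interval (BLeft a) b by apply: inI; rewrite in_itv /= (ltW xz).
        rewrite -hx -hy hmono //= andbC.
        have -> /= : h z <= h y.
          by move: zy; rewrite le_eqVlt => /predU1P[->//|zy]; apply/ltW/hmono.
        move: zI (le_lt_trans (aI _ xI) xz).
        by move: b {dh ch' h'0 hmono hsurj sub aI0 ltI hpos aI conv mI ch inI xI yI} => [[] b|[]];
          rewrite !in_itv //= => + ->; case/andP.
      move=> /andP[zI /andP[uz zv]].
      apply/andP; split; [rewrite ltNge|rewrite leNgt]; apply/negP.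
        rewrite le_eqVlt => /predU1P[zx|zx].
          by move: uz; rewrite -hx zx ltxx.
        by have := hmono _ _ (sub _ zI) xI zx; rewrite hx ltNge (ltW uz).
      by move=> yz; have := hmono _ _ yI (sub _ zI) yz; rewrite hy ltNge zv.
    by case: (z \in Interval _ _) => /=; case: ifP.
  rewrite integral_itv_obnd_cbnd; last first.
    by apply/measurable_EFinP; exact: measurable_funTS.
  rewrite (@continuous_FTC2 _ h' h) //.
  - by rewrite hx hy EFinB.
  - by apply: continuous_in_subspaceT => z; rewrite inE /= => /inI /ch'.
  - split.
    + by move=> z; rewrite in_itv /= => /andP[xz zy];
        have := dh z (inI z _); rewrite in_itv /= !ltW // => /(_ isT); case.
    + by apply: cvg_at_right_filter; exact: ch.
    + by apply: cvg_at_left_filter; exact: ch.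
  - move=> z; rewrite in_itv /= => /andP[xz zy].
    have := dh z (inI z _); rewrite in_itv /= !ltW // => /(_ isT) dz.
    by rewrite derive1E derive_val.
- by move=> x hx; case: ifP => // /hpos; rewrite ltNge hx.
Qed.

Lemma hasC_mkcond {R : realType} d (T : measurableType d) (mu : {measure set T -> \bar R})
    (D : set T) (f : T -> R[i]) v : measurable D ->
  hasC mu (fun x => if x \in D then f x else 0) v ->
  cintegrable mu D f /\ cintegral mu D f = v.
Proof.
move=> mD [[f1 e1] [f2 e2]].
have re : (fun x => complex.Re (if x \in D then f x else 0)) =
    (fun x => complex.Re (f x)) \_ D.
  by apply/funext => x; rewrite patchE; case: ifP.
have im : (fun x => complex.Im (if x \in D then f x else 0)) =
    (fun x => complex.Im (f x)) \_ D.
  by apply/funext => x; rewrite patchE; case: ifP.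
split; first split.
- by apply/(integrable_mkcond _ mD); move: f1; rewrite re restrict_EFin.
- by apply/(integrable_mkcond _ mD); move: f2; rewrite im restrict_EFin.
- rewrite /cintegral Rintegral_mkcond [X in _ +i* X]Rintegral_mkcond.
  rewrite /Rintegral -re -im e1 e2.
  by case: v {f1 e1 f2 e2}.
Qed.

(** * Gamma and beta integrals *)

Section scaling.
Context {R : realType}.

Lemma chvar_scale (c : R) : 0 < c ->
  chvar (@lebesgue_measure R) (@lebesgue_measure R) (fun x => c * x)
    (fun x => if 0 < x then c else 0) (fun y => if 0 < y then 1 else 0).
Proof.
move=> c0; rewrite [X in chvar _ _ _ X _](_ : _ =
  fun x => if x \in `]0, +oo[%R then (fun=> c) x else 0); last first.
  by apply/funext => x; rewrite in_itv /= andbT.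
apply: chvar_increasing.
- exact: measurable_funM.
- exact: measurable_cst.
- by rewrite mulr0.
- by move=> x _; apply: is_derive_eq; rewrite /GRing.scale /=; ring.
- by move=> x _; exact: cst_continuous.
- by move=> x _; exact: ltW.
- by move=> x y _ _ xy; rewrite ltr_pM2l.
- move=> v v0; exists (v / c); last by rewrite mulrC divfK ?gt_eqF.
  by rewrite in_itv /= divr_ge0 // ltW.
Qed.

Lemma hasC_scale (c : R) (g : R -> R[i]) v : 0 < c -> cmeasurable g ->
  hasC (@lebesgue_measure R) (fun x => if 0 < x then g x else 0) v ->
  hasC (@lebesgue_measure R) (fun x => if 0 < x then g (c * x) else 0) (c^-1%:C * v).
Proof.
move=> c0 mg gv.
have mc : measurable_fun setT (fun x : R => if 0 < x then c else 0).
  by apply: measurable_fun_ifT => //; exact: measurable_fun_ltr.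
have m1 : measurable_fun setT (fun x : R => if 0 < x then 1 else 0 : R).
  by apply: measurable_fun_ifT => //; exact: measurable_fun_ltr.
have p1 (y : R) : 0 <= (if 0 < y then 1 else 0 : R) by case: ifP.
have pc (y : R) : 0 <= (if 0 < y then c else 0 : R) by case: ifP => // _; exact: ltW.
have e : (fun x : R => if 0 < x then g x else 0) = fun x => g x * (if 0 < x then 1 else 0)%:C.
  by apply/funext => x; case: ifP => _; rewrite ?mulr1 ?mulr0.
rewrite e in gv.
have h := (hasC_chvar v (chvar_scale c0) (@mulrl_measurable _ _ c) mc m1 pc p1 mg).2 gv.
have := hasCZ c^-1%:C h; congr (hasC _ _ _); apply/funext => x.
case: ifP => _; last by rewrite !mulr0.
by rewrite mulrCA -rmorphM mulVf ?gt_eqF // mulr1.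
Qed.

End scaling.

Section gamma_integrable.
Context {R : realType}.
Notation lambda := (@lebesgue_measure R).

Lemma chvar_exprn (k : nat) :
  chvar lambda lambda (fun x => x ^+ k.+1)
    (fun x => if 0 < x then k.+1%:R * x ^+ k else 0) (fun y => if 0 < y then 1 else 0).
Proof.
rewrite [X in chvar _ _ _ X _](_ : _ =
  fun x => if x \in `]0, +oo[%R then (fun x => k.+1%:R * x ^+ k) x else 0); last first.
  by apply/funext => x; rewrite in_itv /= andbT.
apply: chvar_increasing.
- exact: measurable_funX.
- by apply: measurable_funM => //; exact: measurable_funX.
- by rewrite expr0n.
- move=> x _; rewrite (_ : (fun x => x ^+ k.+1) = (@id R : R -> R) ^+ k.+1).
    by apply: is_derive_eq; rewrite /GRing.scale /= mulr1.
  by apply/funext => z; rewrite exprfctE.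
- move=> x _; apply: (@cvgM _ R); first exact: cvg_cst.
  exact: exprn_continuous.
- by move=> x; rewrite in_itv /= andbT => x0; rewrite mulr_ge0 // exprn_ge0.
- move=> x y; rewrite !in_itv /= !andbT => x0 y0 xy.
  by rewrite ltrXn2r.
- move=> v v0; exists (v `^ (k.+1%:R^-1)); first by rewrite in_itv /= powR_ge0.
  rewrite -powR_mulrn ?powR_ge0 // -powRrM.
  have -> : k.+1%:R^-1 * k.+1%:R = 1 :> R by rewrite mulVf // pnatr_eq0.
  by rewrite powRr1.
Qed.

(** The substitution [x = y ^ (k + 1)] with [(k + 1) a >= 1] turns the singular power into
    [(k + 1) y ^ ((k + 1) a - 1)], which is bounded on []0, 1[]. *)
Lemma hasR_pow_near0 (a : R) : 0 < a -> exists v,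
  hasR lambda (fun x => if 0 < x then (if x < 1 then expR ((a - 1) * ln x) else 0) else 0) v.
Proof.
move=> a0.
have [k ka] : exists k : nat, 1 <= k.+1%:R * a.
  exists (Num.truncn a^-1).
  have := ltW (truncnS_gt a^-1).
  by rewrite -(@ler_pM2r _ a a0 a^-1) mulVf ?gt_eqF.
pose g (x : R) := if x < 1 then expR ((a - 1) * ln x) else 0.
have mg : measurable_fun setT g.
  apply: measurable_fun_ifT => //; first exact: measurable_fun_ltr.
  apply: measurableT_comp => //; apply: measurable_funM => //.
have mD : measurable_fun setT (fun x : R => if 0 < x then k.+1%:R * x ^+ k else 0).
  apply: measurable_fun_ifT => //; first exact: measurable_fun_ltr.
  by apply: measurable_funM => //; exact: measurable_funX.
have m1 : measurable_fun setT (fun x : R => if 0 < x then 1 else 0 : R).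
  by apply: measurable_fun_ifT => //; exact: measurable_fun_ltr.
have p1 (y : R) : 0 <= (if 0 < y then 1 else 0 : R) by case: ifP.
have pD (y : R) : 0 <= (if 0 < y then k.+1%:R * y ^+ k else 0 : R).
  by case: ifP => // /ltW y0; rewrite mulr_ge0 // exprn_ge0.
have b1 : hasR lambda (fun x => k.+1%:R * (\1_(`]0, 1[%classic : set R)) x) (k.+1%:R * 1).
  apply: hasRZ; apply: hasR_ge0 => [||].
  - exact: measurable_indic.
  - by move=> x; rewrite indicE.
  - rewrite integral_indic // setIT [LHS](lebesgue_measure_itv `]0, 1[) /=.
    by rewrite lte_fin ltr01 sube0.
have [v hv] : exists v, hasR lambda (fun x => g (x ^+ k.+1) *
    (if 0 < x then k.+1%:R * x ^+ k else 0)) v.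
  apply: hasR_dom b1.
    by apply: measurable_funM => //; apply: measurableT_comp => //; exact: measurable_funX.
  move=> x; rewrite indicE mem_setE in_itv /=.
  have [x0|x0] := ltP 0 x; last by rewrite mulr0 normr0 mulr0.
  rewrite /g expr_lt1 ?(ltW x0) //=.
  case: ltP => x1 /=; last by rewrite mul0r normr0 mulr0.
  rewrite mulr1 ger0_norm; last first.
    by rewrite mulr_ge0 ?expR_ge0 // mulr_ge0 // exprn_ge0 // ltW.
  rewrite mulrCA ler_piMr //.
  rewrite lnXn // -[x in _ * x ^+ _](lnK x0) -expRM_natl -expRD.
  rewrite -[leRHS]expR0 ler_expR.
  rewrite [X in X <= _](_ : _ = (k.+1%:R * a - 1) * ln x); last first.
    by rewrite -mulr_natl -natr1; ring.
  by apply: mulr_ge0_le0; [rewrite subr_ge0|exact: ln_le0 (ltW x1)].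
exists v.
have := (hasR_chvar (chvar_exprn k) (@measurable_funX _ _ _ _ _ k.+1 (@measurable_id _ _ setT)) mD m1 pD p1 v mg).1 hv.
congr (hasR _ _ _); apply/funext => x; rewrite /g.
by case: (0 < x); rewrite ?mulr1 ?mulr0.
Qed.

End gamma_integrable.

Section gamma_function.
Context {R : realType}.
Notation lambda := (@lebesgue_measure R).

(** Below 1 the power dominates; from 1 on, a multiple of the exponential density of rate 1/2
    does. *)
Let hasR_gamma_abs (a : R) : 0 < a -> exists v,
  hasR lambda (fun x => if 0 < x then expR ((a - 1) * ln x) * expR (- x) else 0) v.
Proof.
move=> a0.
have [v hv] := hasR_pow_near0 a0.
(* The inequality [ln x <= x / c + |ln c|] bounds [M ln x] by [M x / c + M |ln c|]. The choice of
   [c] makes the first term at most [x / 2], half of the available decay, and [K] absorbs the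
   second. *)
pose M := `|a - 1|; pose c := 2 * (M + 1); pose K := expR (M * `|ln c|).
have M0 : 0 <= M by exact: normr_ge0.
have c0 : 0 < c by rewrite mulr_gt0 // ltr_wpDl.
have hexp : hasR lambda (@exponential_pdf R (2^-1)) 1.
  apply: hasR_ge0.
  - exact: measurable_exponential_pdf.
  - by move=> x; apply: exponential_pdf_ge0; rewrite invr_ge0.
  - by apply: integral_exponential_pdf; rewrite invr_gt0.
have hdom := hasRD hv (hasRZ (2 * K) hexp).
apply: hasR_dom hdom.
  apply: measurable_fun_ifT => //; first exact: measurable_fun_ltr.
  apply: measurable_funM.
    apply: measurableT_comp => //; exact: measurable_funM.
  by apply: measurableT_comp => //; exact: measurableT_comp.
move=> x; rewrite ger0_norm; last first.
  by case: ifP => // _; rewrite mulr_ge0 ?expR_ge0.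
have p0 : 0 <= 2 * K * @exponential_pdf R (2^-1) x.
  rewrite mulr_ge0 //; first by rewrite mulr_ge0 // expR_ge0.
  by apply: exponential_pdf_ge0; rewrite invr_ge0.
have [x0|x0] := ltP 0 x; last by rewrite add0r.
have [x1|x1] := ltP x 1.
  apply: (@le_trans _ _ (expR ((a - 1) * ln x))); last by rewrite lerDl.
  by rewrite ler_piMr ?expR_ge0 // -[leRHS]expR0 ler_expR oppr_le0 ltW.
rewrite add0r exponential_pdfE ?(ltW x0) //.
have -> : 2 * K * (2^-1 * expR (- 2^-1 * x)) = K * expR (- 2^-1 * x).
  by field.
rewrite -[leLHS]expRD -[leRHS]expRD ler_expR.
have lx0 : 0 <= ln x by exact: ln_ge0.
have h1 : (a - 1) * ln x <= M * ln x by rewrite ler_wpM2r // ler_norm.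
have h2 : ln x <= x / c + `|ln c|.
  have -> : ln x = ln (x / c) + ln c by rewrite -lnM ?posrE ?divr_gt0 // divfK // gt_eqF.
  apply: lerD; last exact: ler_norm.
  by apply/ltW/ln_sublinear; rewrite divr_gt0.
have h3 : M * ln x <= M * (x / c) + M * `|ln c|.
  by rewrite -mulrDr ler_wpM2l.
have h4 : M * (x / c) <= x / 2.
  rewrite mulrCA ler_wpM2l ?(ltW x0) //.
  rewrite ler_pdivrMr // /c mulrA mulVf ?pnatr_eq0 // mul1r lerDl //.
have : - 2^-1 * x = x / 2 - x by field.
lra.
Qed.

Definition gamma_fun (c : R) (s : R[i]) (t : R) : R[i] :=
  if 0 < t then cpowR t (s - 1) * (expR (- (c * t)))%:C else 0.

Lemma cmeasurable_gamma_fun c s : cmeasurable (gamma_fun c s).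
Proof.
apply: cmeasurable_if; first exact: measurable_fun_ltr.
  apply: cmeasurableM; first exact: cmeasurable_cpowR.
  apply: cmeasurable_real; apply: measurableT_comp => //.
  by apply: measurableT_comp => //; exact: measurable_funM.
exact: cmeasurable_cst.
Qed.

Lemma normc_gamma_fun c s t :
  (normc (gamma_fun c s t))%:C = gamma_fun c (complex.Re s)%:C t.
Proof.
rewrite /gamma_fun; case: ifP => _; last by rewrite normc0.
rewrite normCM normc_cpowRE normc_real ?expR_ge0 //.
by rewrite -(rmorph1 (real_complex R)) -rmorphB ReB.
Qed.

Lemma hasC_gamma1 s : 0 < complex.Re s -> hasC lambda (gamma_fun 1 s) (cGamma s).
Proof.
move=> s0; have [w hw] := hasR_gamma_abs s0.
have [v hv] : exists v, hasC lambda (gamma_fun 1 s) v.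
  apply: (hasC_dom _ _ hw); first exact: cmeasurable_gamma_fun.
  move=> x; rewrite /gamma_fun; case: ifP => _; last by rewrite normc0.
  by rewrite normcM normc_cpowR normc_real ?expR_ge0 // mul1r ReB.
suff -> : cGamma s = v by [].
rewrite /cGamma.
have mD : measurable (`]0, +oo[%classic : set (measurableTypeR R)) by exact: measurable_itv.
have := @hasC_mkcond R _ _ lambda `]0, +oo[%classic
  (fun t : R => cpowR t (s - 1) * (expR (- t))%:C) v mD.
case=> //; move: hv; congr (hasC _ _ _); apply/funext => t.
by rewrite /gamma_fun mem_setE in_itv /= andbT mul1r.
Qed.

Lemma hasC_gamma c s : 0 < c -> 0 < complex.Re s ->
  hasC lambda (gamma_fun c s) (cpowR c (- s) * cGamma s).
Proof.
move=> c0 s0.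
have m : cmeasurable (fun t : R => cpowR t (s - 1) * (expR (- (1 * t)))%:C).
  apply: cmeasurableM; first exact: cmeasurable_cpowR.
  apply: cmeasurable_real; apply: measurableT_comp => //.
  by apply: measurableT_comp => //; exact: measurable_funM.
have h := hasC_scale c0 m (hasC_gamma1 s0).
have := hasCZ (cpowR c (- (s - 1))) h.
have -> : cpowR c (- (s - 1)) * (c^-1%:C * cGamma s) = cpowR c (- s) * cGamma s.
  have -> : - (s - 1) = - s + 1 by rewrite opprB addrC.
  rewrite cpowRD cpowR1 // -mulrA [X in _ * X](_ : _ = cGamma s) //.
  by rewrite mulrA -(rmorphM (real_complex R)) mulfV ?gt_eqF // mul1r.
congr (hasC _ _ _); apply/funext => t; rewrite /gamma_fun.
case: ifP => t0; last by rewrite mulr0.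
rewrite mul1r cpowRM //.
transitivity (cpowR c (- (s - 1)) * cpowR c (s - 1) * (cpowR t (s - 1) * (expR (- (c * t)))%:C)).
  by ring.
by rewrite -cpowRD addNr cpowR0 mul1r.
Qed.

Lemma cGamma_real (a : R) : 0 < a -> exists2 v, cGamma a%:C = v%:C & 0 < v.
Proof.
move=> a0; have h : hasC lambda (gamma_fun 1 a%:C) (cGamma a%:C) by exact: hasC_gamma1.
have e : gamma_fun 1 a%:C = fun t => (if 0 < t then expR ((a - 1) * ln t - t) else 0)%:C.
  apply/funext => t; rewrite /gamma_fun; case: ifP => // _.
  rewrite -(rmorph1 (real_complex R)) -rmorphB cpowR_real -(rmorphM (real_complex R)) -expRD.
  by rewrite mul1r.
rewrite e in h; exists (complex.Re (cGamma a%:C)).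
  have [h1 h2] := h; have i0 := hasR_uniq h2 (hasR0 lambda).
  by rewrite {1}(complexE (cGamma a%:C)) i0 mulr0 addr0.
(* A lower bound for the integrand on []1, 2[], which makes the integral positive. *)
pose k := expR (- `|a - 1| * ln 2 - 2).
have hk : hasR lambda (fun x => k * (\1_(`]1, 2[%classic : set R)) x) (k * 1).
  apply: hasRZ; apply: hasR_ge0 => [||].
  - exact: measurable_indic.
  - by move=> x; rewrite indicE.
  - rewrite integral_indic // setIT [LHS](lebesgue_measure_itv `]1, 2[) /=.
    by rewrite lte_fin ltr1n -EFinB; congr (_%:E); ring.
apply: lt_le_trans (hasR_le _ hk h.1); first by rewrite mulr1 expR_gt0.
move=> x; rewrite indicE mem_setE in_itv /=.
have [/andP[x1 x2]|_] := boolP ((1 < x) && (x < 2)); last first.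
  by rewrite mulr0; case: ifP => // _; exact: expR_ge0.
rewrite (lt_trans ltr01 x1) mulr1 /k ler_expR.
apply: lerB; last exact: ltW.
have lx0 : 0 <= ln x by apply: ln_ge0; exact: ltW.
have lx2 : ln x <= ln 2 by rewrite ler_ln ?posrE // ?ltW // (lt_trans ltr01).
rewrite mulNr.
have : `|a - 1| * ln x <= `|a - 1| * ln 2 by rewrite ler_wpM2l.
have : - `|a - 1| * ln x <= (a - 1) * ln x.
  by rewrite ler_wpM2r // lerNl -normrN ler_norm.
lra.
Qed.

End gamma_function.

Section beta_kernel.
Context {R : realType}.
Notation lambda := (@lebesgue_measure R).

Definition beta_fun (p q : R[i]) (w : R) : R[i] :=
  if 0 < w then cpowR w (p - 1) * cpowR (1 + w) (- (p + q)) else 0.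

Lemma cmeasurable_beta_fun p q : cmeasurable (beta_fun p q).
Proof.
apply: cmeasurable_if; first exact: measurable_fun_ltr.
  apply: cmeasurableM; first exact: cmeasurable_cpowR.
  by apply: cmeasurable_cpowR; exact: measurable_funD.
exact: cmeasurable_cst.
Qed.

(** Integrated over the second variable it leaves [cGamma p] times the Gamma integrand of [q];
    integrated over the first it leaves [cGamma (p + q)] times the beta integrand. Comparing the two
    orders gives the beta integral. *)
Let K (p q : R[i]) (z : R * R) := gamma_fun 1 (p + q) z.1 * gamma_fun z.1 p z.2.

Let mK p q : @cmeasurable _ _ (measurableTypeR R * measurableTypeR R)%type (K p q).
Proof.
apply: cmeasurableM.
  by apply: (cmeasurable_comp (cmeasurable_gamma_fun _ _)).
apply: cmeasurable_if; first exact: measurable_fun_ltr.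
  apply: cmeasurableM; first exact: cmeasurable_cpowR.
  apply: cmeasurable_real; apply: measurableT_comp => //.
  by apply: measurableT_comp => //; exact: measurable_funM.
exact: cmeasurable_cst.
Qed.

Let K1 p q u : 0 < complex.Re p -> hasC lambda (fun w => K p q (u, w)) (cGamma p * gamma_fun 1 q u).
Proof.
move=> p0; rewrite /K /= [X in _ * X]/gamma_fun /=.
have [u0|u0] := ltP 0 u; last first.
  rewrite mulr0; have -> : (fun w => gamma_fun 1 (p + q) u * gamma_fun u p w) = fun=> 0.
    by apply/funext => w; rewrite /gamma_fun ltNge u0 mul0r.
  exact: hasC0.
have := hasCZ (gamma_fun 1 (p + q) u) (hasC_gamma u0 p0).
congr (hasC _ _ _); rewrite /gamma_fun u0.
have -> : p + q - 1 = p + (q - 1) by rewrite addrA.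
rewrite (cpowRD u p).
transitivity (cpowR u p * cpowR u (- p) * (cGamma p * (cpowR u (q - 1) * (expR (- (1 * u)))%:C))).
  by ring.
by rewrite -cpowRD addrN cpowR0 mul1r.
Qed.

Let K2 p q w : 0 < complex.Re (p + q) ->
  hasC lambda (fun u => K p q (u, w)) (cGamma (p + q) * beta_fun p q w).
Proof.
move=> p0; rewrite /K /= /beta_fun.
have [w0|w0] := ltP 0 w; last first.
  rewrite mulr0; have -> : (fun u => gamma_fun 1 (p + q) u * gamma_fun u p w) = fun=> 0.
    by apply/funext => u; rewrite [X in _ * X]/gamma_fun ltNge w0 mulr0.
  exact: hasC0.
have w1 : 0 < 1 + w by rewrite addr_gt0.
have := hasCZ (cpowR w (p - 1)) (hasC_gamma w1 p0).
congr (hasC _ _ _); last by ring.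
apply/funext => u; rewrite /gamma_fun w0; case: ifP => _; last by rewrite mulr0 mul0r.
have -> : (expR (- ((1 + w) * u)))%:C = (expR (- (1 * u)))%:C * (expR (- (u * w)))%:C.
  by rewrite -(rmorphM (real_complex R)) -expRD; congr (expR _)%:C; ring.
by ring.
Qed.

Let normK p q z : (normc (K p q z))%:C = K (complex.Re p)%:C (complex.Re q)%:C z.
Proof. by rewrite /K normCM !normc_gamma_fun ReD rmorphD. Qed.

(** The factor [cGamma (p + q)] stays under the integral because its nonvanishing is itself deduced
    from this identity. *)
Lemma hasC_beta_fun_scaled p q : 0 < complex.Re p -> 0 < complex.Re q ->
  hasC lambda (fun w => cGamma (p + q) * beta_fun p q w) (cGamma p * cGamma q).
Proof.
move=> p0 q0.
have pq0 : 0 < complex.Re (p + q) by rewrite ReD addr_gt0.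
have p0' : 0 < complex.Re (complex.Re p)%:C by [].
have q0' : 0 < complex.Re (complex.Re q)%:C by [].
have h : hasC (lambda \x lambda)%E (K p q) (cGamma p * cGamma q).
  apply: (@hasC_fubini _ _ _ (measurableTypeR R) (measurableTypeR R) lambda lambda
    (K p q) (fun u => cGamma p * gamma_fun 1 q u)
    (fun u => complex.Re (cGamma (complex.Re p)%:C * gamma_fun 1 (complex.Re q)%:C u)) _
    (complex.Re (cGamma (complex.Re p)%:C * cGamma (complex.Re q)%:C))).
  - exact: mK.
  - by move=> u; exact: K1.
  - move=> u.
    have [+ _] := K1 (complex.Re q)%:C u p0'.
    by under eq_fun do rewrite -normK.
  - by have [+ _] := hasCZ (cGamma (complex.Re p)%:C) (hasC_gamma1 q0').
  - exact: hasCZ (hasC_gamma1 q0).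
by apply: (hasC_section_swap h) => w; exact: K2.
Qed.

End beta_kernel.

(** * Gamma has no zero in the right half-plane *)

Section gamma_nonvanishing.
Context {R : realType}.
Notation lambda := (@lebesgue_measure R).

(** Half-angle formula: [1 - cos x = 2 sin(x / 2) ^ 2], and [|sin y| <= |y|] by the mean value
    theorem. *)
Lemma cos_ge_quadratic (x : R) : 1 - x ^+ 2 / 2 <= cos x.
Proof.
have sq (y : R) : 0 <= y -> sin y ^+ 2 <= y ^+ 2.
  move=> y0.
  have cs : {within `[0, y], continuous (@sin R)}.
    by apply: continuous_subspaceT; exact: continuous_sin.
  have [c _ e] := @MVT_segment R sin cos 0 y y0 (fun z _ => is_derive_sin z) cs.
  move: e; rewrite sin0 !subr0 => ->; rewrite exprMn; apply: ler_piMl; first exact: sqr_ge0.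
  by have := cos2Dsin2 c; have := sqr_ge0 (sin c); lra.
have {}sq (y : R) : sin y ^+ 2 <= y ^+ 2.
  have [|y0] := leP 0 y; first exact: sq.
  by rewrite -(sqrrN y) -(sqrrN (sin y)) -sinN sq // oppr_ge0 ltW.
pose y := x / 2.
have xy : x = y *+ 2 by rewrite -mulr_natr divfK // pnatr_eq0.
have -> : x ^+ 2 / 2 = 2 * y ^+ 2 by rewrite xy -mulr_natr; field.
rewrite xy cos_mulr2n -mulr_natr.
have := cos2Dsin2 y; have := sq y.
move: (cos y ^+ 2) (sin y ^+ 2) (y ^+ 2) => a b c; lra.
Qed.

(** The bound uses only powers of [u], whose Gamma integrals are again Gamma values. With [u = e^y]
    the right side is [4 (e^(y/2) - e^(-y/2))^2], which reduces the claim to [z <= e^z - e^(-z)] for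
    [z = y / 2 >= 0]. *)
Lemma sqr_ln_le (u : R) : 0 < u -> (ln u) ^+ 2 <= 4 * (u - 2 + u^-1).
Proof.
move=> u0.
have main (y : R) : 0 <= y -> y ^+ 2 <= 4 * (expR y - 2 + expR (- y)).
  move=> y0; pose z := y / 2.
  have ey : expR y = expR z ^+ 2.
    by rewrite -expRM_natl; congr expR; rewrite /z; field.
  have eNy : expR (- y) = expR (- z) ^+ 2.
    by rewrite -expRM_natl; congr expR; rewrite /z; field.
  have ez : expR z * expR (- z) = 1 by rewrite -expRD addrN expR0.
  have -> : expR y - 2 + expR (- y) = (expR z - expR (- z)) ^+ 2.
    transitivity (expR z ^+ 2 - 2 * (expR z * expR (- z)) + expR (- z) ^+ 2).
      by rewrite ez mulr1 ey eNy.
    by ring.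
  have -> : y ^+ 2 = 4 * z ^+ 2 by rewrite /z; field.
  rewrite ler_pM2l // lerXn2r ?nnegrE //; first by rewrite /z divr_ge0.
    rewrite subr_ge0 ler_expR /z; lra.
  have := expR_ge1Dx z.
  have : expR (- z) <= 1 by rewrite -[leRHS]expR0 ler_expR /z; lra.
  lra.
have [u1|u1] := leP 1 u.
  have := main (ln u) (ln_ge0 u1); by rewrite expRN lnK.
have lu : 0 <= - ln u by rewrite oppr_ge0 ln_le0 // ltW.
have := main _ lu; rewrite opprK sqrrN expRN lnK //; lra.
Qed.

(** This is [B(p, q) = B(p + 1, q) + B(p, q + 1)] cleared of denominators; for the integrands it
    amounts to splitting a factor [1 + w]. It does the work of the functional equation. *)
Lemma cGamma_add (p q : R[i]) : 0 < complex.Re p -> 0 < complex.Re q ->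
  cGamma p * cGamma q * cGamma (p + q + 1) =
  cGamma (p + q) * (cGamma (p + 1) * cGamma q + cGamma p * cGamma (q + 1)).
Proof.
move=> p0 q0.
have p1 : 0 < complex.Re (p + 1) by rewrite ReD /= addr_gt0.
have q1 : 0 < complex.Re (q + 1) by rewrite ReD /= addr_gt0.
have h1 := hasC_beta_fun_scaled p1 q0.
have h2 := hasC_beta_fun_scaled p0 q1.
have h0 := hasCZ (cGamma (p + q + 1)) (hasC_beta_fun_scaled p0 q0).
have h := hasCZ (cGamma (p + q)) (hasCD h1 h2).
rewrite mulrC; apply: (hasC_uniq h0); move: h; congr (hasC _ _ _).
apply/funext => w; rewrite /beta_fun.
have -> : p + 1 + q = p + q + 1 by ring.
have -> : p + (q + 1) = p + q + 1 by ring.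
case: ifPn => w0; last by rewrite !mulr0 addr0 mulr0.
have w1 : 0 < 1 + w by rewrite addr_gt0.
have e1 : cpowR w (p + 1 - 1) = cpowR w (p - 1) * w%:C.
  by rewrite -(cpowR1 w0) -cpowRD; congr cpowR; ring.
have e2 : cpowR (1 + w) (- (p + q)) = cpowR (1 + w) (- (p + q + 1)) * (1 + w%:C).
  have -> : 1 + w%:C = (1 + w)%:C by rewrite rmorphD.
  by rewrite -[X in _ * X](cpowR1 w1) -cpowRD; congr cpowR; ring.
by rewrite e1 e2; ring.
Qed.

Definition rGamma (a : R) := complex.Re (cGamma (a%:C : R[i])).

Local Notation gr := rGamma.

Lemma cGamma_rGamma a : 0 < a -> cGamma a%:C = (gr a)%:C.
Proof. by move=> /cGamma_real[v e _]; rewrite /gr e. Qed.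

Lemma rGamma_gt0 a : 0 < a -> 0 < gr a.
Proof. by move=> /cGamma_real[v e v0]; rewrite /gr e. Qed.

Lemma rGamma_add p q : 0 < p -> 0 < q ->
  gr p * gr q * gr (p + q + 1) = gr (p + q) * (gr (p + 1) * gr q + gr p * gr (q + 1)).
Proof.
move=> p0 q0; have := @cGamma_add p%:C q%:C p0 q0.
rewrite -(rmorph1 (real_complex R)) -!(rmorphD (real_complex R)) !cGamma_rGamma ?addr_gt0 //.
rewrite -4!(rmorphM (real_complex R)) -(rmorphD (real_complex R)) -(rmorphM (real_complex R)).
exact: complexI.
Qed.

(** Equal to [a] by the functional equation, but only its positivity and its additivity are
    needed. *)
Definition gamma_ratio a := gr (a + 1) / gr a.

Local Notation rho := gamma_ratio.

Lemma gamma_ratioD p q : 0 < p -> 0 < q -> rho (p + q) = rho p + rho q.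
Proof.
move=> p0 q0; have := rGamma_add p0 q0; rewrite /rho.
have := rGamma_gt0 p0; have := rGamma_gt0 q0; have := rGamma_gt0 (addr_gt0 p0 q0).
move: (gr p) (gr q) (gr (p + q)) (gr (p + 1)) (gr (q + 1)) (gr (p + q + 1)).
move=> x y z x1 y1 z1 /gt_eqF/negbT a0 /gt_eqF/negbT b0 /gt_eqF/negbT c0 e.
apply: (mulfI (mulf_neq0 (mulf_neq0 c0 b0) a0)).
transitivity (x * y * z1); first by field.
by rewrite e; field; apply/andP.
Qed.

Lemma gamma_ratio_gt0 a : 0 < a -> 0 < rho a.
Proof. by move=> a0; rewrite divr_gt0 // rGamma_gt0 // addr_gt0. Qed.

Lemma gamma_ratio_nat a n : 0 < a -> n%:R * rho 1 < rho (a + n%:R).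
Proof.
move=> a0; elim: n => [|n ih]; first by rewrite mul0r addr0 gamma_ratio_gt0.
have an : 0 < a + n%:R by rewrite ltr_wpDr.
rewrite -natr1 addrA (gamma_ratioD an ltr01) mulrDl mul1r.
by rewrite ltrD2r.
Qed.

Let hasR_gr a : 0 < a -> hasR lambda
  (fun t => if 0 < t then expR ((a - 1) * ln t) * expR (- t) else 0) (gr a).
Proof.
move=> a0; have [+ _] : hasC lambda (gamma_fun 1 a%:C) (cGamma a%:C) by exact: hasC_gamma1.
congr (hasR _ _ _); apply/funext => t; rewrite /gamma_fun; case: ifP => // _.
rewrite -(rmorph1 (real_complex R)) -rmorphB cpowR_real -(rmorphM (real_complex R)) /=.
by rewrite mul1r.
Qed.

(* The Gamma distribution with parameter [N] is concentrated near [c], so the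
   phase [t ^ (i b)] of the integrand is nearly constant. *)
Let gamma_concentration (N b c : R) : 1 < N -> 0 < c ->
  cGamma (N +i* b) = 0 ->
  (1 + 4 * b ^+ 2) * gr N + - (2 * b ^+ 2 / c * gr (N + 1)) + - (2 * b ^+ 2 * c * gr (N - 1)) <= 0.
Proof.
move=> N1 c0 e.
have N0 : 0 < N by exact: lt_trans N1.
have s0 : 0 < complex.Re (N +i* b) by [].
(* The factor [c ^ (- i b)] centres the phase at [c]: the real part of the integrand becomes
   [X cos (b ln (t / c))], whose integral is 0 by assumption. Bounding the cosine below by powers of
   [t / c] gives the three Gamma values of the statement. *)
have h := hasCZ (cpowR c (0 -i* b)) (hasC_gamma1 s0); rewrite e mulr0 in h.
have l := hasRD (hasRD (hasRZ (1 + 4 * b ^+ 2) (hasR_gr N0))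
  (hasRN (hasRZ (2 * b ^+ 2 / c) (hasR_gr (addr_gt0 N0 ltr01)))))
  (hasRN (hasRZ (2 * b ^+ 2 * c) (hasR_gr (etrans (subr_gt0 1 N) N1)))).
apply: hasR_le l h.1 => t; rewrite /gamma_fun.
have [t0|t0] := ltP 0 t; last by rewrite !mulr0 /= ?mulr0; lra.
set X := expR ((N - 1) * ln t) * expR (- t).
have X0 : 0 <= X by rewrite mulr_ge0 // expR_ge0.
have e1 : expR ((N + 1 - 1) * ln t) * expR (- t) = X * t.
  have -> : (N + 1 - 1) * ln t = (N - 1) * ln t + ln t by ring.
  by rewrite expRD lnK // mulrAC.
have e2 : expR ((N - 1 - 1) * ln t) * expR (- t) = X / t.
  have -> : (N - 1 - 1) * ln t = (N - 1) * ln t - ln t by ring.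
  by rewrite expRD expRN lnK // mulrAC.
rewrite e1 e2.
have -> : complex.Re (cpowR c (0 -i* b) * (cpowR t (N +i* b - 1) * (expR (- (1 * t)))%:C))
    = X * cos (b * ln (t / c)).
  rewrite mulrA -cexpD; set z := _ + _.
  have -> : z = ((N - 1) * ln t) +i* (b * ln (t / c)).
    rewrite /z ln_div ?posrE //; simpc.
    by apply/eqP; rewrite eq_complex /=; apply/andP; split; apply/eqP; ring.
  by rewrite /cexp /X mul1r; simpc; rewrite /=; ring.
have h1 := cos_ge_quadratic (b * ln (t / c)).
have tc : 0 < t / c by rewrite divr_gt0.
have h2 := sqr_ln_le tc.
have h3 : 1 - 2 * b ^+ 2 * (t / c - 2 + c / t) <= cos (b * ln (t / c)).
  apply: le_trans h1; rewrite lerD2l lerN2 exprMn.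
  have := ler_wpM2l (sqr_ge0 b) h2; rewrite invf_div; lra.
rewrite [leLHS](_ : _ = X * (1 - 2 * b ^+ 2 * (t / c - 2 + c / t))) ?ler_wpM2l //.
by field; rewrite !gt_eqF.
Qed.

(* A zero at [s] is a zero at every [s + n] by the functional equation, and for
   large [n] this contradicts the concentration estimate. *)
Lemma cGamma_neq0 (s : R[i]) : 0 < complex.Re s -> cGamma s != 0.
Proof.
move=> s0; apply/eqP => e.
have shift n : cGamma (s + n%:R) = 0.
  elim: n => [|n ih]; first by rewrite addr0.
  have n0 : 0 < complex.Re (s + n%:R) by rewrite ReD Re_nat ltr_wpDr.
  have o0 : 0 < complex.Re (1 : R[i]) by [].
  have := cGamma_add n0 o0; rewrite ih !mul0r addr0 -natr1 addrA.
  move/esym/eqP; rewrite !mulf_eq0 => /or3P[/eqP//|/eqP//|].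
  have [v -> v0] := @cGamma_real R 1 ltr01.
  by rewrite eq_complex /= gt_eqF.
case: s s0 e shift => a b /= a0 _ shift.
(* With [N = a + n + 1] and [c = rho (N - 1)], the left side of the concentration estimate collapses
   to [gr N / c * (c - 2 b^2 rho 1)]. Since [c > n * rho 1], taking [n > 2 b^2] makes it positive, a
   contradiction. *)
pose n := (Num.truncn (2 * b ^+ 2)).+1.
have nb : 2 * b ^+ 2 < n%:R by exact: truncnS_gt.
pose N := a + n%:R + 1.
have an0 : 0 < a + n%:R by rewrite ltr_wpDr.
have N1 : 1 < N by rewrite ltrDr.
have NN : N - 1 = a + n%:R by rewrite /N addrK.
have c0 : 0 < rho (a + n%:R) by exact: gamma_ratio_gt0.
have z : cGamma (N +i* b) = 0.
  have -> : N +i* b = a +i* b + n.+1%:R; last exact: shift.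
  rewrite -(rmorph_nat (real_complex R)); apply/eqP.
  by rewrite eq_complex /= addr0 eqxx andbT /N -addrA natr1.
have := gamma_concentration N1 c0 z.
rewrite NN; set c := rho _ in c0 *.
have grN : 0 < gr N by rewrite rGamma_gt0 // (lt_trans _ N1).
have gra : gr (a + n%:R) = gr N / c.
  rewrite /c /rho -/N; have /gt_eqF/negbT := rGamma_gt0 an0.
  move/gt_eqF/negbT: grN; move: (gr N) (gr (a + n%:R)) => x y x0 y0.
  by field; apply/andP.
have grN1 : gr (N + 1) = gr N * (c + rho 1).
  rewrite -gamma_ratioD // -/N /rho; field; by rewrite gt_eqF.
have cn : n%:R * rho 1 < c by exact: gamma_ratio_nat.
rewrite gra grN1.
have -> : (1 + 4 * b ^+ 2) * gr N + - (2 * b ^+ 2 / c * (gr N * (c + rho 1))) +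
    - (2 * b ^+ 2 * c * (gr N / c)) = gr N / c * (c - 2 * b ^+ 2 * rho 1).
  by field; rewrite gt_eqF.
rewrite leNgt => /negP; apply; apply: mulr_gt0; first exact: divr_gt0.
rewrite subr_gt0; apply: le_lt_trans cn; rewrite ler_pM2r ?gamma_ratio_gt0 //; exact: ltW.
Qed.

Lemma hasC_beta2 (p q : R[i]) : 0 < complex.Re p -> 0 < complex.Re q ->
  hasC lambda (beta_fun p q) (cGamma p * cGamma q / cGamma (p + q)).
Proof.
move=> p0 q0; rewrite mulrC; apply: hasCZ_inv.
  by apply: cGamma_neq0; rewrite ReD addr_gt0.
exact: hasC_beta_fun_scaled.
Qed.

End gamma_nonvanishing.

Section beta_integrals.
Context {R : realType}.
Notation lambda := (@lebesgue_measure R).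

(** The map is [x / (1 - x)], from []0, 1[] onto the half-line, written so that only an inverse has
    to be differentiated. *)
Lemma chvar_odds :
  chvar lambda lambda (fun x => (1 - x)^-1 - 1)
    (fun x => if (0 < x) && (x < 1) then ((1 - x) ^+ 2)^-1 else 0)
    (fun y => if 0 < y then 1 else 0).
Proof.
rewrite [X in chvar _ _ _ X _](_ : _ =
  fun x => if x \in `]0, 1[%R then (fun x => ((1 - x) ^+ 2)^-1) x else 0); last first.
  by apply/funext => x; rewrite in_itv.
have m1 : measurable_fun setT (fun x : R => 1 - x) by exact: measurable_funB.
apply: chvar_increasing.
- by apply: measurable_funB => //; exact: measurable_funV.
- by apply: measurable_funV; exact: measurable_funX.
- by rewrite subr0 invr1 subrr.
- move=> x; rewrite in_itv /= => /andP[x0 x1].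
  have d : 1 - x != 0 by rewrite gt_eqF // subr_gt0.
  have dx : is_derive x (1 : R) (fun x : R => 1 - x) (-1).
    have := is_deriveB (is_derive_cst (1 : R) x (1 : R)) (is_derive_id x (1 : R)).
    by rewrite sub0r.
  have dv : is_derive x (1 : R) (fun x : R => (1 - x)^-1) (((1 - x) ^+ 2)^-1).
    apply: DeriveDef; first by apply: derivableV => //; case: dx.
    by rewrite deriveV //; case: dx => // _ ->; rewrite /GRing.scale /= mulrN1 opprK.
  have := is_deriveB dv (is_derive_cst (1 : R) x (1 : R)).
  by rewrite subr0.
- move=> x; rewrite in_itv /= => /andP[x0 x1].
  have d : 1 - x != 0 by rewrite gt_eqF // subr_gt0.
  apply: (@continuous_comp _ _ _ (fun x : R => 1 - x) (fun y : R => (y ^+ 2)^-1)).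
    by apply: (@cvgB _ R); [exact: cvg_cst|exact: cvg_id].
  apply: (@cvgV _ R); first by rewrite expf_neq0.
  exact: exprn_continuous.
- by move=> x _; rewrite invr_ge0 sqr_ge0.
- move=> x y; rewrite !in_itv /= => /andP[x0 x1] /andP[y0 y1] xy.
  by rewrite ltrD2r ltf_pV2 ?posrE ?subr_gt0 // ltrD2l ltrN2.
- move=> v v0; have v1 : 0 < 1 + v by rewrite ltr_wpDr.
  exists (v / (1 + v)); last by field; lra.
  by rewrite in_itv /= divr_ge0 ?(ltW v1) //= ltr_pdivrMr // mul1r ltrDr.
Qed.

Lemma hasC_beta1 (p q : R[i]) : 0 < complex.Re p -> 0 < complex.Re q ->
  hasC lambda (fun x => if (0 < x) && (x < 1) then
      cpowR x (p - 1) * cpowR (1 - x) (q - 1) else 0)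
    (cGamma p * cGamma q / cGamma (p + q)).
Proof.
move=> p0 q0; have h := hasC_beta2 p0 q0.
have mb : measurable_fun setT (fun x : R => (0 < x) && (x < 1)).
  by apply: measurable_and; exact: measurable_fun_ltr.
have m1 : measurable_fun setT (fun x : R => 1 - x) by exact: measurable_funB.
have mE : measurable_fun setT (fun x : R => if 0 < x then 1 else 0 : R).
  by apply: measurable_fun_ifT => //; exact: measurable_fun_ltr.
have mD : measurable_fun setT (fun x : R => if (0 < x) && (x < 1) then ((1 - x) ^+ 2)^-1 else 0).
  by apply: measurable_fun_ifT => //; apply: measurable_funV; exact: measurable_funX.
have mphi : measurable_fun setT (fun x : R => (1 - x)^-1 - 1).
  by apply: measurable_funB => //; exact: measurable_funV.
have p1 (y : R) : 0 <= (if 0 < y then 1 else 0 : R) by case: ifP.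
have pD (x : R) : 0 <= (if (0 < x) && (x < 1) then ((1 - x) ^+ 2)^-1 else 0).
  by case: ifP => // _; rewrite invr_ge0 sqr_ge0.
have := (hasC_chvar (cGamma p * cGamma q / cGamma (p + q)) chvar_odds
  mphi mD mE pD p1 (cmeasurable_beta_fun p q)).2.
have -> : (fun y : R => beta_fun p q y * (if 0 < y then 1 else 0)%:C) = beta_fun p q.
  by apply/funext => y; rewrite /beta_fun; case: ifP; rewrite ?mulr1 ?mulr0.
move=> /(_ h); congr (hasC _ _ _); apply/funext => x.
case: ifPn => [/andP[x0 x1]|_]; last by rewrite mulr0.
have y0 : 0 < 1 - x by rewrite subr_gt0.
have xy : (1 - x)^-1 - 1 = x * (1 - x)^-1 by field; rewrite gt_eqF.
have iy0 : 0 < (1 - x)^-1 by rewrite invr_gt0.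
rewrite /beta_fun xy mulr_gt0 // cpowRM // cpowRV //.
have -> : 1 + x * (1 - x)^-1 = (1 - x)^-1 by field; rewrite gt_eqF.
rewrite cpowRV //.
have -> : (((1 - x) ^+ 2)^-1)%:C = cpowR (1 - x) (- (1 + 1)).
  by rewrite -cpowRV // cpowRD cpowR1 // -(rmorphM (real_complex R)) -expr2 exprVn.
have e : cpowR (1 - x) (q - 1) = cpowR (1 - x) (- (p - 1)) * cpowR (1 - x) (- - (p + q))
    * cpowR (1 - x) (- (1 + 1)).
  by rewrite -!cpowRD; congr cpowR; ring.
by rewrite e; ring.
Qed.

(** One step of a Dirichlet integral: [r] stands for the constant together with the terms of the
    variables not yet integrated. *)
Lemma hasC_beta2_scaled (s tau : R[i]) (r c : R) : 0 < r -> 0 < c ->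
  0 < complex.Re s -> 0 < complex.Re (tau - s) ->
  hasC lambda (fun w => if 0 < w then cpowR w (s - 1) * cpowR (r + c * w) (- tau) else 0)
    (cpowR c (- s) * cpowR r (s - tau) * (cGamma s * cGamma (tau - s) / cGamma tau)).
Proof.
move=> r0 c0 s0 t0; have h := hasC_beta2 s0 t0.
have st : s + (tau - s) = tau by ring.
rewrite st in h.
have cr0 : 0 < c / r by rewrite divr_gt0.
pose g (w : R) := cpowR w (s - 1) * cpowR (1 + w) (- tau).
have mg : cmeasurable g.
  apply: cmeasurableM; first exact: cmeasurable_cpowR.
  by apply: cmeasurable_cpowR; exact: measurable_funD.
have h' : hasC lambda (fun w => if 0 < w then g w else 0)
    (cGamma s * cGamma (tau - s) / cGamma tau).
  by move: h; congr (hasC _ _ _); apply/funext => w; rewrite /beta_fun st.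
have := hasCZ (cpowR (c / r) (- (s - 1)) * cpowR r (- tau)) (hasC_scale cr0 mg h').
congr (hasC _ _ _); last first.
  have -> : ((c / r)^-1)%:C = cpowR (c / r) (- 1) by rewrite -cpowRV // cpowR1 // invr_gt0.
  have e : cpowR c (- s) * cpowR r (s - tau) =
      cpowR (c / r) (- (s - 1)) * cpowR r (- tau) * cpowR (c / r) (- 1).
    have -> : cpowR r (s - tau) = cpowR r s * cpowR r (- tau) by rewrite -cpowRD.
    transitivity (cpowR (c / r) (- (s - 1)) * cpowR (c / r) (- 1) * cpowR r (- tau)).
      rewrite -(cpowRD (c / r)); have -> : - (s - 1) + -1 = - s by ring.
      by rewrite cpowRM ?invr_gt0 // cpowRV // opprK mulrA.
    by ring.
  by rewrite e; ring.
apply/funext => w; case: ifP => w0; last by rewrite mulr0.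
rewrite /g (cpowRM _ cr0 w0).
have -> : cpowR (r + c * w) (- tau) = cpowR r (- tau) * cpowR (1 + c / r * w) (- tau).
  have -> : r + c * w = r * (1 + c / r * w) by field; rewrite gt_eqF.
  by rewrite cpowRM // addr_gt0 // mulr_gt0.
transitivity (cpowR (c / r) (- (s - 1)) * cpowR (c / r) (s - 1) * (cpowR w (s - 1) *
  (cpowR r (- tau) * cpowR (1 + c / r * w) (- tau)))); first by ring.
by rewrite -cpowRD addNr cpowR0 mul1r.
Qed.

Lemma hasC_beta1_scaled (s q : R[i]) (r c : R) : 0 < r -> 0 < c ->
  0 < complex.Re s -> 0 < complex.Re q ->
  hasC lambda (fun w => if (0 < w) && (c * w < r) then
      cpowR w (s - 1) * cpowR (r - c * w) (q - 1) else 0)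
    (cpowR c (- s) * cpowR r (s + q - 1) * (cGamma s * cGamma q / cGamma (s + q))).
Proof.
move=> r0 c0 s0 q0; have h := hasC_beta1 s0 q0.
have cr0 : 0 < c / r by rewrite divr_gt0.
pose g (w : R) := if w < 1 then cpowR w (s - 1) * cpowR (1 - w) (q - 1) else 0.
have mg : cmeasurable g.
  apply: cmeasurable_if; first exact: measurable_fun_ltr.
    apply: cmeasurableM; first exact: cmeasurable_cpowR.
    by apply: cmeasurable_cpowR; exact: measurable_funB.
  exact: cmeasurable_cst.
have h' : hasC lambda (fun w => if 0 < w then g w else 0)
    (cGamma s * cGamma q / cGamma (s + q)).
  move: h; congr (hasC _ _ _); apply/funext => w; rewrite /g.
  by case: (0 < w).
have := hasCZ (cpowR (c / r) (- (s - 1)) * cpowR r (q - 1)) (hasC_scale cr0 mg h').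
congr (hasC _ _ _); last first.
  have -> : ((c / r)^-1)%:C = cpowR (c / r) (- 1) by rewrite -cpowRV // cpowR1 // invr_gt0.
  have e : cpowR c (- s) * cpowR r (s + q - 1) =
      cpowR (c / r) (- (s - 1)) * cpowR r (q - 1) * cpowR (c / r) (- 1).
    have -> : cpowR r (s + q - 1) = cpowR r s * cpowR r (q - 1) by rewrite -cpowRD addrA.
    transitivity (cpowR (c / r) (- (s - 1)) * cpowR (c / r) (- 1) * cpowR r (q - 1)).
      rewrite -(cpowRD (c / r)); have -> : - (s - 1) + -1 = - s by ring.
      by rewrite cpowRM ?invr_gt0 // cpowRV // opprK mulrA.
    by ring.
  by rewrite e; ring.
apply/funext => w; case: (ltP 0 w) => w0 /=; last by rewrite mulr0.
rewrite /g.
have -> : (c / r * w < 1) = (c * w < r).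
  by rewrite mulrAC ltr_pdivrMr // mul1r.
case: ifPn => cw; last by rewrite mulr0.
rewrite (cpowRM _ cr0 w0).
have -> : cpowR (r - c * w) (q - 1) = cpowR r (q - 1) * cpowR (1 - c / r * w) (q - 1).
  have -> : r - c * w = r * (1 - c / r * w) by field; rewrite gt_eqF.
  by rewrite cpowRM // subr_gt0 mulrAC ltr_pdivrMr // mul1r.
transitivity (cpowR (c / r) (- (s - 1)) * cpowR (c / r) (s - 1) * (cpowR w (s - 1) *
  (cpowR r (q - 1) * cpowR (1 - c / r * w) (q - 1)))); first by ring.
by rewrite -cpowRD addNr cpowR0 mul1r.
Qed.

End beta_integrals.

(** * Dirichlet integrals *)

Lemma big_ordS {T : Type} (op : T -> T -> T) (idx : T) n (F : nat -> T) :
  \big[op/idx]_(j < n.+1) F j = op (F 0%N) (\big[op/idx]_(j < n) F j.+1).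
Proof. by rewrite big_ord_recl; congr (op _ _); apply: eq_bigr. Qed.

Section tuple_integrals.
Context {R : realType}.
Notation lambda := (@lebesgue_measure R).
Notation tup n := (n.-tuple (measurableTypeR R)).

Lemma measurable_nth n j : measurable_fun setT (fun t : tup n => t`_j : R).
Proof.
have [jn|nj] := ltnP j n.
  rewrite (_ : (fun _ => _) = fun t : tup n => tnth t (Ordinal jn)).
    exact: measurable_tnth.
  by apply/funext => t; rewrite (tnth_nth 0).
rewrite (_ : (fun _ => _) = fun=> 0); first exact: measurable_cst.
by apply/funext => t; rewrite nth_default // size_tuple.
Qed.

Lemma tuple_consE n (x : measurableTypeR R) (t : tup n) : tuple_cons (x, t) = x :: t :> seq R.
Proof. by []. Qed.

Lemma ge0_integral_tuple_cons n (f : tup n.+1 -> \bar R) :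
  measurable_fun setT f -> (forall t, (0 <= f t)%E) ->
  (\int[lebesgue_tuple n.+1]_t f t = \int[lambda \x lebesgue_tuple n]_z f (tuple_cons z))%E.
Proof.
move=> mf f0.
have mc : measurable_fun setT (@tuple_cons R n) by exact: measurable_tuple_cons.
have := @ge0_integral_pushforward _ _ _ _ R _ mc (lambda \x lebesgue_tuple n)%E setT f measurableT mf.
rewrite preimage_setT => <-; last by move=> y _; exact: f0.
by apply: eq_measure_integral => A mA _.
Qed.

Let mfc n (f : tup n.+1 -> \bar R) : measurable_fun setT f ->
  measurable_fun setT (f \o @tuple_cons R n).
Proof. by move=> mf; apply: measurableT_comp => //; exact: measurable_tuple_cons. Qed.

Lemma tonelli_cons n (f : tup n.+1 -> \bar R) :
  measurable_fun setT f -> (forall t, (0 <= f t)%E) ->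
  (\int[lebesgue_tuple n.+1]_t f t =
   \int[lambda]_x \int[lebesgue_tuple n]_t f (tuple_cons (x, t)))%E.
Proof.
move=> mf f0; rewrite ge0_integral_tuple_cons //.
by rewrite (fubini_tonelli1 (f \o @tuple_cons R n) (mfc mf) (fun z => f0 _)).
Qed.

Lemma tonelli_cons_swap n (f : tup n.+1 -> \bar R) :
  measurable_fun setT f -> (forall t, (0 <= f t)%E) ->
  (\int[lebesgue_tuple n.+1]_t f t =
   \int[lebesgue_tuple n]_t \int[lambda]_x f (tuple_cons (x, t)))%E.
Proof.
move=> mf f0; rewrite ge0_integral_tuple_cons //.
by rewrite (fubini_tonelli2 (f \o @tuple_cons R n) (mfc mf) (fun z => f0 _)).
Qed.

Lemma hasC_tuple_cons n (f : tup n.+1 -> R[i]) v : cmeasurable f ->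
  hasC (lebesgue_tuple n.+1) f v <->
  hasC (lambda \x lebesgue_tuple n)%E (fun z => f (tuple_cons z)) v.
Proof.
move=> mf.
have ch : chvar (lambda \x lebesgue_tuple n)%E (lebesgue_tuple n.+1) (@tuple_cons R n)
    (fun=> 1) (fun=> 1).
  move=> g mg g0; under eq_integral do rewrite mule1.
  by under [RHS]eq_integral do rewrite mule1; rewrite ge0_integral_tuple_cons.
have p1 d (T : measurableType d) (x : T) : 0 <= (1 : R) by [].
have m1 d (T : measurableType d) : measurable_fun setT ((fun=> 1) : T -> R).
  exact: measurable_cst.
have := hasC_chvar v ch (@measurable_tuple_cons R n) (m1 _ _) (m1 _ _)
  (@p1 _ _) (@p1 _ _) mf.
rewrite (_ : (fun y => f y * _) = f); last by apply/funext => t; rewrite rmorph1 mulr1.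
rewrite (_ : (fun x => f (tuple_cons x) * _) = fun z => f (tuple_cons z)); last first.
  by apply/funext => t; rewrite rmorph1 mulr1.
by move=> h; apply: iff_sym.
Qed.

Lemma hasC_tuple0 (f : tup 0 -> R[i]) : hasC (lebesgue_tuple 0) f (f [tuple]).
Proof.
have m0 (g : tup 0 -> R) : measurable_fun setT g.
  rewrite (_ : g = fun=> g [tuple]); first exact: measurable_cst.
  by apply/funext => t; rewrite tuple0.
have r0 (g : tup 0 -> R) : hasR (lebesgue_tuple 0) g (g [tuple]).
  have e (h : tup 0 -> \bar R) : (\int[lebesgue_tuple 0]_t h t = h [tuple])%E.
    rewrite /= integral_dirac // ?diracT ?mul1e //.
    rewrite (_ : h = fun=> h [tuple]); first exact: measurable_cst.
    by apply/funext => t; rewrite tuple0.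
  split; last by rewrite e.
  apply/integrableP; split; first by apply/measurable_EFinP.
  by rewrite e ltry.
by split; exact: (r0 (fun t => _ (f t))).
Qed.

Definition allpos (t : seq R) : bool := all (fun x => 0 < x) t.

Lemma measurable_allpos n : measurable_fun setT (fun t : tup n => allpos t).
Proof.
elim: n => [|n ih].
  rewrite (_ : (fun _ => _) = fun=> true); first exact: measurable_cst.
  by apply/funext => t; rewrite tuple0.
rewrite (_ : (fun _ => _) = fun t : tup n.+1 =>
    (0 < t`_0 :> R) && allpos [tuple of behead t]); last first.
  by apply/funext => t; case/tupleP: t => x t.
apply: measurable_and.
  by apply: measurable_fun_ltr => //; exact: measurable_nth.
apply: (@measurableT_comp _ _ _ _ _ _ (fun t : tup n => allpos t)) => //.
exact: measurable_behead.
Qed.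

Lemma measurable_sum_nth n m (c : nat -> R) :
  measurable_fun setT (fun t : tup n => \sum_(j < m) c j * t`_j).
Proof.
apply: measurable_sum => j.
by apply: measurable_funM => //; exact: measurable_nth.
Qed.

Lemma normC_prod I (r : seq I) (P : pred I) (F : I -> R[i]) :
  (normc (\prod_(i <- r | P i) F i))%:C = \prod_(i <- r | P i) (normc (F i))%:C.
Proof. by rewrite normc_prod rmorph_prod. Qed.

Lemma cmeasurable_dirichlet n (s : nat -> R[i]) :
  cmeasurable (fun t : tup n => \prod_(j < n) cpowR t`_j (s j - 1)).
Proof.
apply: cmeasurable_prod => j; apply: cmeasurable_cpowR; exact: measurable_nth.
Qed.

Lemma normC_dirichlet n (s : nat -> R[i]) (t : seq R) :
  (normc (\prod_(j < n) cpowR t`_j (s j - 1)))%:C =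
  \prod_(j < n) cpowR t`_j ((complex.Re (s j))%:C - 1).
Proof.
rewrite normC_prod; apply: eq_bigr => j _.
by rewrite normc_cpowRE ReB rmorphB.
Qed.

End tuple_integrals.

Section dirichlet_integrals.
Context {R : realType}.
Notation lambda := (@lebesgue_measure R).
Notation tup n := (n.-tuple (measurableTypeR R)).

Let dir2 n (s : nat -> R[i]) (tau : R[i]) (c : nat -> R) (r : R) (t : seq R) : R[i] :=
  if allpos t then (\prod_(j < n) cpowR t`_j (s j - 1)) *
    cpowR (r + \sum_(j < n) c j * t`_j) (- tau) else 0.

Let cmeasurable_dir2 n s tau c r : cmeasurable (fun t : tup n => dir2 n s tau c r t).
Proof.
apply: cmeasurable_if; first exact: measurable_allpos.
  apply: cmeasurableM; first exact: cmeasurable_dirichlet.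
  apply: cmeasurable_cpowR; apply: measurable_funD => //.
  exact: measurable_sum_nth.
exact: cmeasurable_cst.
Qed.

Let normC_dir2 n s tau c r t : (normc (dir2 n s tau c r t))%:C =
  dir2 n (fun j => (complex.Re (s j))%:C) (complex.Re tau)%:C c r t.
Proof.
rewrite /dir2; case: ifP => _; last by rewrite normc0.
by rewrite normCM normC_dirichlet normc_cpowRE ReN rmorphN.
Qed.

Let dir2S n s tau c r (t : tup n) : (forall j, (j < n.+1)%N -> 0 < c j) -> 0 < r ->
  0 < complex.Re (s 0%N) -> 0 < complex.Re (tau - s 0%N) ->
  hasC lambda (fun x => dir2 n.+1 s tau c r (tuple_cons (x, t)))
    (cpowR (c 0%N) (- s 0%N) * (cGamma (s 0%N) * cGamma (tau - s 0%N) / cGamma tau) *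
     dir2 n (fun j => s j.+1) (tau - s 0%N) (fun j => c j.+1) r t).
Proof.
move=> c0 r0 s0 t0; rewrite /dir2; case: ifPn => pt; last first.
  rewrite mulr0 (_ : (fun _ => _) = fun=> 0); first exact: hasC0.
  by apply/funext => y; rewrite /= (negbTE pt) andbF.
pose r' := r + \sum_(j < n) c j.+1 * t`_j.
have r'0 : 0 < r'.
  rewrite /r' ltr_wpDr // sumr_ge0 // => j _; rewrite mulr_ge0 //.
    by apply/ltW/c0; rewrite ltnS.
  by apply/ltW; move/(all_nthP 0): pt; apply; rewrite size_tuple.
have := hasCZ (\prod_(j < n) cpowR t`_j (s j.+1 - 1)) (hasC_beta2_scaled r'0 (c0 0%N isT) s0 t0).
congr (hasC _ _ _); last by rewrite opprB; ring.
apply/funext => y; rewrite /= /allpos /= -/(allpos t) pt andbT.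
case: ifP => y0; last by rewrite mulr0.
rewrite (big_ordS _ _ _ (fun j => cpowR (y :: t)`_j (s j - 1))).
rewrite (big_ordS _ _ _ (fun j => c j * (y :: t)`_j)) /=.
have -> : r + (c 0%N * y + \sum_(i < n) c i.+1 * t`_i) = r' + c 0%N * y.
  by rewrite /r'; ring.
by ring.
Qed.

(** Integrating out the first variable lowers [tau] by [s 0] and contributes
    [Gamma(s_0) Gamma(tau - s_0) / Gamma(tau)]. The quotients telescope, which uses that the
    intermediate values of Gamma are not 0. *)
Lemma hasC_dirichlet2 n (s : nat -> R[i]) (tau : R[i]) (c : nat -> R) (r : R) :
  (forall j, (j < n)%N -> 0 < c j) -> 0 < r ->
  (forall j, (j < n)%N -> 0 < complex.Re (s j)) ->
  0 < complex.Re (tau - \sum_(j < n) s j) ->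
  hasC (lebesgue_tuple n) (fun t : tup n =>
      if allpos t then (\prod_(j < n) cpowR t`_j (s j - 1)) *
        cpowR (r + \sum_(j < n) c j * t`_j) (- tau) else 0)
    ((\prod_(j < n) (cpowR (c j) (- s j) * cGamma (s j))) *
     (cpowR r (\sum_(j < n) s j - tau) * (cGamma (tau - \sum_(j < n) s j) / cGamma tau))).
Proof.
elim: n s tau c => [|n ih] s tau c c0 r0 s0 t0.
  rewrite big_ord0 subr0 in t0.
  have := hasC_tuple0 (fun t : tup 0 => dir2 0 s tau c r t).
  rewrite /dir2 /= !big_ord0 addr0 mul1r subr0 add0r mul1r.
  by rewrite mulfV ?mulr1 //; exact: cGamma_neq0.
have s00 := s0 0%N isT.
have ts : tau - \sum_(j < n.+1) s j = tau - s 0%N - \sum_(j < n) s j.+1.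
  by rewrite (big_ordS _ _ _ s) opprD addrA.
have sS j : (j < n)%N -> 0 < complex.Re (s j.+1) by move=> jn; exact: s0.
have cS j : (j < n)%N -> 0 < c j.+1 by move=> jn; exact: c0.
rewrite ts in t0.
have t00 : 0 < complex.Re (tau - s 0%N).
  have -> : tau - s 0%N = tau - s 0%N - \sum_(j < n) s j.+1 + \sum_(j < n) s j.+1.
    by rewrite subrK.
  rewrite ReD ltr_wpDr // Re_sum sumr_ge0 // => j _; exact/ltW/sS.
have ih1 := ih _ _ _ cS r0 sS t0.
pose s' j : R[i] := (complex.Re (s j))%:C; pose tau' : R[i] := (complex.Re tau)%:C.
have e' : complex.Re (tau' - s' 0%N - \sum_(j < n) s' j.+1) =
    complex.Re (tau - s 0%N - \sum_(j < n) s j.+1).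
  rewrite !ReB !Re_sum; congr (_ - _).
have t0' : 0 < complex.Re (tau' - s' 0%N - \sum_(j < n) s' j.+1) by rewrite e'.
have ih2 := ih (fun j => s' j.+1) (tau' - s' 0%N) _ cS r0 sS t0'.
have t00' : 0 < complex.Re (tau' - s' 0%N) by move: t00; rewrite !ReB.
set f := (fun t => _); have -> : f = fun t : tup n.+1 => dir2 n.+1 s tau c r t by [].
apply/hasC_tuple_cons; first exact: cmeasurable_dir2.
have mz : @cmeasurable _ _ (measurableTypeR R * tup n)%type
    (fun z => dir2 n.+1 s tau c r (tuple_cons z)).
  apply: (cmeasurable_comp (cmeasurable_dir2 n.+1 s tau c r)).
  exact: measurable_tuple_cons.
pose k (s : nat -> R[i]) tau :=
  cpowR (c 0%N) (- s 0%N) * (cGamma (s 0%N) * cGamma (tau - s 0%N) / cGamma tau) : R[i].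
have := @hasC_fubini_swap R _ _ (measurableTypeR R) (tup n) lambda (lebesgue_tuple n)
  (fun z => dir2 n.+1 s tau c r (tuple_cons z))
  (fun t => k s tau * dir2 n (fun j => s j.+1) (tau - s 0%N) (fun j => c j.+1) r t)
  (fun t => complex.Re (k s' tau' * dir2 n (fun j => s' j.+1) (tau' - s' 0%N) (fun j => c j.+1) r t))
  _ _ mz _ _ (hasCZ (k s' tau') ih2).1 (hasCZ (k s tau) ih1).
have h1 (t : tup n) : hasC lambda (fun x => dir2 n.+1 s tau c r (tuple_cons (x, t)))
  (k s tau * dir2 n (fun j => s j.+1) (tau - s 0%N) (fun j => c j.+1) r t).
  exact: dir2S.
have h2 (t : tup n) : hasR lambda (fun x => normc (dir2 n.+1 s tau c r (tuple_cons (x, t))))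
  (complex.Re (k s' tau' * dir2 n (fun j => s' j.+1) (tau' - s' 0%N) (fun j => c j.+1) r t)).
  have [+ _] := @dir2S n s' tau' c r t c0 r0 s00 t00'.
  by under eq_fun do rewrite -normC_dir2.
move=> /(_ h1 h2); congr (hasC _ _ _).
rewrite ts (big_ordS _ _ _ (fun j => cpowR (c j) (- s j) * cGamma (s j))) (big_ordS _ _ _ s) /k.
have -> : \sum_(j < n) s j.+1 - (tau - s 0%N) = s 0%N + \sum_(i < n) s i.+1 - tau by ring.
have tg : cGamma (tau - s 0%N) != 0 by exact: cGamma_neq0.
set P := \prod_(j < n) _; set Q := cpowR r _; set G := cGamma (_ - _ - _).
move: tg; set H := cGamma (tau - s 0%N) => tg.
have : H * (G / H) = G by rewrite mulrCA mulfV ?mulr1.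
set GH := G / H => <-.
by move: (cGamma tau)^-1 (cpowR (c 0%N) _) (cGamma (s 0%N)) => *; ring.
Qed.

End dirichlet_integrals.

Section dirichlet1_integrals.
Context {R : realType}.
Notation lambda := (@lebesgue_measure R).
Notation tup n := (n.-tuple (measurableTypeR R)).

Let dir1 n (s : nat -> R[i]) (q : R[i]) (c : nat -> R) (r : R) (t : seq R) : R[i] :=
  if allpos t && (\sum_(j < n) c j * t`_j < r) then
    (\prod_(j < n) cpowR t`_j (s j - 1)) *
    cpowR (r - \sum_(j < n) c j * t`_j) (q - 1) else 0.

Let cmeasurable_dir1 n s q c r : cmeasurable (fun t : tup n => dir1 n s q c r t).
Proof.
apply: cmeasurable_if.
- apply: measurable_and; first exact: measurable_allpos.
  apply: measurable_fun_ltr => //; exact: measurable_sum_nth.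
- apply: cmeasurableM; first exact: cmeasurable_dirichlet.
  apply: cmeasurable_cpowR; apply: measurable_funB => //.
  exact: measurable_sum_nth.
- exact: cmeasurable_cst.
Qed.

Let normC_dir1 n s q c r t : (normc (dir1 n s q c r t))%:C =
  dir1 n (fun j => (complex.Re (s j))%:C) (complex.Re q)%:C c r t.
Proof.
rewrite /dir1; case: ifP => _; last by rewrite normc0.
by rewrite normCM normC_dirichlet normc_cpowRE ReB rmorphB.
Qed.

Let dir1S n s q c r (t : tup n) : (forall j, (j < n.+1)%N -> 0 < c j) ->
  0 < complex.Re (s 0%N) -> 0 < complex.Re q ->
  hasC lambda (fun x => dir1 n.+1 s q c r (tuple_cons (x, t)))
    (cpowR (c 0%N) (- s 0%N) * (cGamma (s 0%N) * cGamma q / cGamma (s 0%N + q)) *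
     dir1 n (fun j => s j.+1) (s 0%N + q) (fun j => c j.+1) r t).
Proof.
move=> c0 s0 q0; rewrite /dir1.
pose r' := r - \sum_(j < n) c j.+1 * t`_j.
have sumE y : \sum_(j < n.+1) c j * (tuple_cons (y, t))`_j =
    c 0%N * y + \sum_(j < n) c j.+1 * t`_j.
  by rewrite (big_ordS _ _ _ (fun j => c j * (y :: t)`_j)).
case: ifPn => [/andP[pt tr]|ptr]; last first.
  rewrite mulr0 (_ : (fun _ => _) = fun=> 0); first exact: hasC0.
  apply/funext => y; rewrite sumE; case: ifP => // /andP[/= /andP[y0 pt] yr].
  have pt' : allpos t := pt.
  move: ptr; rewrite negb_and pt' /= -leNgt => rt.
  suff : r < r by rewrite ltxx.
  apply: le_lt_trans yr; apply: le_trans rt _; rewrite lerDr mulr_ge0 ?(ltW y0) //.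
  by apply/ltW/c0.
have r'0 : 0 < r' by rewrite subr_gt0.
have := hasCZ (\prod_(j < n) cpowR t`_j (s j.+1 - 1)) (hasC_beta1_scaled r'0 (c0 0%N isT) s0 q0).
congr (hasC _ _ _); last by rewrite /r'; ring.
apply/funext => y; rewrite sumE /= /allpos /= -/(allpos t) pt andbT.
have -> : (c 0%N * y + \sum_(j < n) c j.+1 * t`_j < r) = (c 0%N * y < r').
  by rewrite /r' ltrBrDr.
case: ifP => y0; last by rewrite mulr0.
rewrite (big_ordS _ _ _ (fun j => cpowR (y :: t)`_j (s j - 1))) /=.
have -> : r - (c 0%N * y + \sum_(i < n) c i.+1 * t`_i) = r' - c 0%N * y.
  by rewrite /r'; ring.
by ring.
Qed.

(** The version over a simplex, needed when the points are confined between two extreme poles. Here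
    each integration raises [q] by [s 0], and the Gamma quotients telescope again. *)
Lemma hasC_dirichlet1 n (s : nat -> R[i]) (q : R[i]) (c : nat -> R) (r : R) :
  (forall j, (j < n)%N -> 0 < c j) -> 0 < r ->
  (forall j, (j < n)%N -> 0 < complex.Re (s j)) -> 0 < complex.Re q ->
  hasC (lebesgue_tuple n) (fun t : tup n =>
      if allpos t && (\sum_(j < n) c j * t`_j < r) then
        (\prod_(j < n) cpowR t`_j (s j - 1)) *
        cpowR (r - \sum_(j < n) c j * t`_j) (q - 1) else 0)
    ((\prod_(j < n) (cpowR (c j) (- s j) * cGamma (s j))) *
     (cpowR r (\sum_(j < n) s j + q - 1) * (cGamma q / cGamma (\sum_(j < n) s j + q)))).
Proof.
elim: n s q c => [|n ih] s q c c0 r0 s0 q0.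
  have := hasC_tuple0 (fun t : tup 0 => dir1 0 s q c r t).
  rewrite /dir1 /= !big_ord0 r0 subr0 !add0r !mul1r.
  by rewrite mulfV ?mulr1 //; exact: cGamma_neq0.
have s00 := s0 0%N isT.
have sS j : (j < n)%N -> 0 < complex.Re (s j.+1) by move=> jn; exact: s0.
have cS j : (j < n)%N -> 0 < c j.+1 by move=> jn; exact: c0.
have sq0 : 0 < complex.Re (s 0%N + q) by rewrite ReD addr_gt0.
have ih1 := ih _ _ _ cS r0 sS sq0.
pose s' j : R[i] := (complex.Re (s j))%:C; pose q' : R[i] := (complex.Re q)%:C.
have sq0' : 0 < complex.Re (s' 0%N + q') by move: sq0; rewrite !ReD.
have ih2 := ih (fun j => s' j.+1) (s' 0%N + q') _ cS r0 sS sq0'.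
set f := (fun t => _); have -> : f = fun t : tup n.+1 => dir1 n.+1 s q c r t by [].
apply/hasC_tuple_cons; first exact: cmeasurable_dir1.
have mz : @cmeasurable _ _ (measurableTypeR R * tup n)%type
    (fun z => dir1 n.+1 s q c r (tuple_cons z)).
  apply: (cmeasurable_comp (cmeasurable_dir1 n.+1 s q c r)).
  exact: measurable_tuple_cons.
pose k (s : nat -> R[i]) q :=
  cpowR (c 0%N) (- s 0%N) * (cGamma (s 0%N) * cGamma q / cGamma (s 0%N + q)) : R[i].
have := @hasC_fubini_swap R _ _ (measurableTypeR R) (tup n) lambda (lebesgue_tuple n)
  (fun z => dir1 n.+1 s q c r (tuple_cons z))
  (fun t => k s q * dir1 n (fun j => s j.+1) (s 0%N + q) (fun j => c j.+1) r t)
  (fun t => complex.Re (k s' q' * dir1 n (fun j => s' j.+1) (s' 0%N + q') (fun j => c j.+1) r t))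
  _ _ mz _ _ (hasCZ (k s' q') ih2).1 (hasCZ (k s q) ih1).
have h1 (t : tup n) : hasC lambda (fun x => dir1 n.+1 s q c r (tuple_cons (x, t)))
  (k s q * dir1 n (fun j => s j.+1) (s 0%N + q) (fun j => c j.+1) r t).
  exact: dir1S.
have h2 (t : tup n) : hasR lambda (fun x => normc (dir1 n.+1 s q c r (tuple_cons (x, t))))
  (complex.Re (k s' q' * dir1 n (fun j => s' j.+1) (s' 0%N + q') (fun j => c j.+1) r t)).
  have [+ _] := @dir1S n s' q' c r t c0 s00 q0.
  by under eq_fun do rewrite -normC_dir1.
move=> /(_ h1 h2); congr (hasC _ _ _).
rewrite (big_ordS _ _ _ (fun j => cpowR (c j) (- s j) * cGamma (s j))) (big_ordS _ _ _ s) /k.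
have -> : \sum_(j < n) s j.+1 + (s 0%N + q) = s 0%N + \sum_(i < n) s i.+1 + q by ring.
have tg : cGamma (s 0%N + q) != 0 by exact: cGamma_neq0.
set P := \prod_(j < n) _; set Q := cpowR r _; set G := cGamma (_ + _ + _).
move: tg; set H := cGamma (s 0%N + q) => tg.
transitivity (cpowR (c 0%N) (- s 0%N) * cGamma (s 0%N) * P * (Q * (cGamma q / G)) * (H / H)).
  by move: (cGamma q) (G^-1) (H^-1) (cpowR (c 0%N) _) (cGamma (s 0%N)) => *; ring.
by rewrite mulfV // mulr1.
Qed.

End dirichlet1_integrals.

Section tuple_scaling.
Context {R : realType}.
Notation lambda := (@lebesgue_measure R).
Notation tup n := (n.-tuple (measurableTypeR R)).

Definition tscale n (c : nat -> R) (t : tup n) : tup n := [tuple c j * t`_j | j < n].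

Lemma nth_tscale n c (t : tup n) j : (j < n)%N -> (tscale c t)`_j = c j * t`_j.
Proof. by move=> jn; rewrite (nth_mktuple _ _ (Ordinal jn)). Qed.

Lemma measurable_tscale d (T : measurableType d) n (c : T -> nat -> R) (f : T -> tup n) :
  (forall j, (j < n)%N -> measurable_fun setT (fun z => c z j)) -> measurable_fun setT f ->
  measurable_fun setT (fun z => tscale (c z) (f z)).
Proof.
move=> mc mf; apply/measurable_fun_tnthP => i.
rewrite (_ : _ \o _ = (fun z => c z i) \* (fun z => (f z)`_i)); last first.
  by apply/funext => z; rewrite /= (tnth_nth 0) nth_tscale.
apply: measurable_funM; first exact: mc.
by apply: (measurableT_comp (@measurable_nth R n i)).
Qed.

Lemma measurable_tscale_cst n (c : nat -> R) : measurable_fun setT (@tscale n c).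
Proof.
apply: (@measurable_tscale _ _ n (fun=> c) idfun).
  by move=> j _; exact: measurable_cst.
exact: measurable_id.
Qed.

Lemma allpos_tscale n c (t : tup n) : (forall j, (j < n)%N -> 0 < c j) ->
  allpos (tscale c t) = allpos t.
Proof.
move=> c0; apply/(all_nthP 0)/(all_nthP 0) => h i; rewrite size_tuple => ni.
  by have := h i; rewrite size_tuple nth_tscale // pmulr_rgt0 ?c0 //; apply.
by rewrite nth_tscale // pmulr_rgt0 ?c0 // h // size_tuple.
Qed.

Lemma tscale_cons n c x (t : tup n) :
  tscale c (tuple_cons (x, t)) = tuple_cons (c 0%N * x, tscale (fun j => c j.+1) t).
Proof.
apply: val_inj; apply: (@eq_from_nth _ 0); rewrite ?size_tuple // => i ni.
rewrite nth_tscale //; case: i ni => [//|i]; rewrite ltnS => ni.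
by rewrite /= -[RHS]/((tscale (fun j => c j.+1) t)`_i) nth_tscale.
Qed.

(** Stated for iterated integrals, so that one change of variables acts on the inner integral and
    the other on the outer one. *)
Lemma chvar_tuple_cons n (phi : R -> R) (d e : R -> R) (psi : tup n -> tup n)
    (D E : tup n -> R) :
  measurable_fun setT phi -> measurable_fun setT psi ->
  measurable_fun setT d -> measurable_fun setT e ->
  measurable_fun setT D -> measurable_fun setT E ->
  (forall x, 0 <= d x) -> (forall x, 0 <= e x) ->
  (forall t, 0 <= D t) -> (forall t, 0 <= E t) ->
  chvar lambda lambda phi d e -> chvar (lebesgue_tuple n) (lebesgue_tuple n) psi D E ->
  forall f : tup n.+1 -> \bar R, measurable_fun setT f -> (forall t, (0 <= f t)%E) ->
  (\int[lambda]_x \int[lebesgue_tuple n]_t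
     (f (tuple_cons (phi x, psi t)) * (d x * D t)%:E) =
   \int[lambda]_x \int[lebesgue_tuple n]_t (f (tuple_cons (x, t)) * (e x * E t)%:E))%E.
Proof.
move=> mphi mpsi md me mD mE d0 e0 D0 E0 phide psiDE f mf f0.
have mfx (x : measurableTypeR R) : measurable_fun setT (fun t => f (tuple_cons (x, t))).
  apply: (measurableT_comp mf).
  by apply: (measurableT_comp (@measurable_tuple_cons R n)); exact: measurable_pair1.
pose G (y : measurableTypeR R) := (\int[lebesgue_tuple n]_t (f (tuple_cons (y, t)) * (E t)%:E))%E.
have mF : measurable_fun setT (fun z : measurableTypeR R * tup n =>
    (f (tuple_cons z) * (E z.2)%:E)%E).
  apply: emeasurable_funM; first by apply: (measurableT_comp mf); exact: measurable_tuple_cons.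
  by apply/measurable_EFinP; exact: measurableT_comp.
have F0 (z : measurableTypeR R * tup n) : (0 <= f (tuple_cons z) * (E z.2)%:E)%E.
  by rewrite mule_ge0 // lee_fin.
have mG : measurable_fun setT G.
  exact: (@measurable_fun_fubini_tonelli_F _ _ _ _ _ (lebesgue_tuple n)
    (fun z : measurableTypeR R * tup n => f (tuple_cons z) * (E z.2)%:E)%E).
have G0 y : (0 <= G y)%E.
  by apply: integral_ge0 => t _; exact: (F0 (y, t)).
transitivity (\int[lambda]_x (G (phi x) * (d x)%:E))%E.
  apply: eq_integral => x _.
  transitivity (\int[lebesgue_tuple n]_t
    ((f (tuple_cons (phi x, psi t)) * (D t)%:E) * (d x)%:E))%E.
    by apply: eq_integral => t _; rewrite mulrC EFinM muleA.
  have mA : measurable_fun setT (fun t => f (tuple_cons (phi x, psi t)) * (D t)%:E)%E.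
    apply: emeasurable_funM; last exact/measurable_EFinP.
    exact: (measurableT_comp (mfx (phi x))).
  have A0 t : setT t -> (0 <= f (tuple_cons (phi x, psi t)) * (D t)%:E)%E.
    by move=> _; rewrite mule_ge0 // lee_fin.
  rewrite (ge0_integralZr (lebesgue_tuple n) measurableT mA A0) ?lee_fin //.
  by rewrite (psiDE (fun t => f (tuple_cons (phi x, t)))).
rewrite (phide G) //; apply: eq_integral => x _.
have mA : measurable_fun setT (fun t => f (tuple_cons (x, t)) * (E t)%:E)%E.
  by apply: emeasurable_funM; [exact: mfx|exact/measurable_EFinP].
have A0 t : setT t -> (0 <= f (tuple_cons (x, t)) * (E t)%:E)%E.
  by move=> _; exact: (F0 (x, t)).
rewrite /G -(ge0_integralZr (lebesgue_tuple n) measurableT mA A0) ?lee_fin //.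
by apply: eq_integral => t _; rewrite mulrC EFinM muleA.
Qed.

Lemma chvar_tscale n (c : nat -> R) : (forall j, (j < n)%N -> 0 < c j) ->
  chvar (lebesgue_tuple n) (lebesgue_tuple n) (tscale c)
    (fun t => if allpos t then \prod_(j < n) c j else 0)
    (fun t => if allpos t then 1 else 0).
Proof.
elim: n c => [|n ih] c c0 f mf f0.
  apply: eq_integral => t _; rewrite big_ord0.
  by have -> : tscale c t = t := etrans (tuple0 _) (esym (tuple0 _)).
have cS j : (j < n)%N -> 0 < c j.+1 by move=> jn; exact: c0.
have mif m (k : R) : measurable_fun setT (fun t : tup m => if allpos t then k else 0 : R).
  by apply: measurable_fun_ifT => //; exact: measurable_allpos.
have mif1 (k : R) : measurable_fun setT (fun x : R => if 0 < x then k else 0 : R).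
  by apply: measurable_fun_ifT => //; exact: measurable_fun_ltr.
have if0 (b : bool) (k : R) : 0 <= k -> 0 <= (if b then k else 0) by case: b.
have P0 : 0 <= \prod_(j < n) c j.+1 by apply: prodr_ge0 => j _; apply/ltW/cS.
have PS0 : 0 <= \prod_(j < n.+1) c j by apply: prodr_ge0 => j _; apply/ltW/c0.
rewrite tonelli_cons; last 2 first.
- apply: emeasurable_funM; last by apply/measurable_EFinP; exact: mif.
  by apply: (measurableT_comp mf); exact: measurable_tscale_cst.
- by move=> t; rewrite mule_ge0 // lee_fin if0.
rewrite tonelli_cons; last 2 first.
- apply: emeasurable_funM => //; by apply/measurable_EFinP; exact: mif.
- by move=> t; rewrite mule_ge0 // lee_fin if0.
have := @chvar_tuple_cons n _ _ _ _ _ _ (mulrl_measurable (c 0%N))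
  (@measurable_tscale_cst n (fun j => c j.+1))
  (mif1 (c 0%N)) (mif1 1) (mif n (\prod_(j < n) c j.+1)) (mif n 1)
  (fun x => if0 _ _ (ltW (c0 0%N isT))) (fun x => if0 _ _ ler01)
  (fun t => if0 _ _ P0) (fun t => if0 _ _ ler01)
  (chvar_scale (c0 0%N isT)) (ih _ cS) f mf f0.
move=> e; apply: (etrans _ (etrans e _)) => {e}.
- apply: eq_integral => x _; apply: eq_integral => t _.
  rewrite tscale_cons (big_ordS _ _ _ c) /= /allpos /= -/(allpos t).
  by case: (0 < x); case: (allpos t); rewrite /= ?mul0r ?mulr0.
- apply: eq_integral => x _; apply: eq_integral => t _.
  by rewrite /= /allpos /= -/(allpos t); case: (0 < x); case: (allpos t); rewrite /= ?mul0r ?mulr1 ?mulr0.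
Qed.

End tuple_scaling.

(** * The Dixon-Anderson change of variables *)

Section pole_functions.
Context {R : realType}.
Notation lambda := (@lebesgue_measure R).
Notation tup n := (n.-tuple (measurableTypeR R)).

Definition pole_sum n (a : nat -> R) (w : seq R) (t : R) : R :=
  1 + \sum_(j < n) w`_j / (a j - t).

(** The derivative in [t] of [(t - a0) * pole_sum n a w t], after combining the two terms at each
    pole. *)
Definition pole_deriv n (a : nat -> R) (w : seq R) (a0 t : R) : R :=
  1 + \sum_(j < n) w`_j * (a j - a0) / (a j - t) ^+ 2.

Lemma measurable_pole_sum d (T : measurableType d) n a (w : T -> tup n) (t : T -> R) :
  measurable_fun setT w -> measurable_fun setT t ->
  measurable_fun setT (fun z => pole_sum n a (w z) (t z)).
Proof.
move=> mw mt; apply: measurable_funD => //; apply: measurable_sum => j.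
apply: measurable_funM.
  exact: (measurableT_comp (@measurable_nth R n j)).
by apply: measurable_funV; exact: measurable_funB.
Qed.

Lemma measurable_pole_deriv d (T : measurableType d) n a a0 (w : T -> tup n) (t : T -> R) :
  measurable_fun setT w -> measurable_fun setT t ->
  measurable_fun setT (fun z => pole_deriv n a (w z) a0 (t z)).
Proof.
move=> mw mt; apply: measurable_funD => //; apply: measurable_sum => j.
apply: measurable_funM; last first.
  by apply: measurable_funV; apply: measurable_funX; exact: measurable_funB.
apply: measurable_funM => //.
exact: (measurableT_comp (@measurable_nth R n j)).
Qed.

Let is_derive_inv_sub (a x : R) : a - x != 0 ->
  is_derive x (1 : R) (fun y : R => (a - y)^-1) (((a - x) ^+ 2)^-1).
Proof.
move=> d.
have dx : is_derive x (1 : R) (fun y : R => a - y) (-1).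
  have := is_deriveB (is_derive_cst a x (1 : R)) (is_derive_id x (1 : R)).
  by rewrite sub0r.
apply: DeriveDef; first by apply: derivableV => //; case: dx.
by rewrite deriveV //; case: dx => // _ ->; rewrite /GRing.scale /= mulrN1 opprK.
Qed.

Let continuous_sum_at n (F : nat -> R -> R) (x : R) :
  (forall j, (j < n)%N -> {for x, continuous (F j)}) ->
  {for x, continuous (fun y => \sum_(j < n) F j y)}.
Proof.
elim: n F => [|n ih] F cF.
  rewrite (_ : (fun y => _) = fun=> 0); first exact: cvg_cst.
  by apply/funext => y; rewrite big_ord0.
rewrite (_ : (fun y => _) = fun y => F 0%N y + \sum_(j < n) F j.+1 y); last first.
  by apply/funext => y; rewrite (big_ordS _ _ _ (fun j => F j y)).
apply: (@cvgD _ R); first exact: cF.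
by apply: (ih (fun j => F j.+1)) => j jn; exact: cF.
Qed.

Let continuous_inv_sub (a x : R) : a - x != 0 ->
  {for x, continuous (fun y : R => (a - y)^-1)}.
Proof.
move=> d; apply: (@cvgV _ R) => //.
by apply: (@cvgB _ R); [exact: cvg_cst|exact: cvg_id].
Qed.

Variables (n : nat) (a : nat -> R) (w : tup n) (a0 : R).
Hypothesis a0_lt : (0 < n)%N -> a0 < a 0%N.
Hypothesis a_ge : forall j, (j < n)%N -> a 0%N <= a j.
Hypothesis w_pos : allpos w.

(** The substitution runs from [a0] up to the next pole, where it blows up, or up to infinity if no
    pole remains. *)
Let b : itv_bound R := if (0 < n)%N then BLeft (a 0%N) else +oo%O.

Let w_gt0 j : (j < n)%N -> 0 < w`_j.
Proof. by move=> jn; move/(all_nthP 0): w_pos; apply; rewrite size_tuple. Qed.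

Let inI x : x \in Interval (BLeft a0) b -> a0 <= x.
Proof. by rewrite /b; case: ifP => _; rewrite in_itv /= => /andP[]. Qed.

Let inI_lt x j : x \in Interval (BLeft a0) b -> (j < n)%N -> x < a j.
Proof.
rewrite /b; case: ifP => [n0|]; last by case: (n).
rewrite in_itv /= => /andP[_ xa] jn; exact: lt_le_trans xa (a_ge jn).
Qed.

Let sub_neq0 x j : x \in Interval (BLeft a0) b -> (j < n)%N -> a j - x != 0.
Proof. by move=> xI jn; rewrite gt_eqF // subr_gt0 inI_lt. Qed.

Let h x := (x - a0) * pole_sum n a w x.

Let is_derive_h x : x \in Interval (BLeft a0) b ->
  is_derive x (1 : R) h (pole_deriv n a w a0 x).
Proof.
move=> xI.
have dj (j : 'I_n) : is_derive x (1 : R) (fun y : R => w`_j / (a j - y))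
    (w`_j * ((a j - x) ^+ 2)^-1).
  exact: (is_deriveZ w`_j (is_derive_inv_sub (sub_neq0 xI (ltn_ord j)))).
have ds := is_derive_sum dj.
have d1 := is_deriveD (is_derive_cst (1 : R) x (1 : R)) ds.
have d0 := is_deriveB (is_derive_id x (1 : R)) (is_derive_cst a0 x (1 : R)).
have := is_deriveM d0 d1; rewrite fct_sumE.
have -> : ((id - cst a0) * (cst 1 + (fun x0 : R => \sum_(i < n) w`_i / (a i - x0))))%R = h.
  by apply/funext => y.
move/is_derive_eq; apply.
rewrite /pole_deriv /GRing.scale /= subr0 add0r mulr1.
change ((x - a0) * (\sum_(i < n) w`_i / (a i - x) ^+ 2) +
  (1 + \sum_(i < n) w`_i / (a i - x)) = 1 + \sum_(j < n) w`_j * (a j - a0) / (a j - x) ^+ 2).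
rewrite addrCA; congr (_ + _); rewrite mulr_sumr -big_split /=.
apply: eq_bigr => j _; field.
exact: sub_neq0.
Qed.

Let continuous_pole_deriv x : x \in Interval (BLeft a0) b ->
  {for x, continuous (pole_deriv n a w a0)}.
Proof.
move=> xI; apply: (@cvgD _ R); first exact: cvg_cst.
apply: (continuous_sum_at (F := fun j y => w`_j * (a j - a0) / (a j - y) ^+ 2)) => j jn.
apply: (@cvgM _ R); first exact: cvg_cst.
rewrite (_ : (fun y => _) = fun y => (a j - y)^-1 * (a j - y)^-1); last first.
  by apply/funext => y; rewrite expr2 invfM.
have c := continuous_inv_sub (sub_neq0 xI jn).
by rewrite expr2 invfM; apply: (@cvgM _ R); exact: c.
Qed.

Let pole_sum_ge1 x : x \in Interval (BLeft a0) b -> 1 <= pole_sum n a w x.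
Proof.
move=> xI; rewrite lerDl sumr_ge0 // => j _; rewrite divr_ge0 //.
  by rewrite ltW // w_gt0.
by rewrite subr_ge0 ltW // inI_lt.
Qed.

Let h_mono : {in Interval (BLeft a0) b &, {homo h : x y / x < y}}.
Proof.
move=> x y xI yI xy; rewrite /h.
apply: (@le_lt_trans _ _ ((x - a0) * pole_sum n a w y)).
  rewrite ler_wpM2l ?subr_ge0 ?inI // lerD2l ler_sum // => j _.
  rewrite ler_wpM2l ?(ltW (w_gt0 _)) // lef_pV2 ?posrE ?subr_gt0 ?inI_lt //.
  by rewrite lerB // ltW.
by rewrite ltr_pM2r ?ltrD2r // (lt_le_trans ltr01) // pole_sum_ge1.
Qed.

Let h_surj v : 0 <= v -> exists2 x, x \in Interval (BLeft a0) b & h x = v.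
Proof.
move=> v0.
have [n0|n0] := posnP n.
  exists (a0 + v).
    by rewrite /b n0 /= in_itv /= andbT lerDl.
  by rewrite /h /pole_sum big1 ?addr0 ?mulr1; [ring|move=> [j jn] _; exfalso; have := jn; rewrite n0].
move: v0; rewrite le_eqVlt => /predU1P[<-|v0].
  exists a0; last by rewrite /h subrr mul0r.
  by rewrite /b n0 in_itv /= lexx a0_lt.
have w0 := w_gt0 n0.
have d0 : 0 < a 0%N - a0 by rewrite subr_gt0 a0_lt.
(* At [y = a 0 - e] the term of the first pole alone already contributes exactly [v]; the other
   terms are nonnegative, so [h y >= v] and the intermediate value theorem applies. *)
pose e := (a 0%N - a0) * w`_0 / (v + w`_0).
have vw : 0 < v + w`_0 by rewrite addr_gt0.
have e0 : 0 < e by rewrite divr_gt0 // mulr_gt0.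
have ed : e < a 0%N - a0.
  by rewrite /e ltr_pdivrMr // ltr_pM2l // ltrDr.
pose y := a 0%N - e.
have a0y : a0 < y by rewrite /y; lra.
have yI : y \in Interval (BLeft a0) b by rewrite /b n0 in_itv /= ltW //= /y; lra.
have hy : v <= h y.
  have {1}<- : (y - a0) * (w`_0 / (a 0%N - y)) = v.
      have -> : a 0%N - y = e by rewrite /y; ring.
      have -> : y - a0 = (a 0%N - a0) - e by rewrite /y; ring.
      rewrite /e; move: (a 0%N - a0) (w`_0) d0 w0 vw => d u d0 u0 vu.
      by field; rewrite !gt_eqF.
  rewrite ler_pM2l ?subr_gt0 // /pole_sum (bigD1 (Ordinal n0)) //= addrCA lerDl.
  rewrite addr_ge0 // sumr_ge0 // => j _; rewrite divr_ge0 ?subr_ge0 //.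
    by rewrite ltW // w_gt0.
  by rewrite ltW // inI_lt.
have ch : {within `[a0, y], continuous h}.
  apply: continuous_in_subspaceT => z; rewrite inE /= in_itv /= => /andP[az zy].
  apply: differentiable_continuous; apply/derivable1_diffP.
  have zI : z \in Interval (BLeft a0) b.
    by rewrite /b n0 in_itv /= az (le_lt_trans zy) // /y; lra.
  by have := is_derive_h zI; case.
have ha0 : h a0 = 0 by rewrite /h subrr mul0r.
have [|c cI hc] := IVT (ltW a0y) ch (v := v).
  by rewrite ha0 ge_min le_max (ltW v0) hy orbT.
exists c => //; move: cI; rewrite in_itv /= => /andP[ac cy].
by rewrite /b n0 in_itv /= ac (le_lt_trans cy) // /y; lra.
Qed.

(** The substitution in the first point: with the other residues [w] held fixed, the residue at [a0]
    is this function of [x], increasing from 0 to infinity. *)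
Lemma chvar_pole : chvar lambda lambda (fun x => (x - a0) * pole_sum n a w x)
  (fun x => if (a0 < x) && ((0 < n)%N ==> (x < a 0%N)) then pole_deriv n a w a0 x else 0)
  (fun y => if 0 < y then 1 else 0).
Proof.
rewrite [X in chvar _ _ _ X _](_ : _ =
  fun x => if x \in Interval (BRight a0) b then pole_deriv n a w a0 x else 0); last first.
  by apply/funext => x; rewrite /b; case: (0 < n)%N; rewrite in_itv.
apply: (@chvar_increasing R h).
- apply: measurable_funM; first exact: measurable_funB.
  by apply: (measurable_pole_sum a (w := fun=> w)); [exact: measurable_cst|exact: measurable_id].
- by apply: (measurable_pole_deriv a a0 (w := fun=> w)); [exact: measurable_cst|exact: measurable_id].
- by rewrite /h subrr mul0r.
- exact: is_derive_h.
- exact: continuous_pole_deriv.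
- move=> x xI; rewrite addr_ge0 // sumr_ge0 // => j _.
  rewrite divr_ge0 ?sqr_ge0 // mulr_ge0 ?(ltW (w_gt0 _)) // subr_ge0.
  by rewrite (le_trans (inI xI)) // ltW // inI_lt.
- exact: h_mono.
- exact: h_surj.
Qed.

End pole_functions.

Section dixon_anderson_map.
Context {R : realType}.
Notation tup n := (n.-tuple (measurableTypeR R)).
Implicit Types (a : nat -> R).

(* [wmap a x] lists the residues [w] of
   [prod_i (x_i - t) / (a_i - t) = 1 + sum_j w_j / (a_j - t)]; the recursion
   multiplies the expansion for the pairs of index >= 1 by the first factor. *)
Fixpoint wmap n a : tup n -> tup n :=
  match n return tup n -> tup n with
  | 0 => id
  | n'.+1 => fun t =>
      let w := wmap (fun j => a j.+1) [tuple of behead t] in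
      tuple_cons ((thead t - a 0%N) * pole_sum n' (fun j => a j.+1) w (a 0%N),
        tscale (fun j => (a j.+1 - thead t) / (a j.+1 - a 0%N)) w)
  end.

(** The last point has no upper bound. A big conjunction is used so that measurability follows by
    induction. *)
Definition interlaced n a (x : seq R) : bool :=
  \big[andb/true]_(i < n) ((a i < x`_i) && ((i.+1 < n)%N ==> (x`_i < a i.+1))).

(** The Jacobian of [wmap a] on the interlacing sequences, as [chvar_wmap] shows. *)
Definition vandermonde_ratio n a (x : seq R) : R :=
  \prod_(j < n) \prod_(i < j) ((x`_j - x`_i) / (a j - a i)).

Definition increasing_upto n a := forall i j, (i < j)%N -> (j < n)%N -> a i < a j.

Lemma increasing_uptoS n a : increasing_upto n.+1 a -> increasing_upto n (fun j => a j.+1).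
Proof. by move=> ha i j ij jn; exact: ha. Qed.

Lemma wmap_cons n a x (t : tup n) : wmap a (tuple_cons (x, t)) =
  tuple_cons ((x - a 0%N) * pole_sum n (fun j => a j.+1) (wmap (fun j => a j.+1) t) (a 0%N),
        tscale (fun j => (a j.+1 - x) / (a j.+1 - a 0%N)) (wmap (fun j => a j.+1) t)).
Proof.
rewrite /= (_ : [tuple of behead (tuple_cons (x, t))] = t); last exact: val_inj.
by rewrite /tuple_cons theadE.
Qed.

Lemma measurable_wmap n a : measurable_fun setT (@wmap n a).
Proof.
elim: n a => [|n ih] a; first exact: measurable_id.
have mw : measurable_fun setT (fun t : tup n.+1 => wmap (fun j => a j.+1) [tuple of behead t]).
  by apply: (measurableT_comp (ih _)); exact: measurable_behead.
have mh : measurable_fun setT (fun t : tup n.+1 => thead t).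
  exact: measurable_tnth.
apply: (measurableT_comp (@measurable_tuple_cons R n)).
apply/measurable_fun_pairP; split => /=.
  apply: measurable_funM; first exact: measurable_funB.
  by apply: measurable_pole_sum => //; exact: measurable_cst.
apply: measurable_tscale => // j _.
by apply: measurable_funM => //; exact: measurable_funB.
Qed.

Lemma interlaced_cons n a x (t : seq R) : interlaced n.+1 a (x :: t) =
  (a 0%N < x) && ((0 < n)%N ==> (x < a 1%N)) && interlaced n (fun j => a j.+1) t.
Proof.
rewrite /interlaced (big_ordS _ _ _ (fun i =>
  (a i < (x :: t)`_i) && ((i.+1 < n.+1)%N ==> ((x :: t)`_i < a i.+1)))) /=.
by rewrite ltnS.
Qed.

Lemma vandermonde_ratio_cons n a x (t : seq R) : vandermonde_ratio n.+1 a (x :: t) =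
  (\prod_(j < n) ((t`_j - x) / (a j.+1 - a 0%N))) * vandermonde_ratio n (fun j => a j.+1) t.
Proof.
rewrite /vandermonde_ratio (big_ordS _ _ _ (fun j => \prod_(i < j) (((x :: t)`_j - (x :: t)`_i) / (a j - a i)))).
rewrite big_ord0 mul1r -big_split /=; apply: eq_bigr => j _.
by rewrite (big_ordS _ _ _ (fun i => (t`_j - (x :: t)`_i) / (a j.+1 - a i))).
Qed.

Lemma measurable_big_and d (T : measurableType d) n (b : nat -> T -> bool) :
  (forall i, measurable_fun setT (b i)) ->
  measurable_fun setT (fun x => \big[andb/true]_(i < n) b i x).
Proof.
move=> mb; elim: n => [|n ih].
  rewrite (_ : (fun _ => _) = fun=> true); first exact: measurable_cst.
  by apply/funext => x; rewrite big_ord0.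
rewrite (_ : (fun _ => _) = fun x => (\big[andb/true]_(i < n) b i x) && b n x).
  exact: measurable_and.
by apply/funext => x; rewrite big_ord_recr.
Qed.

Lemma measurable_interlaced_fun d (T : measurableType d) n (a : T -> nat -> R) (x : T -> seq R) :
  (forall i, measurable_fun setT (fun z => a z i)) ->
  (forall i, measurable_fun setT (fun z => (x z)`_i)) ->
  measurable_fun setT (fun z => interlaced n (a z) (x z)).
Proof.
move=> ma mx; apply: (@measurable_big_and _ _ n (fun i z =>
  (a z i < (x z)`_i) && ((i.+1 < n)%N ==> ((x z)`_i < a z i.+1)))) => i.
apply: measurable_and; first exact: measurable_fun_ltr.
case: (i.+1 < n)%N => /=; last exact: measurable_cst.
exact: measurable_fun_ltr.
Qed.

Lemma measurable_interlaced n a : measurable_fun setT (fun x : tup n => interlaced n a x).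
Proof. by apply: measurable_interlaced_fun => i //; exact: measurable_nth. Qed.

Lemma measurable_vandermonde_ratio n a :
  measurable_fun setT (fun x : tup n => vandermonde_ratio n a x).
Proof.
apply: measurable_prod => j _; apply: measurable_prod => i _.
apply: measurable_funM => //.
by apply: measurable_funB; exact: measurable_nth.
Qed.

(** Expresses the first residue through [x] and the final, rescaled residues alone. This is what
    lets the first point be integrated last. *)
Lemma pole_sum_tscale n a (a0 x : R) (w : tup n) : (forall j, (j < n)%N -> a j != x) ->
  pole_sum n a (tscale (fun j => (a j - x) / (a j - a0)) w) x = pole_sum n a w a0.
Proof.
move=> ax; congr (_ + _); apply: eq_bigr => j _; rewrite nth_tscale //.
(* For [a j = a0] both sides vanish, the inverse of 0 being 0. *)
have [->|aj0] := eqVneq (a j) a0; first by rewrite subrr invr0 !mulr0 !mul0r.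
by field; rewrite !subr_eq0 aj0 ax.
Qed.

Lemma pole_deriv_tscale n a (a0 x : R) (w : tup n) : (forall j, (j < n)%N -> a j != x) ->
  (forall j, (j < n)%N -> a j != a0) ->
  pole_deriv n a (tscale (fun j => (a j - x) / (a j - a0)) w) a0 x = pole_sum n a w x.
Proof.
move=> ax aa; congr (_ + _); apply: eq_bigr => j _; rewrite nth_tscale //.
by field; rewrite !subr_eq0 aa ?ax.
Qed.

Lemma pole_sum_wmap n a (x : tup n) (t : R) : increasing_upto n a ->
  (forall j, (j < n)%N -> a j != t) ->
  pole_sum n a (wmap a x) t = \prod_(j < n) ((x`_j - t) / (a j - t)).
Proof.
elim: n a x => [|n ih] a x ha ta; first by rewrite /pole_sum !big_ord0 addr0.
case/tupleP: x => x0 x.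
have -> : [tuple of x0 :: x] = tuple_cons (x0, x) by [].
have -> : \prod_(j < n.+1) (((tuple_cons (x0, x))`_j - t) / (a j - t)) =
    (x0 - t) / (a 0%N - t) * \prod_(j < n) ((x`_j - t) / (a j.+1 - t)).
  by rewrite (big_ordS _ _ _ (fun j => ((x0 :: x)`_j - t) / (a j - t))).
rewrite wmap_cons.
have taS j : (j < n)%N -> a j.+1 != t by move=> jn; exact: ta.
rewrite -(ih _ _ (increasing_uptoS ha) taS).
set w := wmap _ x.
have := @nth_tscale R n (fun j => (a j.+1 - x0) / (a j.+1 - a 0%N)) w.
move: (tscale _ w) => tw twE.
rewrite {1}/pole_sum tuple_consE (big_ordS _ _ _ (fun j =>
  (((x0 - a 0%N) * pole_sum n (fun j => a j.+1) w (a 0%N)) :: tw)`_j / (a j - t))) /= /pole_sum.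
rewrite [X in 1 + (_ + X)](eq_bigr (fun j : 'I_n => w`_j *
  ((a j.+1 - x0) / (a j.+1 - a 0%N) / (a j.+1 - t)))); last first.
  by move=> j _; rewrite twE // mulrAC [_ * w`_j]mulrC !mulrA.
have t0 : a 0%N - t != 0 by rewrite subr_eq0 ta.
(* Partial fractions in [t] of the first factor times [1 / (a_j - t)]; the part with a pole at [a_0]
   then cancels against the sum contained in the new first residue. *)
rewrite [X in 1 + (_ + X)](_ : _ = (x0 - t) / (a 0%N - t) * (\sum_(j < n) w`_j / (a j.+1 - t))
    - (x0 - a 0%N) / (a 0%N - t) * (\sum_(j < n) w`_j / (a j.+1 - a 0%N))); last first.
  rewrite !mulr_sumr -sumrB; apply: eq_bigr => j _.
  have tj : a j.+1 - t != 0 by rewrite subr_eq0 taS.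
  have aj : a j.+1 - a 0%N != 0 by rewrite gt_eqF // subr_gt0 ha //= ltnS.
  by field; rewrite t0 tj aj.
move: (\sum_(j < n) _) (\sum_(j < n) _) => S U.
by field.
Qed.

Lemma interlacedP n a (x : seq R) : reflect
  (forall i, (i < n)%N -> a i < x`_i /\ ((i.+1 < n)%N -> x`_i < a i.+1)) (interlaced n a x).
Proof.
rewrite /interlaced big_andE; apply: (iffP forallP) => [h i ni|h i].
  by have /andP[-> /implyP] := h (Ordinal ni).
have [h1 h2] := h i (ltn_ord i).
by apply/andP; split => //; exact/implyP.
Qed.

Lemma increasing_upto_le n a i j : increasing_upto n a -> (i <= j)%N -> (j < n)%N -> a i <= a j.
Proof. by move=> ha; rewrite leq_eqVlt => /predU1P[->//|ij jn]; apply/ltW/ha. Qed.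

Lemma interlaced_gt n a (x : seq R) i j : increasing_upto n a ->
  interlaced n a x -> (i <= j)%N -> (j < n)%N -> a i < x`_j.
Proof.
move=> ha /interlacedP h ij jn; have [h1 _] := h j jn.
exact: le_lt_trans (increasing_upto_le ha ij jn) h1.
Qed.

Lemma interlaced_lt n a (x : seq R) i j : increasing_upto n a ->
  interlaced n a x -> (i < j)%N -> (j < n)%N -> x`_i < a j.
Proof.
move=> ha /interlacedP h ij jn; have [_ h2] := h i (ltn_trans ij jn).
apply: lt_le_trans (h2 (leq_ltn_trans ij jn)) _.
exact: (increasing_upto_le ha ij jn).
Qed.

Lemma interlaced_mono n a (x : seq R) i j : increasing_upto n a ->
  interlaced n a x -> (i < j)%N -> (j < n)%N -> x`_i < x`_j.
Proof.
move=> ha hx ij jn; apply: lt_trans (interlaced_lt ha hx ij jn) _.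
exact: (interlaced_gt ha hx).
Qed.

Lemma vandermonde_ratio_gt0 n a (x : seq R) : increasing_upto n a ->
  interlaced n a x -> 0 < vandermonde_ratio n a x.
Proof.
move=> ha hx; apply: prodr_gt0 => j _; apply: prodr_gt0 => i _.
rewrite divr_gt0 // subr_gt0; first by apply: (interlaced_mono ha hx).
by apply: ha.
Qed.

Lemma allpos_cons n x (t : tup n) : allpos (tuple_cons (x, t)) = (0 < x) && allpos t.
Proof. by []. Qed.

Lemma allpos_wmap n a (x : tup n) : increasing_upto n a -> interlaced n a x -> allpos (wmap a x).
Proof.
elim: n a x => [|n ih] a x ha; first by rewrite tuple0.
case/tupleP: x => x0 x.
have -> : [tuple of x0 :: x] = tuple_cons (x0, x) by [].
rewrite wmap_cons interlaced_cons => /andP[/andP[a0 a1] hx].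
have pw := ih _ _ (increasing_uptoS ha) hx.
have c0 j : (j < n)%N -> 0 < (a j.+1 - x0) / (a j.+1 - a 0%N).
  move=> jn; rewrite divr_gt0 ?subr_gt0 ?ha ?ltnS //.
  apply: lt_le_trans (implyP a1 _) (increasing_upto_le ha _ _) => //.
  exact: leq_ltn_trans jn.
rewrite allpos_cons allpos_tscale // pw andbT mulr_gt0 ?subr_gt0 //.
rewrite ltr_wpDr // sumr_ge0 // => j _; rewrite divr_ge0 ?subr_ge0 //.
  by move/(all_nthP 0): pw => pw; rewrite ltW // pw // size_tuple.
by apply/ltW/ha => //; rewrite ltnS.
Qed.

End dixon_anderson_map.

Section dixon_anderson_chvar.
Context {R : realType}.
Notation lambda := (@lebesgue_measure R).
Notation tup n := (n.-tuple (measurableTypeR R)).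
Implicit Types (a : nat -> R).

Definition interlaced_density n a (x : seq R) : R :=
  if interlaced n a x then vandermonde_ratio n a x else 0.

Lemma interlaced_density_ge0 n a x : increasing_upto n a -> 0 <= interlaced_density n a x.
Proof.
move=> ha; rewrite /interlaced_density; case: ifP => // hx.
exact/ltW/vandermonde_ratio_gt0.
Qed.

Lemma measurable_interlaced_density n a :
  measurable_fun setT (fun x : tup n => interlaced_density n a x).
Proof.
apply: measurable_fun_ifT => //; first exact: measurable_interlaced.
exact: measurable_vandermonde_ratio.
Qed.

Definition pos_density (x : seq R) : R := if allpos x then 1 else 0.

Lemma pos_density_ge0 x : 0 <= pos_density x.
Proof. by rewrite /pos_density; case: ifP. Qed.

Lemma measurable_pos_density n : measurable_fun setT (fun x : tup n => pos_density x).
Proof. by apply: measurable_fun_ifT => //; exact: measurable_allpos. Qed.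

Let pole_density n (a : nat -> R) (a0 x : R) (w : seq R) : R :=
  if [&& a0 < x, (0 < n)%N ==> (x < a 0%N) & allpos w] then pole_deriv n a w a0 x else 0.

Let pole_deriv_ge0 n a (a0 x : R) (w : tup n) : (forall j, (j < n)%N -> a0 <= a j) ->
  allpos w -> 0 <= pole_deriv n a w a0 x.
Proof.
move=> ha pw; rewrite addr_ge0 // sumr_ge0 // => j _.
rewrite divr_ge0 ?sqr_ge0 // mulr_ge0 ?subr_ge0 ?ha //.
by move/(all_nthP 0): pw => pw; rewrite ltW // pw // size_tuple.
Qed.

(** Adding the first pole multiplies the Vandermonde ratio by [prod_j (t_j - x) / (a_j - a_0)]. This
    splits into the Jacobian of the rescaling and a value of [pole_sum] at [x]; written in the
    rescaled residues, the latter is precisely the derivative required for the substitution in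
    [x]. *)
Let section_chvar n a (x : R) : increasing_upto n.+1 a ->
  chvar (lebesgue_tuple n) (lebesgue_tuple n) (wmap (fun j => a j.+1))
    (interlaced_density n (fun j => a j.+1)) pos_density ->
  forall f : tup n.+1 -> \bar R, measurable_fun setT f -> (forall t, (0 <= f t)%E) ->
  (\int[lebesgue_tuple n]_t (f (wmap a (tuple_cons (x, t))) *
      (interlaced_density n.+1 a (tuple_cons (x, t)))%:E) =
   \int[lebesgue_tuple n]_w (f (tuple_cons
        (((x - a 0%N) * pole_sum n (fun j => a j.+1) w x)%R, w)) *
      (pole_density n (fun j => a j.+1) (a 0%N) x w)%:E))%E.
Proof.
move=> ha ih f mf f0; set a' := fun j => a j.+1 in ih *.
have [xI|xI] := boolP ((a 0%N < x) && ((0 < n)%N ==> (x < a 1%N))); last first.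
  rewrite !integral0_eq // => t _.
    rewrite /pole_density; case: ifP => [/and3P[h1 h2 _]|_]; last by rewrite mule0.
    by move: xI; rewrite h1 h2.
  by rewrite /interlaced_density interlaced_cons (negbTE xI) mule0.
have ha' := increasing_uptoS ha.
have xa j : (j < n)%N -> x < a' j.
  case/andP: xI => _ /implyP h jn; have n0 := leq_ltn_trans (leq0n j) jn.
  exact: lt_le_trans (h n0) (increasing_upto_le ha' (leq0n j) jn).
have aa j : (j < n)%N -> a 0%N < a' j by move=> jn; exact: ha.
pose c j := (a' j - x) / (a' j - a 0%N).
have c0 j : (j < n)%N -> 0 < c j by move=> jn; rewrite divr_gt0 // subr_gt0 ?xa ?aa.
pose C := \prod_(j < n) c j.
have C0 : 0 < C by apply: prodr_gt0 => j _; exact: c0.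
pose G (w : tup n) := tuple_cons ((x - a 0%N) * pole_sum n a' w (a 0%N), tscale c w).
have mG : measurable_fun setT G.
  apply: (measurableT_comp (@measurable_tuple_cons R n)).
  apply/measurable_fun_pairP; split => /=; last exact: measurable_tscale_cst.
  apply: measurable_funM => //.
  by apply: measurable_pole_sum; [exact: measurable_id|exact: measurable_cst].
(* The absolute values here and in [k] only make the test functions nonnegative everywhere, as
   [chvar] demands; on the support of the densities they change nothing. *)
pose g (w : tup n) := (f (G w) * (`|pole_sum n a' w x| * C)%R%:E)%E.
pose K (w : tup n) := tuple_cons ((x - a 0%N) * pole_sum n a' w x, w).
have mK : measurable_fun setT K.
  apply: (measurableT_comp (@measurable_tuple_cons R n)).
  apply/measurable_fun_pairP; split => /=; last exact: measurable_id.
  apply: measurable_funM => //.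
  by apply: measurable_pole_sum; [exact: measurable_id|exact: measurable_cst].
pose k (w : tup n) := (f (K w) * (`|pole_deriv n a' w (a 0%N) x|)%R%:E)%E.
have mg : measurable_fun setT g.
  apply: emeasurable_funM; first exact: (measurableT_comp mf).
  apply/measurable_EFinP; apply: measurable_funM => //.
  apply: measurableT_comp => //.
  by apply: measurable_pole_sum; [exact: measurable_id|exact: measurable_cst].
have mk : measurable_fun setT k.
  apply: emeasurable_funM; first exact: (measurableT_comp mf).
  apply/measurable_EFinP; apply: measurableT_comp => //.
  by apply: measurable_pole_deriv; [exact: measurable_id|exact: measurable_cst].
have g0 w : (0 <= g w)%E by rewrite mule_ge0 // lee_fin mulr_ge0 // ltW.
have k0 w : (0 <= k w)%E by rewrite mule_ge0 // lee_fin.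
transitivity (\int[lebesgue_tuple n]_t (g (wmap a' t) * (interlaced_density n a' t)%:E))%E.
  apply: eq_integral => t _.
  rewrite /interlaced_density interlaced_cons xI andTb.
  case: ifP => ht; last by rewrite !mule0.
  rewrite /g -muleA; congr (_ * _)%E; first by rewrite wmap_cons.
  rewrite -EFinM; congr (_%:E).
  rewrite vandermonde_ratio_cons; congr (_ * _).
  rewrite pole_sum_wmap //; last by move=> j jn; rewrite gt_eqF // xa.
  rewrite ger0_norm; last first.
    apply: prodr_ge0 => j _; rewrite divr_ge0 // subr_ge0 ltW ?xa //.
    exact: lt_trans (xa _ (ltn_ord j)) (interlaced_gt ha' ht (leqnn j) (ltn_ord j)).
  rewrite -big_split /=; apply: eq_bigr => j _.
  have xj := xa j (ltn_ord j); have aj := aa j (ltn_ord j).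
  by rewrite /c /a' in xj aj *; field; rewrite !subr_eq0 !gt_eqF.
rewrite (ih g) //.
transitivity (\int[lebesgue_tuple n]_w (k (tscale c w) * (if allpos w then C else 0)%:E))%E.
  apply: eq_integral => w _; rewrite /pos_density; case: ifP => pw; last by rewrite !mule0.
  rewrite mule1 /g /k -muleA -EFinM; congr (f _ * (_%:E))%E.
    rewrite /G /K pole_sum_tscale // => j jn; by rewrite gt_eqF // xa.
  rewrite pole_deriv_tscale // => j jn; by rewrite gt_eqF // ?xa ?aa.
rewrite (chvar_tscale c0) //; apply: eq_integral => w _.
rewrite /k -muleA -EFinM; congr (_ * (_%:E))%E.
rewrite /pole_density; case/andP: xI => -> -> /=; case: ifP => pw; last by rewrite mulr0.
rewrite mulr1 ger0_norm //; apply: pole_deriv_ge0 => // j jn; exact/ltW/aa.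
Qed.

(* By induction on the number of poles: for a fixed first point [x_0] the other
   residues are rescaled by constants, and for fixed rescaled residues the first
   one is an increasing function of [x_0]. *)
Lemma chvar_wmap n a : increasing_upto n a ->
  chvar (lebesgue_tuple n) (lebesgue_tuple n) (wmap a)
    (interlaced_density n a) pos_density.
Proof.
elim: n a => [|n ih] a ha f mf f0.
  apply: eq_integral => t _.
  by rewrite /interlaced_density /interlaced /vandermonde_ratio /pos_density !big_ord0 (tuple0 t).
have ha' := increasing_uptoS ha.
rewrite tonelli_cons; last 2 first.
- apply: emeasurable_funM; first exact: (measurableT_comp mf (measurable_wmap a)).
  by apply/measurable_EFinP; exact: measurable_interlaced_density.
- by move=> t; rewrite mule_ge0 // lee_fin interlaced_density_ge0.
rewrite tonelli_cons_swap; last 2 first.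
- apply: emeasurable_funM => //.
  by apply/measurable_EFinP; exact: measurable_pos_density.
- by move=> t; rewrite mule_ge0 // lee_fin pos_density_ge0.
set a' := fun j => a j.+1 in ha' *.
pose F (z : measurableTypeR R * tup n) :=
  (f (tuple_cons (((z.1 - a 0%N) * pole_sum n a' z.2 z.1)%R, z.2)) *
   (pole_density n a' (a 0%N) z.1 z.2)%:E)%E.
have mF : measurable_fun setT F.
  apply: emeasurable_funM.
    apply: (measurableT_comp mf).
    apply: (measurableT_comp (@measurable_tuple_cons R n)).
    apply/measurable_fun_pairP; split => /=; last exact: measurable_snd.
    apply: measurable_funM; first exact: measurable_funB.
    exact: measurable_pole_sum.
  apply/measurable_EFinP; apply: measurable_fun_ifT => //.
    apply: measurable_and; first exact: measurable_fun_ltr.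
    apply: measurable_and; last exact: (measurableT_comp (@measurable_allpos R n)).
    by case: (0 < n)%N => /=; [exact: measurable_fun_ltr|exact: measurable_cst].
  exact: measurable_pole_deriv.
have F0 z : (0 <= F z)%E.
  rewrite mule_ge0 // lee_fin /pole_density; case: ifP => // /and3P[_ _ pw].
  by apply: pole_deriv_ge0 => // j jn; apply/ltW/ha.
transitivity (\int[lambda]_x \int[lebesgue_tuple n]_w F (x, w))%E.
  by apply: eq_integral => x _; rewrite (section_chvar x ha (ih _ ha') mf f0).
rewrite (fubini_tonelli F mF F0); apply: eq_integral => w _.
have [pw|pw] := boolP (allpos w); last first.
  rewrite !integral0_eq // => x _.
    by rewrite /pos_density allpos_cons (negbTE pw) andbF mule0.
  by rewrite /F /pole_density /= (negbTE pw) !andbF mule0.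
have a0_lt : (0 < n)%N -> a 0%N < a' 0%N by move=> n0; exact: ha.
have a_ge j : (j < n)%N -> a' 0%N <= a' j by exact: increasing_upto_le.
have mfw : measurable_fun setT (fun u => f (tuple_cons (u, w))).
  apply: (measurableT_comp mf).
  by apply: (measurableT_comp (@measurable_tuple_cons R n)); exact: measurable_pair2.
have := chvar_pole a0_lt a_ge pw mfw (fun u => f0 _) => e.
apply: (etrans _ (etrans e _)) => {e}; apply: eq_integral => x _.
  by rewrite /F /pole_density /= pw andbT.
by rewrite /pos_density allpos_cons pw andbT.
Qed.

End dixon_anderson_chvar.

(** * The outer and the inner Dixon-Anderson integral *)

Section dixon_anderson_integrals.
Context {R : realType}.
Notation tup n := (n.-tuple (measurableTypeR R)).
Implicit Types (a : nat -> R) (s : nat -> R[i]).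

Definition cross_prod n m a s (x : seq R) : R[i] :=
  \prod_(j < n) \prod_(i < m) cpowR `|x`_i - a j| (s j - 1).

Definition pole_prod n a s : R[i] :=
  \prod_(j < n) \prod_(i < j) cpowR (a j - a i) (s i + s j - 1).

Definition vdm n (x : seq R) : R := \prod_(j < n) \prod_(i < j) (x`_j - x`_i).

Lemma cpowR_prod_ord n (F : nat -> R) z : (forall j, (j < n)%N -> 0 < F j) ->
  cpowR (\prod_(j < n) F j) z = \prod_(j < n) cpowR (F j) z.
Proof. by move=> F0; rewrite cpowR_prod // => j _; exact: F0. Qed.

Lemma vandermonde_ratioE n a (x : seq R) : increasing_upto n a ->
  (vandermonde_ratio n a x)%:C * (\prod_(j < n) \prod_(i < j) cpowR (a j - a i) 1) = (vdm n x)%:C.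
Proof.
move=> ha; rewrite /vandermonde_ratio /vdm !rmorph_prod -big_split /=.
apply: eq_bigr => j _; rewrite !rmorph_prod -big_split /=; apply: eq_bigr => i _.
have aij : 0 < a j - a i by rewrite subr_gt0 ha.
by rewrite cpowR1 // -(rmorphM (real_complex R)) divfK // gt_eqF.
Qed.

(* The residues [w_j = prod_i |x_i - a_j| / prod_(k <> j) |a_k - a_j|], in the
   form in which they enter the integrals. *)
Lemma weight_prod n a s (x : tup n) : increasing_upto n a -> interlaced n a x ->
  (\prod_(j < n) cpowR (wmap a x)`_j (s j - 1)) *
    (\prod_(j < n) \prod_(i < j) cpowR (a j - a i) (s i + s j - (1 + 1))) =
  cross_prod n n a s x.
Proof.
elim: n a s x => [|n ih] a s x ha; first by rewrite /cross_prod !big_ord0 mul1r.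
case/tupleP: x => x0 x; change (Real.sort R) in x0.
have -> : [tuple of x0 :: x] = tuple_cons (x0, x) by [].
rewrite interlaced_cons => /andP[/andP[a0 a1] hx].
have ha' := increasing_uptoS ha.
have xa j : (j < n)%N -> x0 < a j.+1.
  move=> jn; have n0 := leq_ltn_trans (leq0n j) jn.
  exact: lt_le_trans (implyP a1 n0) (increasing_upto_le ha' (leq0n j) jn).
have aa j : (j < n)%N -> a 0%N < a j.+1 by move=> jn; exact: ha.
have ax j : (j < n)%N -> a 0%N < x`_j.
  move=> jn; exact: lt_trans (aa _ jn) (interlaced_gt ha' hx (leqnn j) jn).
have {}ih := ih _ (fun j => s j.+1) x ha' hx.
have pw := allpos_wmap ha' hx.
rewrite wmap_cons.
have ps : pole_sum n (fun j => a j.+1) (wmap (fun j => a j.+1) x) (a 0%N) =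
    \prod_(j < n) ((x`_j - a 0%N) / (a j.+1 - a 0%N)).
  by apply: pole_sum_wmap => // j jn; rewrite gt_eqF // aa.
rewrite ps.
move: (wmap _ x) ih pw {ps} => w ih pw.
have wj j : (j < n)%N -> 0 < w`_j.
  by move=> jn; move/(all_nthP 0): pw; apply; rewrite size_tuple.
have tE := @nth_tscale R n (fun j => (a j.+1 - x0) / (a j.+1 - a 0%N)) w.
move: (tscale _ w) tE => tw tE.
rewrite (big_ordS _ _ _ (fun j =>
  cpowR (((x0 - a 0%N) * \prod_(j < n) ((x`_j - a 0%N) / (a j.+1 - a 0%N))) :: tw)`_j (s j - 1))).
rewrite [X in _ * X](big_ordS _ _ _ (fun j => \prod_(i < j) cpowR (a j - a i) (s i + s j - (1 + 1)))).
rewrite big_ord0 mul1r.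
have e1 : \prod_(j < n) \prod_(i < j.+1) cpowR (a j.+1 - a i) (s i + s j.+1 - (1 + 1)) =
    (\prod_(j < n) (cpowR (a j.+1 - a 0%N) (s 0%N - 1) * cpowR (a j.+1 - a 0%N) (s j.+1 - 1))) *
    \prod_(j < n) \prod_(i < j) cpowR (a j.+1 - a i.+1) (s i.+1 + s j.+1 - (1 + 1)).
  rewrite -big_split /=; apply: eq_bigr => j _.
  rewrite (big_ordS _ _ _ (fun i => cpowR (a j.+1 - a i) (s i + s j.+1 - (1 + 1)))).
  rewrite -(cpowRD (a j.+1 - a 0%N)); congr (cpowR _ _ * _); ring.
rewrite e1.
rewrite [(_ :: _)`_0]/= [in LHS](eq_bigr (fun j : 'I_n => cpowR w`_j (s j.+1 - 1) *
   (cpowR (a j.+1 - x0) (s j.+1 - 1) * cpowR (a j.+1 - a 0%N) (- (s j.+1 - 1))))); last first.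
  move=> j _; rewrite [X in cpowR X _ = _](tE j (ltn_ord j)).
  have aj0 : 0 < a j.+1 - a 0%N by rewrite subr_gt0 aa.
  have xj0 : 0 < a j.+1 - x0 by rewrite subr_gt0 xa.
  rewrite (@cpowRM _ ((a j.+1 - x0) / (a j.+1 - a 0%N)) w`_j _ (divr_gt0 xj0 aj0) (wj _ (ltn_ord j))).
  have aj0' : 0 < (a j.+1 - a 0%N)^-1 by rewrite invr_gt0.
  rewrite (@cpowRM _ (a j.+1 - x0) _ _ xj0 aj0').
  rewrite (cpowRV _ aj0).
  by rewrite mulrC.
rewrite (@cpowRM _ (x0 - a 0%N)) ?subr_gt0 //; last by apply: prodr_gt0 => j _; rewrite divr_gt0 ?subr_gt0 ?ax ?aa.
rewrite (cpowR_prod_ord (F := fun j => (x`_j - a 0%N) / (a j.+1 - a 0%N))); last first.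
  by move=> j jn; rewrite divr_gt0 // subr_gt0 ?ax ?aa.
rewrite [\prod_(j < n) cpowR ((x`_j - a 0%N) / _) _](eq_bigr (fun j : 'I_n =>
   cpowR (x`_j - a 0%N) (s 0%N - 1) *
   cpowR (a j.+1 - a 0%N) (- (s 0%N - 1)))); last first.
  move=> j _; have aj0 : 0 < a j.+1 - a 0%N by rewrite subr_gt0 aa.
  have aj0' : 0 < (a j.+1 - a 0%N)^-1 by rewrite invr_gt0.
  have xj0 : 0 < x`_j - a 0%N by rewrite subr_gt0 ax.
  rewrite (@cpowRM _ (x`_j - a 0%N) _ _ xj0 aj0').
  by rewrite (cpowRV _ aj0).
have e2 : cross_prod n.+1 n.+1 a s (x0 :: x) =
    cpowR (x0 - a 0%N) (s 0%N - 1) * (\prod_(j < n) cpowR (x`_j - a 0%N) (s 0%N - 1)) *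
    ((\prod_(j < n) cpowR (a j.+1 - x0) (s j.+1 - 1)) *
     cross_prod n n (fun j => a j.+1) (fun j => s j.+1) x).
  rewrite /cross_prod (big_ordS _ _ _ (fun j => \prod_(i < n.+1) cpowR `|(x0 :: x)`_i - a j| (s j - 1))).
  congr (_ * _).
    rewrite (big_ordS _ _ _ (fun i => cpowR `|(x0 :: x)`_i - a 0%N| (s 0%N - 1))) /=.
    rewrite ger0_norm ?subr_ge0 ?ltW //; congr (_ * _); apply: eq_bigr => j _.
    by rewrite ger0_norm // subr_ge0 ltW // ax.
  rewrite -big_split /=; apply: eq_bigr => j _.
  rewrite (big_ordS _ _ _ (fun i => cpowR `|(x0 :: x)`_i - a j.+1| (s j.+1 - 1))) /=.
  by rewrite ltr0_norm ?opprB // subr_lt0 xa.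
(* The powers of [a_(j+1) - a_0] coming from the pairs with index 0 cancel those brought in by the
   first residue ([e3]) and by the rescaling of the others ([e4]). *)
have e3 : (\prod_(j < n) cpowR (a j.+1 - a 0%N) (s 0%N - 1)) *
    (\prod_(j < n) cpowR (a j.+1 - a 0%N) (- (s 0%N - 1))) = 1.
  by rewrite -big_split big1 // => j _ /=; rewrite -(cpowRD (a j.+1 - a 0%N)) addrN cpowR0.
have e4 : (\prod_(j < n) cpowR (a j.+1 - a 0%N) (s j.+1 - 1)) *
    (\prod_(j < n) cpowR (a j.+1 - a 0%N) (- (s j.+1 - 1))) = 1.
  by rewrite -big_split big1 // => j _ /=; rewrite -(cpowRD (a j.+1 - a 0%N)) addrN cpowR0.
rewrite e2 -ih; move: e3 e4.
move: (@cpowR R) => F; rewrite !big_split /=.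
set A := \prod_(j < n) F (a j.+1 - a 0%N) (s 0%N - 1).
set B := \prod_(j < n) F (a j.+1 - a 0%N) (- (s 0%N - 1)).
set C := \prod_(j < n) F (a j.+1 - a 0%N) (s j.+1 - 1).
set D := \prod_(j < n) F (a j.+1 - a 0%N) (- (s j.+1 - 1)).
move=> e3 e4.
set P1 := F (x0 - _) _; set P2 := \prod_(i < n) F (x`_i - _) _.
set P3 := \prod_(i < n) F w`_i _; set P4 := \prod_(i < n) F (_ - x0) _.
set P5 := \prod_(j < n) \prod_(i < j) _.
transitivity ((A * B) * (C * D) * (P1 * P2 * (P4 * (P3 * P5)))).
  by clear e3 e4; move: A B C D P1 P2 P3 P4 P5 => *; ring.
by rewrite e3 e4 !mul1r.
Qed.

(** The Jacobian raises each exponent [s_i + s_j - 2] of the pole differences by 1 and brings in the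
    Vandermonde product of [x]. *)
Lemma weight_prod_density n a s (x : tup n) : increasing_upto n a -> interlaced n a x ->
  (\prod_(j < n) cpowR (wmap a x)`_j (s j - 1)) * (vandermonde_ratio n a x)%:C *
    pole_prod n a s = cross_prod n n a s x * (vdm n x)%:C.
Proof.
move=> ha hx; rewrite -(weight_prod s ha hx) -(vandermonde_ratioE x ha).
have -> : pole_prod n a s =
    (\prod_(j < n) \prod_(i < j) cpowR (a j - a i) (s i + s j - (1 + 1))) *
    (\prod_(j < n) \prod_(i < j) cpowR (a j - a i) 1).
  rewrite -big_split /=; apply: eq_bigr => j _.
  rewrite -big_split /=; apply: eq_bigr => i _.
  rewrite -(cpowRD (a j - a i)); congr (cpowR _ _); ring.
move: (\prod_(j < n) cpowR _ _) (\prod_(j < n) \prod_(i < j) _)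
  (\prod_(j < n) \prod_(i < j) _) => A B C.
by move: (_%:C) => V; ring.
Qed.

(* Outer integral: the last point lies beyond the last pole and runs to infinity;
   inner integral (below): all points lie between the [n + 1] poles. *)
Definition outer_integrand n a s tau (x : seq R) : R[i] :=
  if interlaced n a x then
    cross_prod n n a s x * (\prod_(i < n) cpowR (1 + x`_i) (- tau)) * (vdm n x)%:C
  else 0.

Definition outer_value n a s tau : R[i] :=
  (\prod_(j < n) cGamma (s j)) * (cGamma (tau - \sum_(j < n) s j) / cGamma tau) *
  (\prod_(j < n) cpowR (1 + a j) (s j - tau)) * pole_prod n a s.

Lemma hasC_outer n a s tau : increasing_upto n a -> (forall j, (j < n)%N -> 0 < 1 + a j) ->
  (forall j, (j < n)%N -> 0 < complex.Re (s j)) ->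
  0 < complex.Re (tau - \sum_(j < n) s j) ->
  hasC (lebesgue_tuple n) (fun x : tup n => outer_integrand n a s tau x)
    (outer_value n a s tau).
Proof.
move=> ha a1 s0 t0.
have c0 j : (j < n)%N -> 0 < (1 + a j)^-1 by move=> jn; rewrite invr_gt0 a1.
have := hasC_dirichlet2 c0 ltr01 s0 t0.
pose h (t : tup n) := (\prod_(j < n) cpowR t`_j (s j - 1)) *
  cpowR (1 + \sum_(j < n) (1 + a j)^-1 * t`_j) (- tau).
have mh : cmeasurable h.
  apply: cmeasurableM; first exact: cmeasurable_dirichlet.
  apply: (cmeasurable_cpowR (f := fun t : tup n => 1 + \sum_(j < n) (1 + a j)^-1 * t`_j)).
  apply: measurable_funD => //.
  exact: (measurable_sum_nth _ (fun j => (1 + a j)^-1)).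
rewrite (_ : (fun t => _) = (fun t => h t * (pos_density t)%:C)); last first.
  by apply/funext => t; rewrite /pos_density; case: ifP; rewrite ?mulr1 ?mulr0.
move/(hasC_chvar _ (chvar_wmap ha) (measurable_wmap a) (measurable_interlaced_density a)
  (@measurable_pos_density R n) (fun x => interlaced_density_ge0 x ha) (@pos_density_ge0 R) mh).
(* These constants clear the denominators: [pole_prod] those of the residues and of the Jacobian,
   the product those of [(1 + x_j) / (1 + a_j)]. *)
move/(hasCZ (pole_prod n a s * \prod_(j < n) cpowR (1 + a j) (- tau))).
congr hasC.
  apply/funext => x; rewrite /outer_integrand /interlaced_density.
  case: ifP => hx; last by rewrite !mulr0.
  have e : 1 + \sum_(j < n) (1 + a j)^-1 * (wmap a x)`_j =
      \prod_(j < n) ((1 + x`_j) / (1 + a j)).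
    transitivity (pole_sum n a (wmap a x) (- 1)).
      by congr (_ + _); apply: eq_bigr => j _; rewrite mulrC opprK [1 + _]addrC.
    rewrite pole_sum_wmap //; last first.
      by move=> j jn; rewrite -subr_eq0 opprK addrC gt_eqF // a1.
    by apply: eq_bigr => j _; rewrite !opprK ![1 + _]addrC.
  have x1 j : (j < n)%N -> 0 < 1 + x`_j.
    move=> jn; apply: lt_trans (a1 _ jn) _; rewrite ltrD2l.
    exact: (interlaced_gt ha hx (leqnn j) jn).
  rewrite /h e (cpowR_prod_ord (F := fun j => (1 + x`_j) / (1 + a j))); last first.
    by move=> j jn; rewrite divr_gt0 ?a1 ?x1.
  rewrite [\prod_(j < n) cpowR ((1 + x`_j) / _) _](eq_bigr (fun j : 'I_n => cpowR (1 + x`_j) (- tau) * cpowR (1 + a j) tau)); last first.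
    move=> j _; have aj := c0 j (ltn_ord j); have xj := x1 j (ltn_ord j).
    rewrite (@cpowRM _ (1 + x`_j) _ _ xj aj) (cpowRV _ (a1 _ (ltn_ord j))); congr (_ * cpowR _ _).
    by rewrite opprK.
  rewrite [\prod_(j < n) (cpowR (1 + x`_j) _ * _)](big_split _ _ _
    (fun j : 'I_n => cpowR (1 + x`_j) (- tau)) (fun j : 'I_n => cpowR (1 + a j) tau)) /=.
  rewrite [cross_prod _ _ _ _ _ * _ * _]mulrAC -(weight_prod_density s ha hx).
  have e1 : (\prod_(j < n) cpowR (1 + a j) (- tau)) * (\prod_(j < n) cpowR (1 + a j) tau) = 1.
    by rewrite -big_split big1 // => j _ /=; rewrite -(cpowRD (1 + a j)) addNr cpowR0.
  move: e1.
  set A := \prod_(j < n) cpowR (1 + a j) (- tau).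
  set B := \prod_(j < n) cpowR (1 + a j) tau.
  move: (pole_prod n a s) (vandermonde_ratio n a x)%:C => E D e1.
  set C := \prod_(j < n) cpowR (wmap a x)`_j _; set F := \prod_(j < n) cpowR (1 + x`_j) _.
  transitivity ((A * B) * (C * D * E * F)); last by rewrite e1 mul1r.
  by clear e1; move: A B C D E F => *; ring.
rewrite /outer_value cpow1R mul1r.
rewrite [\prod_(j < n) (cpowR (1 + a j)^-1 _ * _)](eq_bigr (fun j : 'I_n => cpowR (1 + a j) (s j) * cGamma (s j))); last first.
  by move=> j _; rewrite (cpowRV _ (a1 _ (ltn_ord j))) opprK.
rewrite (big_split _ _ _ (fun j : 'I_n => cpowR (1 + a j) (s j)) (fun j : 'I_n => cGamma (s j))) /=.
rewrite [X in _ = _ * X * _](eq_bigr (fun j : 'I_n => cpowR (1 + a j) (- tau) * cpowR (1 + a j) (s j))); last first.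
  by move=> j _; rewrite -(cpowRD (1 + a j)) [- tau + _]addrC.
rewrite (big_split _ _ _ (fun j : 'I_n => cpowR (1 + a j) (- tau)) (fun j : 'I_n => cpowR (1 + a j) (s j))) /=.
move: (pole_prod n a s) (cGamma (tau - \sum_(j < n) s j) / cGamma tau) => A E.
move: (\prod_(j < n) cGamma (s j)) (\prod_(j < n) cpowR (1 + a j) (s j))
  (\prod_(j < n) cpowR (1 + a j) (- tau)) => B C D.
by ring.
Qed.

End dixon_anderson_integrals.

Section inner_dixon_anderson.
Context {R : realType}.
Notation tup n := (n.-tuple (measurableTypeR R)).
Implicit Types (a : nat -> R) (s : nat -> R[i]).

Definition interlaced_upper n a (x : seq R) : bool :=
  interlaced n a x && ((0 < n)%N ==> (x`_n.-1 < a n)).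

Definition inner_integrand n a s (x : seq R) : R[i] :=
  if interlaced_upper n a x then cross_prod n.+1 n a s x * (vdm n x)%:C else 0.

Definition inner_value n a s : R[i] :=
  (\prod_(j < n.+1) cGamma (s j)) / cGamma (\sum_(j < n.+1) s j) * pole_prod n.+1 a s.

Lemma increasing_uptoW n a : increasing_upto n.+1 a -> increasing_upto n a.
Proof. by move=> ha i j ij jn; apply: ha => //; exact: ltnW. Qed.

(** The last of the [n + 1] poles is no pole of the map [wmap a] but an evaluation point. Evaluating
    there yields both the linear form that bounds the simplex and the factor of exponent
    [s n - 1]. *)
Lemma sum_wmap_last n a (x : tup n) : increasing_upto n.+1 a ->
  1 - \sum_(j < n) (a n - a j)^-1 * (wmap a x)`_j =
  \prod_(j < n) ((a n - x`_j) / (a n - a j)).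
Proof.
move=> ha; transitivity (pole_sum n a (wmap a x) (a n)).
  rewrite /pole_sum -sumrN; congr (_ + _); apply: eq_bigr => j _.
  by rewrite mulrC -mulrN -invrN opprB.
rewrite pole_sum_wmap //; last 2 first.
- exact: increasing_uptoW.
- by move=> j jn; rewrite lt_eqF // ha.
by apply: eq_bigr => j _; rewrite -(opprB (a n) (a j)) invrN mulrN -mulNr opprB.
Qed.

(** In the product for [1 - sum], interlacing makes all factors but the last positive, so its sign
    is that of [a_n] minus the last point. *)
Lemma sum_wmap_lt1 n a (x : tup n) : increasing_upto n.+1 a -> interlaced n a x ->
  (\sum_(j < n) (a n - a j)^-1 * (wmap a x)`_j < 1) = ((0 < n)%N ==> (x`_n.-1 < a n)).
Proof.
move=> ha hx; rewrite -subr_gt0 sum_wmap_last //.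
case: n a x ha hx => [|n] a x ha hx /=; first by rewrite big_ord0 ltr01.
rewrite big_ord_recr /= pmulr_rgt0; last first.
  apply: prodr_gt0 => j _; rewrite divr_gt0 // subr_gt0.
    apply: lt_trans (interlaced_lt (increasing_uptoW ha) hx (_ : (j < n)%N) (ltnSn n)) _ => //.
    exact: ha.
  by apply: ha => //; rewrite ltnS ltnW.
by rewrite pmulr_lgt0 ?invr_gt0 ?subr_gt0 // ha.
Qed.

Lemma hasC_inner n a s : increasing_upto n.+1 a ->
  (forall j, (j < n.+1)%N -> 0 < complex.Re (s j)) ->
  hasC (lebesgue_tuple n) (fun x : tup n => inner_integrand n a s x) (inner_value n a s).
Proof.
move=> ha s0; have ha' := increasing_uptoW ha.
have c0 j : (j < n)%N -> 0 < (a n - a j)^-1 by move=> jn; rewrite invr_gt0 subr_gt0 ha.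
have s0' j : (j < n)%N -> 0 < complex.Re (s j) by move=> jn; rewrite s0 // ltnW.
have := hasC_dirichlet1 c0 ltr01 s0' (s0 n (ltnSn n)).
pose S (t : tup n) := \sum_(j < n) (a n - a j)^-1 * t`_j.
have mS : measurable_fun setT S by exact: (measurable_sum_nth _ (fun j => (a n - a j)^-1)).
pose h (t : tup n) : R[i] := if S t < 1 then (\prod_(j < n) cpowR t`_j (s j - 1)) *
  cpowR (1 - S t) (s n - 1) else 0.
have mh : cmeasurable h.
  apply: cmeasurable_if; first exact: measurable_fun_ltr.
    apply: cmeasurableM; first exact: cmeasurable_dirichlet.
    apply: (cmeasurable_cpowR (f := fun t : tup n => 1 - S t)).
    exact: measurable_funB.
  exact: cmeasurable_cst.
rewrite (_ : (fun t => _) = (fun t => h t * (pos_density t)%:C)); last first.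
  apply/funext => t; rewrite /h /S /pos_density.
  by case: (allpos t); rewrite ?mulr1 ?mulr0.
move/(hasC_chvar _ (chvar_wmap ha') (measurable_wmap a) (measurable_interlaced_density a)
  (@measurable_pos_density R n) (fun x => interlaced_density_ge0 x ha') (@pos_density_ge0 R) mh).
move/(hasCZ (pole_prod n a s * \prod_(j < n) cpowR (a n - a j) (s n - 1))).
congr hasC.
  apply/funext => x; rewrite /inner_integrand /interlaced_upper /interlaced_density.
  case: (boolP (interlaced n a x)) => hx; last by rewrite !mulr0.
  rewrite /h {1}/S (sum_wmap_lt1 ha hx) andTb; case: ifP => xn; last by rewrite mul0r mulr0.
  have an j : (j < n)%N -> 0 < a n - a j by move=> jn; rewrite subr_gt0 ha.
  have xa j : (j < n)%N -> 0 < a n - x`_j.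
    move=> jn; have n0 := leq_ltn_trans (leq0n j) jn; rewrite subr_gt0.
    apply: le_lt_trans (implyP xn n0).
    have [->//|jn'] := eqVneq j n.-1.
    by apply/ltW/(interlaced_mono ha' hx); lia.
  rewrite /S (sum_wmap_last x ha).
  rewrite (cpowR_prod_ord (F := fun j => (a n - x`_j) / (a n - a j))); last first.
    by move=> j jn; rewrite divr_gt0 ?an ?xa.
  rewrite [\prod_(j < n) cpowR ((a n - x`_j) / _) _](eq_bigr (fun j : 'I_n =>
    cpowR (a n - x`_j) (s n - 1) * cpowR (a n - a j) (- (s n - 1)))); last first.
    move=> j _; have aj := c0 j (ltn_ord j); have xj := xa j (ltn_ord j).
    by rewrite (@cpowRM _ (a n - x`_j) _ _ xj aj) (cpowRV _ (an _ (ltn_ord j))).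
  rewrite [\prod_(j < n) (cpowR (a n - x`_j) _ * _)](big_split _ _ _
    (fun j : 'I_n => cpowR (a n - x`_j) (s n - 1))
    (fun j : 'I_n => cpowR (a n - a j) (- (s n - 1)))) /=.
  have -> : cross_prod n.+1 n a s x =
      cross_prod n n a s x * (\prod_(j < n) cpowR (a n - x`_j) (s n - 1)).
    rewrite {1}/cross_prod big_ord_recr /=; congr (_ * _).
    by apply: eq_bigr => i _; rewrite ltr0_norm ?opprB // -oppr_gt0 opprB xa.
  rewrite [cross_prod _ _ _ _ _ * _ * _]mulrAC -(weight_prod_density s ha' hx).
  have e1 : (\prod_(j < n) cpowR (a n - a j) (s n - 1)) *
      (\prod_(j < n) cpowR (a n - a j) (- (s n - 1))) = 1.
    by rewrite -big_split big1 // => j _ /=; rewrite -(cpowRD (a n - a j)) addrN cpowR0.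
  move: e1.
  move: (pole_prod n a s) (vandermonde_ratio n a x)%:C
    (\prod_(j < n) cpowR (a n - a j) (s n - 1))
    (\prod_(j < n) cpowR (a n - a j) (- (s n - 1)))
    (\prod_(j < n) cpowR (wmap a x)`_j (s j - 1))
    (\prod_(j < n) cpowR (a n - x`_j) (s n - 1)) => E D A B C F e1.
  transitivity ((A * B) * (C * D * E * F)); last by rewrite e1 mul1r.
  by clear e1; ring.
rewrite /inner_value cpow1R mul1r.
have an j : (j < n)%N -> 0 < a n - a j by move=> jn; rewrite subr_gt0 ha.
rewrite [\prod_(j < n) (cpowR (a n - a j)^-1 _ * _)](eq_bigr (fun j : 'I_n =>
  cpowR (a n - a j) (s j) * cGamma (s j))); last first.
  by move=> j _; rewrite (cpowRV _ (an _ (ltn_ord j))) opprK.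
rewrite (big_split _ _ _ (fun j : 'I_n => cpowR (a n - a j) (s j)) (fun j : 'I_n => cGamma (s j))) /=.
have -> : pole_prod n.+1 a s = pole_prod n a s *
    ((\prod_(j < n) cpowR (a n - a j) (s n - 1)) * (\prod_(j < n) cpowR (a n - a j) (s j))).
  rewrite {1}/pole_prod big_ord_recr /=; congr (_ * _).
  rewrite -big_split /=; apply: eq_bigr => j _.
  by rewrite -(cpowRD (a n - a j)); congr cpowR; ring.
rewrite [\prod_(j < n.+1) _]big_ord_recr [in RHS]big_ord_recr /=.
move: (pole_prod n a s) (cGamma (\sum_(j < n) s j + s n)) (cGamma (s n)) => A E F.
move: (\prod_(j < n) cGamma (s j)) (\prod_(j < n) cpowR (a n - a j) (s j))
  (\prod_(j < n) cpowR (a n - a j) (s n - 1)) => B C D.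
by ring.
Qed.

End inner_dixon_anderson.

(** * Adding one row: the integral over a new last row *)

Section integrand_families.
Context {R : realType}.
Implicit Types (a : nat -> R) (s : nat -> R[i]) (x : seq R).

Lemma interlaced_increasing n a x : interlaced n a x -> increasing_upto n a.
Proof.
move/interlacedP => h i j; elim: j => // j ih; rewrite ltnS leq_eqVlt => /predU1P[->|ij] jn.
  by have [h1 h2] := h j (ltnW jn); exact: lt_trans h1 (h2 jn).
apply: lt_trans (ih ij (ltnW jn)) _.
by have [h1 h2] := h j (ltnW jn); exact: lt_trans h1 (h2 jn).
Qed.

Lemma vdm_gt0 n x : increasing_upto n (nth 0 x) -> 0 < vdm n x.
Proof.
move=> hx; apply: prodr_gt0 => j _; apply: prodr_gt0 => i _; rewrite subr_gt0.
exact: hx.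
Qed.

Lemma interlaced_vdm_gt0 n a x : interlaced n a x -> 0 < vdm n x.
Proof.
move=> hx; apply: vdm_gt0 => i j ij jn.
exact: (interlaced_mono (interlaced_increasing hx) hx).
Qed.

Definition real_part (z : R[i]) : R[i] := (complex.Re z)%:C.

Lemma real_partD z w : real_part (z + w) = real_part z + real_part w.
Proof. by rewrite /real_part ReD rmorphD. Qed.

Lemma real_partN z : real_part (- z) = - real_part z.
Proof. by rewrite /real_part ReN rmorphN. Qed.

Lemma real_part1 : real_part 1 = 1.
Proof. by []. Qed.

Lemma ReMn (z : R[i]) n : complex.Re (z *+ n) = complex.Re z *+ n.
Proof. by elim: n => [|n ih]; rewrite ?mulr0n // !mulrS ReD ih. Qed.

Lemma real_partMn (z : R[i]) n : real_part (z *+ n) = real_part z *+ n.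
Proof. by rewrite /real_part ReMn rmorphMn. Qed.

Lemma normcM_complex (z w : R[i]) : (normc (z * w))%:C = (normc z)%:C * (normc w)%:C.
Proof. by rewrite normcM; exact: (rmorphM (real_complex R)). Qed.

Lemma normC_cross_prod n m a s x :
  (normc (cross_prod n m a s x))%:C = cross_prod n m a (fun j => real_part (s j)) x.
Proof.
rewrite /cross_prod normC_prod; apply: eq_bigr => j _.
rewrite normC_prod; apply: eq_bigr => i _.
by rewrite normc_cpowRE -/(real_part _) real_partD real_partN real_part1.
Qed.

Lemma normC_outer_integrand n a s tau x :
  (normc (outer_integrand n a s tau x))%:C =
  outer_integrand n a (fun j => real_part (s j)) (real_part tau) x.
Proof.
rewrite /outer_integrand; case: ifP => hx; last by rewrite normc_real.
rewrite !normcM_complex normC_cross_prod.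
rewrite normc_real ?(ltW (interlaced_vdm_gt0 hx)) //; congr (_ * _ * _).
rewrite normC_prod; apply: eq_bigr => i _.
by rewrite normc_cpowRE -/(real_part _) real_partN.
Qed.

Lemma real_part_sum n (F : nat -> R[i]) :
  \sum_(i < n) real_part (F i) = real_part (\sum_(i < n) F i).
Proof.
elim: n => [|n ih]; first by rewrite !big_ord0.
by rewrite !big_ord_recr /= ih real_partD.
Qed.

Section measurability.
Context d (T : measurableType d).
Variables (a : T -> nat -> R) (x : T -> seq R).
Hypothesis ma : forall i, measurable_fun setT (fun z => a z i).
Hypothesis mx : forall i, measurable_fun setT (fun z => (x z)`_i).

Lemma cmeasurable_vdm n : cmeasurable (fun z => (vdm n (x z))%:C).
Proof.
apply: cmeasurable_real; apply: measurable_prod => j _; apply: measurable_prod => i _.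
exact: measurable_funB.
Qed.

Lemma cmeasurable_cross_prod n m s : cmeasurable (fun z => cross_prod n m (a z) s (x z)).
Proof.
apply: cmeasurable_prod => j; apply: cmeasurable_prod => i.
apply: (cmeasurable_cpowR (f := fun z => `|(x z)`_i - a z j|)).
by apply: measurableT_comp => //; exact: measurable_funB.
Qed.

Lemma cmeasurable_outer_integrand n s tau :
  cmeasurable (fun z => outer_integrand n (a z) s tau (x z)).
Proof.
apply: cmeasurable_if; [exact: measurable_interlaced_fun| |exact: cmeasurable_cst].
apply: cmeasurableM; last exact: cmeasurable_vdm.
apply: cmeasurableM; first exact: cmeasurable_cross_prod.
apply: cmeasurable_prod => i; apply: (cmeasurable_cpowR (f := fun z => 1 + (x z)`_i)).
exact: measurable_funD.
Qed.

End measurability.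

End integrand_families.

Section row_integral.
Context {R : realType}.
Notation tup n := (n.-tuple (measurableTypeR R)).
Implicit Types (s : nat -> R[i]) (x y : seq R).

(** Prepending 0 merges positivity of the first entry with the increase of the others. *)
Definition pos_increasing n x : bool := \big[andb/true]_(i < n) ((0 :: x)`_i < x`_i).

Lemma pos_increasingP n x :
  reflect (forall i, (i < n)%N -> (0 :: x)`_i < x`_i) (pos_increasing n x).
Proof.
rewrite /pos_increasing big_andE; apply: (iffP forallP) => [h i ni|h i].
  exact: h (Ordinal ni).
exact: h (ltn_ord i).
Qed.

Lemma measurable_pos_increasing d (T : measurableType d) n (x : T -> seq R) :
  (forall i, measurable_fun setT (fun z => (x z)`_i)) ->
  measurable_fun setT (fun z => pos_increasing n (x z)).
Proof.
move=> mx; apply: (@measurable_big_and _ _ n (fun i z => (0 :: x z)`_i < (x z)`_i)) => i.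
by apply: measurable_fun_ltr => //; case: i => [|i] /=; [exact: measurable_cst|exact: mx].
Qed.

Lemma pos_increasing_cons n y : pos_increasing n y -> increasing_upto n.+1 (nth 0 (0 :: y)).
Proof.
move/pos_increasingP => h i j; elim: j => // j ih; rewrite ltnS leq_eqVlt => /predU1P[->|ij] jn.
  exact: h.
exact: lt_trans (ih ij (ltnW jn)) (h _ jn).
Qed.

Lemma pos_increasing_upto n y : pos_increasing n y -> increasing_upto n (nth 0 y).
Proof. by move=> h i j ij jn; exact: (pos_increasing_cons h (_ : (i.+1 < j.+1)%N)). Qed.

Lemma pos_increasing_gt0 n y i : pos_increasing n y -> (i < n)%N -> 0 < y`_i.
Proof. by move=> h ni; exact: (pos_increasing_cons h (_ : (0 < i.+1)%N)). Qed.

Lemma interlaced_pos_increasing n x y :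
  interlaced n.+1 (nth 0 (0 :: y)) x -> pos_increasing n y.
Proof.
move=> /interlaced_increasing h; apply/pos_increasingP => i ni.
exact: (h i i.+1).
Qed.

(** Interlacing read from either side: [x] outside the poles [0, y], or [y] inside the poles [x]. A
    kernel on pairs of rows is therefore an outer integrand in one variable and an inner one in the
    other. *)
Lemma interlaced_row n x y : interlaced n.+1 (nth 0 (0 :: y)) x =
  pos_increasing n.+1 x && interlaced_upper n (nth 0 x) y.
Proof.
apply/idP/andP => [/interlacedP h|[/pos_increasingP h1 /andP[/interlacedP h2 h3]]].
  split.
    apply/pos_increasingP => -[|i] ni; first by have [] := h 0%N ni.
    have [_ /(_ ni) h1] := h i (ltnW ni); have [h2 _] := h i.+1 ni.
    exact: lt_trans h1 h2.
  apply/andP; split.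
    apply/interlacedP => i ni; have [_ /(_ ni)] := h i (ltnW ni); split=> // ni'.
    by have [] := h i.+1 ni.
  apply/implyP; case: n h => // n h _.
  by have [] := h n.+1 (ltnSn _).
apply/interlacedP => i ni; split; last by move=> ni'; have [] := h2 i ni'.
case: i ni => [|i] ni; first exact: (h1 0%N ni).
rewrite /=; case: n h3 h2 ni {h1} => // n h3 h2.
rewrite ltnS => ni.
move: (ni); rewrite leq_eqVlt => /predU1P[[->]|ni']; first exact: (implyP h3 isT).
by have [_ h] := h2 i ni; apply: h.
Qed.

Definition row_exp (s0 : R[i]) s (j : nat) : R[i] := if j is i.+1 then s i else s0.

(* The new row [x] interlaces the poles [0] and [y], the previous row. *)
Definition row_integrand n (s0 : R[i]) s (tau : R[i]) y x : R[i] :=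
  outer_integrand n.+1 (nth 0 (0 :: y)) (row_exp s0 s) tau x.

Definition selberg_weight n (sigma tau : R[i]) x : R[i] :=
  (\prod_(i < n) cpowR x`_i (sigma - 1)) * (\prod_(i < n) cpowR (1 + x`_i) (- tau)) *
  (vdm n x)%:C.

Definition cross_row n s y x : R[i] :=
  if interlaced n.+1 (nth 0 (0 :: y)) x then cross_prod n n.+1 (nth 0 y) s x else 0.

(** The pole 0 contributes the powers [x_i ^ (s0 - 1)], which join the factors depending on the row
    [x] alone. *)
Lemma row_integrandE n (s0 : R[i]) s (tau : R[i]) y x :
  row_integrand n s0 s tau y x = cross_row n s y x * selberg_weight n.+1 s0 tau x.
Proof.
rewrite /row_integrand /outer_integrand /cross_row.
case: ifP => [|_]; last by rewrite mul0r.
rewrite interlaced_row => /andP[x0 _].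
have -> : cross_prod n.+1 n.+1 (nth 0 (0 :: y)) (row_exp s0 s) x =
    (\prod_(i < n.+1) cpowR x`_i (s0 - 1)) * cross_prod n n.+1 (nth 0 y) s x.
  rewrite /cross_prod (big_ordS _ _ _ (fun j => \prod_(i < n.+1)
    cpowR `|x`_i - (0 :: y)`_j| (row_exp s0 s j - 1))) /=; congr (_ * _).
  by apply: eq_bigr => i _; rewrite subr0 ger0_norm // ltW // (pos_increasing_gt0 x0).
rewrite /selberg_weight.
move: (\prod_(i < n.+1) cpowR x`_i (s0 - 1)) (\prod_(i < n.+1) cpowR (1 + x`_i) (- tau))
  (cross_prod n n.+1 (nth 0 y) s x) (vdm n.+1 x)%:C => *.
by ring.
Qed.

Definition row_value n (s0 : R[i]) s (tau : R[i]) y : R[i] :=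
  if pos_increasing n y then
    (cGamma s0 * \prod_(j < n) cGamma (s j)) *
    (cGamma (tau - (s0 + \sum_(j < n) s j)) / cGamma tau) *
    (\prod_(j < n) cpowR (1 + y`_j) (s j - tau)) *
    ((\prod_(j < n) cpowR y`_j (s0 + s j - 1)) * pole_prod n (nth 0 y) s)
  else 0.

Lemma outer_value_row n (s0 : R[i]) s (tau : R[i]) y :
  outer_value n.+1 (nth 0 (0 :: y)) (row_exp s0 s) tau =
  (cGamma s0 * \prod_(j < n) cGamma (s j)) *
  (cGamma (tau - (s0 + \sum_(j < n) s j)) / cGamma tau) *
  (\prod_(j < n) cpowR (1 + y`_j) (s j - tau)) *
  ((\prod_(j < n) cpowR y`_j (s0 + s j - 1)) * pole_prod n (nth 0 y) s).
Proof.
rewrite /outer_value.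
rewrite (big_ordS _ _ _ (fun j => cGamma (row_exp s0 s j))).
rewrite (big_ordS _ _ _ (fun j => row_exp s0 s j)).
rewrite (big_ordS _ _ _ (fun j => cpowR (1 + (0 :: y)`_j) (row_exp s0 s j - tau))).
have -> : pole_prod n.+1 (nth 0 (0 :: y)) (row_exp s0 s) =
    (\prod_(j < n) cpowR y`_j (s0 + s j - 1)) * pole_prod n (nth 0 y) s.
  rewrite {1}/pole_prod (big_ordS _ _ _ (fun j => \prod_(i < j)
    cpowR ((0 :: y)`_j - (0 :: y)`_i) (row_exp s0 s i + row_exp s0 s j - 1))).
  rewrite big_ord0 mul1r -big_split; apply: eq_bigr => j _.
  rewrite (big_ordS _ _ _ (fun i =>
    cpowR ((0 :: y)`_j.+1 - (0 :: y)`_i) (row_exp s0 s i + row_exp s0 s j.+1 - 1))).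
  by rewrite [(0 :: y)`_0]/= subr0.
by rewrite [(0 :: y)`_0]/= addr0 cpow1R mul1r.
Qed.

Lemma hasC_row n (s0 : R[i]) s (tau : R[i]) y : 0 < complex.Re s0 ->
  (forall j, (j < n)%N -> 0 < complex.Re (s j)) ->
  0 < complex.Re (tau - (s0 + \sum_(j < n) s j)) ->
  hasC (lebesgue_tuple n.+1) (fun x : tup n.+1 => row_integrand n s0 s tau y x)
    (row_value n s0 s tau y).
Proof.
move=> s00 sj0 t0; rewrite /row_value; case: ifP => hy; last first.
  rewrite (_ : (fun _ => _) = fun=> 0); first exact: hasC0.
  apply/funext => x; rewrite /row_integrand /outer_integrand; case: ifP => // hx.
  by rewrite (interlaced_pos_increasing hx) in hy.
rewrite -outer_value_row; apply: hasC_outer.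
- exact: pos_increasing_cons.
- move=> [|j] jn; first by rewrite addr0.
  by rewrite ltr_wpDr // ltW // (pos_increasing_gt0 hy).
- by case.
- by rewrite (big_ordS _ _ _ (fun j => row_exp s0 s j)).
Qed.

Lemma normC_row_integrand n (s0 : R[i]) s (tau : R[i]) y x :
  (normc (row_integrand n s0 s tau y x))%:C =
  row_integrand n (real_part s0) (fun j => real_part (s j)) (real_part tau) y x.
Proof.
rewrite normC_outer_integrand; congr outer_integrand.
by apply/funext => -[].
Qed.

Lemma cmeasurable_row_integrand d (T : measurableType d) n (s0 : R[i]) s (tau : R[i]) (x y : T -> seq R) :
  (forall i, measurable_fun setT (fun z => (x z)`_i)) ->
  (forall i, measurable_fun setT (fun z => (y z)`_i)) ->
  cmeasurable (fun z => row_integrand n s0 s tau (y z) (x z)).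
Proof.
move=> mx my; apply: (@cmeasurable_outer_integrand _ _ _ (fun z => nth 0 (0 :: y z))) => //.
by case=> [|i] /=; [exact: measurable_cst|exact: my].
Qed.

End row_integral.

(** * The Selberg integral *)

Section selberg.
Context {R : realType}.
Notation tup n := (n.-tuple (measurableTypeR R)).
Implicit Types (k sigma tau : R[i]) (x y : seq R).

(** The factor [vdm] and the exponent [2k - 1] of [pole_prod] combine to the power [2k] of the
    differences: Selberg's integrand on the half-line, restricted to increasing arguments. *)
Definition selberg_integrand n k sigma tau x : R[i] :=
  if pos_increasing n x then
    selberg_weight n sigma tau x * pole_prod n (nth 0 x) (fun=> k)
  else 0.

Definition selberg_value n k sigma tau : R[i] :=
  (\prod_(j < n) (cGamma (k *+ j.+1) / cGamma k)) *
  \prod_(j < n) (cGamma (sigma + k *+ j) * cGamma (tau - sigma - k *+ (n.-1 + j)) /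
                 cGamma (tau - k *+ j)).

(** Over [y] it is an inner integrand and leaves the Selberg integrand of size [n + 1] at
    [(sigma, tau)]; over [x] it is an outer integrand and leaves the one of size [n] at
    [(sigma + k, tau - k)]. *)
Let kernel n k sigma tau x y : R[i] :=
  row_integrand n sigma (fun=> k) tau y x * (vdm n y)%:C.

Let kernel_inner n k sigma tau x y : kernel n k sigma tau x y =
  (if pos_increasing n.+1 x then selberg_weight n.+1 sigma tau x else 0) *
  inner_integrand n (nth 0 x) (fun=> k) y.
Proof.
rewrite /kernel row_integrandE /cross_row interlaced_row /inner_integrand.
case: (pos_increasing n.+1 x) => /=; last by rewrite !mul0r.
case: ifP => _; last by rewrite mulr0 !mul0r.
have -> : cross_prod n n.+1 (nth 0 y) (fun=> k) x = cross_prod n.+1 n (nth 0 x) (fun=> k) y.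
  rewrite /cross_prod exchange_big /=; apply: eq_bigr => i _; apply: eq_bigr => j _.
  by rewrite distrC.
move: (cross_prod n.+1 n (nth 0 x) (fun=> k) y) (selberg_weight n.+1 sigma tau x)
  (vdm n y)%:C => *.
by ring.
Qed.

Let inner_const n k : R[i] := cGamma k ^+ n / cGamma (k *+ n).

Let hasC_kernel_inner n k sigma tau x : 0 < complex.Re k ->
  hasC (lebesgue_tuple n) (fun y : tup n => kernel n k sigma tau x y)
    (inner_const n.+1 k * selberg_integrand n.+1 k sigma tau x).
Proof.
move=> k0.
rewrite (_ : (fun _ => _) = (fun y : tup n =>
  (if pos_increasing n.+1 x then selberg_weight n.+1 sigma tau x else 0) *
  inner_integrand n (nth 0 x) (fun=> k) y)); last first.
  by apply/funext => y; rewrite kernel_inner.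
rewrite /selberg_integrand; case: ifP => hx; last first.
  rewrite mulr0 (_ : (fun _ => _) = fun=> 0); first exact: hasC0.
  by apply/funext => y; rewrite mul0r.
have -> : inner_const n.+1 k * (selberg_weight n.+1 sigma tau x *
    pole_prod n.+1 (nth 0 x) (fun=> k)) =
    selberg_weight n.+1 sigma tau x * inner_value n (nth 0 x) (fun=> k).
  rewrite /inner_value big_const_ord sumr_const card_ord iter_mulr_1 /inner_const.
  move: (selberg_weight _ _ _ _) (pole_prod _ _ _) (cGamma (k *+ n.+1)) (cGamma k ^+ n.+1) => *.
  by ring.
apply: hasCZ; apply: hasC_inner => //.
exact: pos_increasing_upto.
Qed.

Let outer_const n k sigma tau : R[i] :=
  cGamma sigma * cGamma k ^+ n * (cGamma (tau - sigma - k *+ n) / cGamma tau).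

Let hasC_kernel_outer n k sigma tau y : 0 < complex.Re k -> 0 < complex.Re sigma ->
  0 < complex.Re (tau - sigma - k *+ n) ->
  hasC (lebesgue_tuple n.+1) (fun x : tup n.+1 => kernel n k sigma tau x y)
    (outer_const n k sigma tau * selberg_integrand n k (sigma + k) (tau - k) y).
Proof.
move=> k0 s0 t0.
have e : tau - (sigma + \sum_(j < n) k) = tau - sigma - k *+ n.
  by rewrite sumr_const card_ord opprD addrA.
have -> : outer_const n k sigma tau * selberg_integrand n k (sigma + k) (tau - k) y =
    (vdm n y)%:C * row_value n sigma (fun=> k) tau y.
  rewrite /row_value /selberg_integrand; case: ifP => hy; last by rewrite !mulr0.
  rewrite e big_const_ord iter_mulr_1 /outer_const /selberg_weight opprB.
  move: (\prod_(j < n) cpowR (1 + y`_j) (k - tau)) (\prod_(j < n) cpowR y`_j (sigma + k - 1))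
    (pole_prod n (nth 0 y) (fun=> k)) (vdm n y)%:C (cGamma k ^+ n)
    (cGamma (tau - sigma - k *+ n)) (cGamma sigma) (cGamma tau) => *.
  by ring.
rewrite (_ : (fun _ => _) = (fun x : tup n.+1 =>
  (vdm n y)%:C * row_integrand n sigma (fun=> k) tau y x)); last first.
  by apply/funext => x; rewrite /kernel mulrC.
by apply: hasCZ; apply: hasC_row => //; rewrite e.
Qed.

Let normC_kernel n k sigma tau x y : (normc (kernel n k sigma tau x y))%:C =
  kernel n (real_part k) (real_part sigma) (real_part tau) x y.
Proof.
rewrite /kernel normcM_complex normC_row_integrand.
rewrite /row_integrand /outer_integrand; case: ifP => hx; last by rewrite !mul0r.
rewrite [normc (_%:C)]normc_real // ltW // vdm_gt0 //.
exact: pos_increasing_upto (interlaced_pos_increasing hx).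
Qed.

Let cmeasurable_kernel n k sigma tau :
  cmeasurable (fun z : tup n.+1 * tup n => kernel n k sigma tau z.1 z.2).
Proof.
have m1 i : measurable_fun setT (fun z : tup n.+1 * tup n => z.1`_i).
  by apply: (measurableT_comp (f := fun t : tup n.+1 => t`_i)); [exact: measurable_nth|exact: measurable_fst].
have m2 i : measurable_fun setT (fun z : tup n.+1 * tup n => z.2`_i).
  by apply: (measurableT_comp (f := fun t : tup n => t`_i)); [exact: measurable_nth|exact: measurable_snd].
apply: cmeasurableM.
  by apply: cmeasurable_row_integrand => i; [exact: m1|exact: m2].
exact: cmeasurable_vdm.
Qed.

(* Both orders of integration in the kernel are Dixon-Anderson integrals. *)
Lemma hasC_selberg n k sigma tau : 0 < complex.Re k -> 0 < complex.Re sigma ->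
  ((0 < n)%N -> 0 < complex.Re (tau - sigma - k *+ (n.-1 + n.-1))) ->
  hasC (lebesgue_tuple n) (fun x : tup n => selberg_integrand n k sigma tau x)
    (selberg_value n k sigma tau).
Proof.
elim: n k sigma tau => [|n ih] k sigma tau k0 s0 t0.
  have -> : selberg_value 0 k sigma tau = selberg_integrand 0 k sigma tau [tuple].
    rewrite /selberg_value /selberg_integrand /selberg_weight /pos_increasing /pole_prod /vdm.
    by rewrite !big_ord0 !mul1r.
  exact: hasC_tuple0.
have {}t0 : 0 < complex.Re (tau - sigma - k *+ (n + n)) by exact: t0.
have t1 : 0 < complex.Re (tau - sigma - k *+ n).
  apply: lt_le_trans t0 _; rewrite !ReB !ReMn lerD2l lerN2 ler_wpMn2l ?ltW //.
  exact: leq_addr.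
(* The parameter shift uses up exactly the two multiples of [k] by which the condition weakens when
   the size drops by 1. *)
have t2 : (0 < n)%N -> 0 < complex.Re (tau - k - (sigma + k) - k *+ (n.-1 + n.-1)).
  case: n t0 {ih t1} => // n t0 _; congr (0 < complex.Re _) : t0 => /=.
  by rewrite !addnS addSn !mulrS; ring.
have s1 : 0 < complex.Re (sigma + k) by rewrite ReD addr_gt0.
have hK : hasC (lebesgue_tuple n.+1 \x lebesgue_tuple n)%E
    (fun z => kernel n k sigma tau z.1 z.2)
    (outer_const n k sigma tau * selberg_value n k (sigma + k) (tau - k)).
  have hr : hasC (lebesgue_tuple n) (fun y : tup n =>
      outer_const n (real_part k) (real_part sigma) (real_part tau) *
      selberg_integrand n (real_part k) (real_part sigma + real_part k)
        (real_part tau - real_part k) y)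
      (outer_const n (real_part k) (real_part sigma) (real_part tau) *
       selberg_value n (real_part k) (real_part sigma + real_part k)
        (real_part tau - real_part k)).
    apply: hasCZ; apply: ih => //.
      by rewrite -real_partD.
    by move=> n0; rewrite -!(real_partN, real_partD, real_partMn); exact: t2.
  have hn (y : tup n) : hasC (lebesgue_tuple n.+1) (fun x : tup n.+1 =>
      (normc (kernel n k sigma tau x y))%:C)
      (outer_const n (real_part k) (real_part sigma) (real_part tau) *
      selberg_integrand n (real_part k) (real_part sigma + real_part k)
        (real_part tau - real_part k) y).
    rewrite (_ : (fun _ => _) = (fun x : tup n.+1 =>
      kernel n (real_part k) (real_part sigma) (real_part tau) x y)); last first.
      by apply/funext => x; rewrite normC_kernel.
    apply: hasC_kernel_outer => //.
    by rewrite -!(real_partN, real_partD, real_partMn).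
  apply: (hasC_fubini_swap (cmeasurable_kernel n k sigma tau)
    (fun y : tup n => hasC_kernel_outer y k0 s0 t1) (fun y : tup n => (hn y).1) hr.1).
  by apply: hasCZ; exact: ih.
have := hasC_section hK (fun x : tup n.+1 => hasC_kernel_inner n sigma tau x k0).
move/(hasCZ (inner_const n.+1 k)^-1).
have g0 : cGamma k != 0 by exact: cGamma_neq0.
have g1 : cGamma (k *+ n.+1) != 0 by apply: cGamma_neq0; rewrite ReMn pmulrn_lgt0.
have i0 : inner_const n.+1 k != 0 by rewrite mulf_neq0 ?invr_neq0 ?expf_neq0.
congr hasC; first by apply/funext => x; rewrite mulKf.
rewrite /inner_const /outer_const /selberg_value.
rewrite [\prod_(j < n.+1) (cGamma (k *+ _) / _)]big_ord_recr.
rewrite (big_ordS _ _ _ (fun j => cGamma (sigma + k *+ j) *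
  cGamma (tau - sigma - k *+ (n.+1.-1 + j)) / cGamma (tau - k *+ j))) /=.
rewrite mulr0n addr0 subr0 addn0.
rewrite [\prod_(j < n) (cGamma (sigma + k + k *+ j) * _ / _)](eq_bigr (fun j : 'I_n =>
  cGamma (sigma + k *+ j.+1) * cGamma (tau - sigma - k *+ (n + j.+1)) /
  cGamma (tau - k *+ j.+1))); last first.
  move=> j _.
  have -> : sigma + k + k *+ j = sigma + k *+ j.+1 by rewrite mulrS; ring.
  have -> : tau - k - k *+ j = tau - k *+ j.+1 by rewrite mulrS; ring.
  suff -> : tau - k - (sigma + k) - k *+ (n.-1 + j) = tau - sigma - k *+ (n + j.+1) by [].
  case: n j {ih t0 t1 t2 hK g1 i0} => [[]//|n] j /=.
  by rewrite !addnS addSn !mulrS; ring.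
move: (\prod_(j < n) (cGamma (sigma + k *+ j.+1) * cGamma (tau - sigma - k *+ (n + j.+1)) /
  cGamma (tau - k *+ j.+1))) (\prod_(j < n) (cGamma (k *+ j.+1) / cGamma k)) => A B.
rewrite exprS; have := expf_neq0 n g0; move: (cGamma k ^+ n) g0 g1.
move: (cGamma k) (cGamma (k *+ n.+1)) (cGamma sigma) (cGamma (tau - sigma - k *+ n)).
move: (cGamma tau)^-1 => *.
by field; apply/and3P.
Qed.

End selberg.

(** * Lebesgue measure and concatenation of tuples *)

Section tuple_concatenation.
Context {R : realType}.
Notation tup n := (n.-tuple (measurableTypeR R)).

Lemma measurable_cat_tuple p q :
  measurable_fun setT (fun z : tup p * tup q => [tuple of z.1 ++ z.2] : tup (p + q)).
Proof.
apply/measurable_fun_tnthP => i.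
rewrite (_ : _ \o _ = fun z : tup p * tup q => if (i < p)%N then z.1`_i else z.2`_(i - p)); last first.
  by apply/funext => z; rewrite /= (tnth_nth 0) /= nth_cat size_tuple.
case: (i < p)%N.
  apply: (measurableT_comp (f := fun t : tup p => t`_i)); last exact: measurable_fst.
  exact: measurable_nth.
apply: (measurableT_comp (f := fun t : tup q => t`_(i - p))); last exact: measurable_snd.
exact: measurable_nth.
Qed.

Lemma integral_tuple0 (h : tup 0 -> \bar R) : (\int[lebesgue_tuple 0]_t h t = h [tuple])%E.
Proof.
have mh : measurable_fun setT h.
  rewrite (_ : h = fun=> h [tuple]); first exact: measurable_cst.
  by apply/funext => t; rewrite tuple0.
by rewrite /= integral_dirac // diracT mul1e.
Qed.

Lemma tonelli_cat p q (f : tup (p + q) -> \bar R) :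
  measurable_fun setT f -> (forall t, (0 <= f t)%E) ->
  (\int[lebesgue_tuple (p + q)]_t f t =
   \int[lebesgue_tuple p]_t \int[lebesgue_tuple q]_u f [tuple of t ++ u])%E.
Proof.
elim: p f => [|p ih] f mf f0.
  by rewrite integral_tuple0; apply: eq_integral => u _; congr f; exact: val_inj.
have mcat := @measurable_cat_tuple p.+1 q.
rewrite [RHS]tonelli_cons; last 2 first.
- have mfz : measurable_fun setT (fun z : tup p.+1 * tup q => f [tuple of z.1 ++ z.2]).
    exact: (measurableT_comp mf mcat).
  exact: (@measurable_fun_fubini_tonelli_F _ _ _ _ _ (lebesgue_tuple q)
    (fun z : tup p.+1 * tup q => f [tuple of z.1 ++ z.2])).
- by move=> t; exact: integral_ge0.
rewrite (@tonelli_cons R (p + q) f mf f0); apply: eq_integral => x _.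
have mfx : measurable_fun setT (fun w : tup (p + q) => f (tuple_cons (x, w))).
  apply: (measurableT_comp mf); apply: (measurableT_comp (@measurable_tuple_cons R _)).
  exact: measurable_pair1.
apply: (etrans (ih _ mfx (fun w => f0 _))).
apply: eq_integral => t _; apply: eq_integral => u _.
by congr f; exact: val_inj.
Qed.

Lemma hasC_cat p q (f : tup (p + q) -> R[i]) v : cmeasurable f ->
  hasC (lebesgue_tuple p \x lebesgue_tuple q)%E (fun z => f [tuple of z.1 ++ z.2]) v ->
  hasC (lebesgue_tuple (p + q)) f v.
Proof.
move=> mf.
have mcat := @measurable_cat_tuple p q.
have ch : @chvar R _ _ _ _ (lebesgue_tuple p \x lebesgue_tuple q)%E (lebesgue_tuple (p + q))
    (fun z => [tuple of z.1 ++ z.2]) (fun=> 1) (fun=> 1).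
  move=> g mg g0.
  under eq_integral do rewrite mule1.
  under [RHS]eq_integral do rewrite mule1.
  apply: (etrans _ (esym (tonelli_cat mg g0))).
  rewrite (fubini_tonelli1 (fun z : tup p * tup q => g [tuple of z.1 ++ z.2])) //.
  exact: (measurableT_comp mg mcat).
have p1 d (T : measurableType d) (x : T) : 0 <= (1 : R) by [].
have m1 d (T : measurableType d) : measurable_fun setT ((fun=> 1) : T -> R).
  exact: measurable_cst.
have := hasC_chvar v ch mcat (m1 _ _) (m1 _ _) (@p1 _ _) (@p1 _ _) mf.
rewrite (_ : (fun y => f y * _) = f); last by apply/funext => t; rewrite rmorph1 mulr1.
rewrite (_ : (fun x => f _ * _) = fun z : tup p * tup q => f [tuple of z.1 ++ z.2]); last first.
  by apply/funext => t; rewrite rmorph1 mulr1.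
by case.
Qed.

End tuple_concatenation.

(** * Integration over trapezoids *)

Section trapezoid_integral.
Context {R : realType}.
Notation tup n := (n.-tuple (measurableTypeR R)).
Implicit Types (x y t : seq R) (th : nat -> R[i]).

Definition trap_row m t j : seq R := mkseq (fun i => trap_entry m t j i.+1) j.

Lemma nth_trap_row m t j i : (i < j)%N -> (trap_row m t j)`_i = trap_entry m t j i.+1.
Proof. by move=> ij; rewrite nth_mkseq. Qed.

Lemma trap_pos_lt m n j i : (m <= j <= n)%N -> (i < j)%N ->
  (\sum_(m <= l < j) l + i < trap_size m n)%N.
Proof.
move=> /andP[mj jn] ij.
rewrite /trap_size [X in (_ < X)%N](@big_cat_nat _ _ _ j) //=; last exact: leqW.
by rewrite [X in (_ < _ + X)%N]big_ltn // ltn_add2l; exact: ltn_addr.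
Qed.

Lemma trap_row_catl m n j t x : size t = trap_size m n -> (m <= j <= n)%N ->
  trap_row m (t ++ x) j = trap_row m t j.
Proof.
move=> st /andP[mj jn]; apply: (@eq_from_nth _ 0); first by rewrite !size_mkseq.
move=> i; rewrite size_mkseq => ij; rewrite !nth_trap_row // /trap_entry nth_cat st /=.
by rewrite trap_pos_lt // mj.
Qed.

Lemma trap_row_catr m n t (x : tup n.+1) : size t = trap_size m n ->
  trap_row m (t ++ x) n.+1 = x.
Proof.
move=> st; apply: (@eq_from_nth _ 0); first by rewrite size_mkseq size_tuple.
move=> i; rewrite size_mkseq => ij; rewrite nth_trap_row // /trap_entry nth_cat st /=.
by rewrite ltnNge leq_addr /= addKn.
Qed.

Lemma trap_row_base m t : size t = m -> trap_row m t m = t.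
Proof.
move=> st; apply: (@eq_from_nth _ 0); first by rewrite size_mkseq.
by move=> i; rewrite size_mkseq => im; rewrite nth_trap_row // /trap_entry big_geq.
Qed.

Lemma measurable_trap_row N m j i :
  measurable_fun setT (fun t : tup N => (trap_row m t j)`_i).
Proof.
have [ij|ji] := ltnP i j.
  rewrite (_ : (fun _ => _) = fun t : tup N => t`_(\sum_(m <= i < j) i + i)).
    exact: measurable_nth.
  by apply/funext => t; rewrite nth_trap_row.
rewrite (_ : (fun _ => _) = fun=> 0); first exact: measurable_cst.
by apply/funext => t; rewrite nth_default // size_mkseq.
Qed.

(* The factor by which the row [y] differs from a last row of the integral. *)
Definition link_weight n (sn sn1 tn tn1 : R[i]) th y : R[i] :=
  (\prod_(i < n) (cpowR y`_i (sn - sn1 - th i) * cpowR (1 + y`_i) (- (tn - tn1 + th i)))) *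
  \prod_(j < n) \prod_(i < j) cpowR (y`_j - y`_i) (- (th i + th j - (1 + 1))).

Definition row_const n (s0 t0 : R[i]) th : R[i] :=
  (cGamma s0 * \prod_(j < n) cGamma (th j)) *
  (cGamma (t0 - (s0 + \sum_(j < n) th j)) / cGamma t0).

(** The reproducing property behind the removal of a row. The exponents of [y_i] and [1 + y_i] add
    up to those of a last row, and the exponents [-(th_i + th_j - 2)] and [th_i + th_j - 1] of the
    differences add up to 1, which gives [vdm]. *)
Lemma link_weight_row_value n (sn sn1 tn tn1 : R[i]) th y : pos_increasing n y ->
  link_weight n sn sn1 tn tn1 th y * row_value n sn1 th tn1 y =
  row_const n sn1 tn1 th * selberg_weight n sn tn y.
Proof.
move=> hy; rewrite /row_value hy /link_weight /selberg_weight /row_const.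
have -> : (vdm n y)%:C = (\prod_(j < n) \prod_(i < j)
    cpowR (y`_j - y`_i) (- (th i + th j - (1 + 1)))) * pole_prod n (nth 0 y) th.
  rewrite /vdm /pole_prod rmorph_prod -big_split /=; apply: eq_bigr => j _.
  rewrite rmorph_prod -big_split /=; apply: eq_bigr => i _.
  rewrite -(cpowRD (y`_j - y`_i)) -[LHS]cpowR1 ?subr_gt0.
    by congr (cpowR _ _); ring.
  exact: (pos_increasing_upto hy).
have -> : \prod_(i < n) cpowR y`_i (sn - 1) =
    (\prod_(i < n) cpowR y`_i (sn - sn1 - th i)) * (\prod_(i < n) cpowR y`_i (sn1 + th i - 1)).
  rewrite -big_split /=; apply: eq_bigr => i _.
  by rewrite -(cpowRD y`_i); congr (cpowR _ _); ring.
have -> : \prod_(i < n) cpowR (1 + y`_i) (- tn) =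
    (\prod_(i < n) cpowR (1 + y`_i) (- (tn - tn1 + th i))) *
    (\prod_(i < n) cpowR (1 + y`_i) (th i - tn1)).
  rewrite -big_split /=; apply: eq_bigr => i _.
  by rewrite -(cpowRD (1 + y`_i)); congr (cpowR _ _); ring.
rewrite [\prod_(i < n) (cpowR y`_i _ * _)](big_split _ _ _
  (fun i : 'I_n => cpowR y`_i (sn - sn1 - th i))
  (fun i : 'I_n => cpowR (1 + y`_i) (- (tn - tn1 + th i)))) /=.
move: (\prod_(i < n) cpowR y`_i (sn - sn1 - th i)) (\prod_(i < n) cpowR y`_i (sn1 + th i - 1))
  (\prod_(i < n) cpowR (1 + y`_i) (- (tn - tn1 + th i)))
  (\prod_(i < n) cpowR (1 + y`_i) (th i - tn1)) (pole_prod n (nth 0 y) th)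
  (\prod_(j < n) \prod_(i < j) cpowR (y`_j - y`_i) (- (th i + th j - (1 + 1))))
  (\prod_(j < n) cGamma (th j)) (cGamma (tn1 - (sn1 + \sum_(j < n) th j))) (cGamma sn1)
  (cGamma tn1) => *.
by ring.
Qed.

(* [trap_prefix] contains the factors in which the last row only enters through
   [cross_row]; it vanishes unless the trapezoid interlaces strictly. *)
Definition trap_prefix m n (k : R[i]) (sigma tau : nat -> R[i]) (theta : nat -> nat -> R[i]) t :=
  (if pos_increasing m (trap_row m t m) then pole_prod m (nth 0 (trap_row m t m)) (fun=> k)
   else 0) *
  \prod_(m <= j < n) (link_weight j (sigma j) (sigma j.+1) (tau j) (tau j.+1)
      (fun i => theta j i.+1) (trap_row m t j) *
    cross_row j (fun i => theta j i.+1) (trap_row m t j) (trap_row m t j.+1)).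

Definition trap_integrand m n k sigma tau theta t : R[i] :=
  trap_prefix m n k sigma tau theta t * selberg_weight n (sigma n) (tau n) (trap_row m t n).

Definition trap_value m n k (sigma tau : nat -> R[i]) (theta : nat -> nat -> R[i]) : R[i] :=
  selberg_value m k (sigma m) (tau m) *
  \prod_(m <= j < n) row_const j (sigma j.+1) (tau j.+1) (fun i => theta j i.+1).

Lemma trap_prefix_pos_increasing m n k sigma tau theta t : (m <= n)%N ->
  trap_prefix m n k sigma tau theta t != 0 -> pos_increasing n (trap_row m t n).
Proof.
rewrite /trap_prefix leq_eqVlt => /predU1P[<-|].
  by case: ifP => //; rewrite mul0r eqxx.
case: n => // n; rewrite ltnS => mn; rewrite big_nat_recr //= !mulf_eq0 !negb_or.
case/and4P => _ _ _; rewrite /cross_row; case: ifP => [|_]; last by rewrite eqxx.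
by rewrite interlaced_row => /andP[].
Qed.

(** Isolates the only factor in which the new row [x] occurs. *)
Lemma trap_integrand_cat m n k sigma tau theta t (x : tup n.+1) : (m <= n)%N ->
  size t = trap_size m n ->
  trap_integrand m n.+1 k sigma tau theta (t ++ x) =
  trap_prefix m n k sigma tau theta t *
  link_weight n (sigma n) (sigma n.+1) (tau n) (tau n.+1) (fun i => theta n i.+1)
    (trap_row m t n) *
  row_integrand n (sigma n.+1) (fun i => theta n i.+1) (tau n.+1) (trap_row m t n) x.
Proof.
move=> mn st; rewrite /trap_integrand row_integrandE.
have rE j : (m <= j <= n)%N -> trap_row m (t ++ x) j = trap_row m t j.
  by move=> jn; exact: trap_row_catl st jn.
rewrite (trap_row_catr _ st) /trap_prefix big_nat_recr //= (trap_row_catr _ st).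
rewrite !rE ?leqnn ?mn //.
rewrite (eq_big_nat _ _ (F2 := fun j => link_weight j (sigma j) (sigma j.+1) (tau j) (tau j.+1)
      (fun i => theta j i.+1) (trap_row m t j) *
    cross_row j (fun i => theta j i.+1) (trap_row m t j) (trap_row m t j.+1))); last first.
  by move=> j /andP[mj jn]; rewrite !rE ?mj 1?ltnW ?jn.
move: (\prod_(m <= j < n) _) (link_weight _ _ _ _ _ _ _) (cross_row _ _ _ _)
  (selberg_weight _ _ _ _) => A B C D.
by move: (if _ then _ else _) => E; ring.
Qed.

Lemma normC_link_weight n (sn sn1 tn tn1 : R[i]) th y :
  (normc (link_weight n sn sn1 tn tn1 th y))%:C =
  link_weight n (real_part sn) (real_part sn1) (real_part tn) (real_part tn1)
    (fun i => real_part (th i)) y.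
Proof.
rewrite /link_weight normcM_complex !normC_prod; congr (_ * _).
  apply: eq_bigr => i _; rewrite normcM_complex !normc_cpowRE -!/(real_part _).
  by rewrite !(real_partN, real_partD).
apply: eq_bigr => j _; rewrite normC_prod; apply: eq_bigr => i _.
by rewrite normc_cpowRE -/(real_part _) !(real_partN, real_partD, real_part1).
Qed.

Lemma normC_cross_row n th y x : (normc (cross_row n th y x))%:C =
  cross_row n (fun i => real_part (th i)) y x.
Proof.
rewrite /cross_row; case: ifP => _; first exact: normC_cross_prod.
by rewrite normc_real.
Qed.

Lemma normC_pole_prod n (a : nat -> R) th :
  (normc (pole_prod n a th))%:C = pole_prod n a (fun i => real_part (th i)).
Proof.
rewrite /pole_prod normC_prod; apply: eq_bigr => j _; rewrite normC_prod; apply: eq_bigr => i _.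
by rewrite normc_cpowRE -/(real_part _) !(real_partN, real_partD, real_part1).
Qed.

Lemma normC_trap_prefix m n k sigma tau theta t :
  (normc (trap_prefix m n k sigma tau theta t))%:C =
  trap_prefix m n (real_part k) (fun j => real_part (sigma j)) (fun j => real_part (tau j))
    (fun j i => real_part (theta j i)) t.
Proof.
rewrite /trap_prefix normcM_complex normC_prod; congr (_ * _).
  by case: ifP => _; [exact: normC_pole_prod|rewrite normc_real].
by apply: eq_bigr => j _; rewrite normcM_complex normC_link_weight normC_cross_row.
Qed.

Lemma cmeasurable_link_weight d (T : measurableType d) (y : T -> seq R) n
    (sn sn1 tn tn1 : R[i]) th :
  (forall i, measurable_fun setT (fun z => (y z)`_i)) ->
  cmeasurable (fun z => link_weight n sn sn1 tn tn1 th (y z)).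
Proof.
move=> my; apply: cmeasurableM.
  apply: cmeasurable_prod => i; apply: cmeasurableM.
    exact: (cmeasurable_cpowR (f := fun z => (y z)`_i)).
  by apply: (cmeasurable_cpowR (f := fun z => 1 + (y z)`_i)); exact: measurable_funD.
apply: cmeasurable_prod => j; apply: cmeasurable_prod => i.
apply: (cmeasurable_cpowR (f := fun z => (y z)`_j - (y z)`_i)).
exact: measurable_funB.
Qed.

Lemma cmeasurable_cross_row d (T : measurableType d) (y x : T -> seq R) n th :
  (forall i, measurable_fun setT (fun z => (x z)`_i)) ->
  (forall i, measurable_fun setT (fun z => (y z)`_i)) ->
  cmeasurable (fun z => cross_row n th (y z) (x z)).
Proof.
move=> mx my; apply: cmeasurable_if; last exact: cmeasurable_cst.
  apply: measurable_interlaced_fun => // -[|i] /=; [exact: measurable_cst|exact: my].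
exact: cmeasurable_cross_prod.
Qed.

Lemma cmeasurable_pole_prod d (T : measurableType d) (y : T -> seq R) n th :
  (forall i, measurable_fun setT (fun z => (y z)`_i)) ->
  cmeasurable (fun z => pole_prod n (nth 0 (y z)) th).
Proof.
move=> my; apply: cmeasurable_prod => j; apply: cmeasurable_prod => i.
apply: (cmeasurable_cpowR (f := fun z => (y z)`_j - (y z)`_i)).
exact: measurable_funB.
Qed.

Lemma cmeasurable_selberg_weight d (T : measurableType d) (y : T -> seq R) n (s0 t0 : R[i]) :
  (forall i, measurable_fun setT (fun z => (y z)`_i)) ->
  cmeasurable (fun z => selberg_weight n s0 t0 (y z)).
Proof.
move=> my; apply: cmeasurableM; last exact: cmeasurable_vdm.
apply: cmeasurableM; apply: cmeasurable_prod => i.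
  exact: (cmeasurable_cpowR (f := fun z => (y z)`_i)).
by apply: (cmeasurable_cpowR (f := fun z => 1 + (y z)`_i)); exact: measurable_funD.
Qed.

Lemma cmeasurable_trap_integrand N m n k sigma tau theta :
  cmeasurable (fun t : tup N => trap_integrand m n k sigma tau theta t).
Proof.
have mr := @measurable_trap_row N m.
apply: cmeasurableM; last by apply: cmeasurable_selberg_weight.
apply: cmeasurableM.
  apply: cmeasurable_if; [exact: measurable_pos_increasing| |exact: cmeasurable_cst].
  exact: cmeasurable_pole_prod.
apply: cmeasurable_prod => j; apply: cmeasurableM.
  exact: cmeasurable_link_weight.
exact: cmeasurable_cross_row.
Qed.

End trapezoid_integral.

Section trapezoid_integral_value.
Context {R : realType}.
Notation tup n := (n.-tuple (measurableTypeR R)).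

Lemma trap_sizeS m n : (m <= n.+1)%N -> trap_size m n.+1 = (trap_size m n + n.+1)%N.
Proof. by move=> mn; rewrite /trap_size big_nat_recr. Qed.

Lemma trap_size_base m : trap_size m m = m.
Proof. by rewrite /trap_size big_nat1. Qed.

Lemma hasC_trap m n (k : R[i]) (sigma tau : nat -> R[i]) (theta : nat -> nat -> R[i]) :
  (0 < m)%N -> (m <= n)%N -> 0 < complex.Re k ->
  (forall j i, (m <= j < n)%N -> (i < j)%N -> 0 < complex.Re (theta j i.+1)) ->
  (forall j, (m <= j <= n)%N -> 0 < complex.Re (sigma j)) ->
  0 < complex.Re (tau m - sigma m - k *+ (m.-1 + m.-1)) ->
  (forall j, (m <= j < n)%N ->
    0 < complex.Re (tau j.+1 - (sigma j.+1 + \sum_(i < j) theta j i.+1))) ->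
  hasC (lebesgue_tuple (trap_size m n))
    (fun t : tup (trap_size m n) => trap_integrand m n k sigma tau theta t)
    (trap_value m n k sigma tau theta).
Proof.
move=> m0 mn; elim: n mn k sigma tau theta => [|n ih] mn k sigma tau theta k0 th0 s0 tm0 t0.
  by rewrite leqn0 in mn; rewrite (eqP mn) in m0.
move: (mn); rewrite leq_eqVlt => /predU1P[mE|]; last first.
  rewrite ltnS => mn'.
  have thn j : (j < n)%N -> 0 < complex.Re (theta n j.+1).
    by move=> jn; apply: th0 => //; rewrite mn' /=.
  have s0n : 0 < complex.Re (sigma n.+1) by apply: s0; rewrite mn /=.
  have t0n : 0 < complex.Re (tau n.+1 - (sigma n.+1 + \sum_(i < n) theta n i.+1)).
    by apply: t0; rewrite mn' /=.
  have th0' j i : (m <= j < n)%N -> (i < j)%N -> 0 < complex.Re (theta j i.+1).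
    by move=> /andP[mj jn]; apply: th0; rewrite mj ltnW.
  have s0' j : (m <= j <= n)%N -> 0 < complex.Re (sigma j).
    by move=> /andP[mj jn]; apply: s0; rewrite mj leqW.
  have t0' j : (m <= j < n)%N ->
      0 < complex.Re (tau j.+1 - (sigma j.+1 + \sum_(i < j) theta j i.+1)).
    by move=> /andP[mj jn]; apply: t0; rewrite mj ltnW.
  rewrite trap_sizeS //; apply: hasC_cat; first exact: cmeasurable_trap_integrand.
  set q := trap_size m n.
  pose c k' sg ta (tht : nat -> nat -> R[i]) (t : seq R) := trap_prefix m n k' sg ta tht t *
    link_weight n (sg n) (sg n.+1) (ta n) (ta n.+1) (fun i => tht n i.+1) (trap_row m t n).
  (* Stated for arbitrary parameters because it serves twice: for the given ones, and for their real
     parts, which control the absolute value. *)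
  have sec k' sg ta (tht : nat -> nat -> R[i]) (t : tup q) : 0 < complex.Re (sg n.+1) ->
      (forall j, (j < n)%N -> 0 < complex.Re (tht n j.+1)) ->
      0 < complex.Re (ta n.+1 - (sg n.+1 + \sum_(i < n) tht n i.+1)) ->
      hasC (lebesgue_tuple n.+1)
        (fun x : tup n.+1 => trap_integrand m n.+1 k' sg ta tht (t ++ x))
        (row_const n (sg n.+1) (ta n.+1) (fun i => tht n i.+1) *
          trap_integrand m n k' sg ta tht t).
    move=> h1 h2 h3.
    have -> : row_const n (sg n.+1) (ta n.+1) (fun i => tht n i.+1) *
          trap_integrand m n k' sg ta tht t =
        c k' sg ta tht t * row_value n (sg n.+1) (fun i => tht n i.+1) (ta n.+1) (trap_row m t n).
      rewrite /c /trap_integrand.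
      (* The reproducing identity needs a positive increasing row [n]; where this fails, the prefix
         vanishes and both sides are 0. *)
      have [->|/(trap_prefix_pos_increasing mn') hy] := eqVneq (trap_prefix m n k' sg ta tht t) 0.
        by rewrite !mul0r mulr0.
      rewrite -mulrA (link_weight_row_value _ _ _ _ _ hy).
      by rewrite mulrCA.
    rewrite (_ : (fun _ => _) = (fun x : tup n.+1 => c k' sg ta tht t *
        row_integrand n (sg n.+1) (fun i => tht n i.+1) (ta n.+1) (trap_row m t n) x)); last first.
      by apply/funext => x; rewrite trap_integrand_cat // size_tuple.
    by apply: hasCZ; apply: hasC_row.
  have rec k' sg ta (tht : nat -> nat -> R[i]) :
      hasC (lebesgue_tuple q) (fun t : tup q => trap_integrand m n k' sg ta tht t)
        (trap_value m n k' sg ta tht) ->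
      hasC (lebesgue_tuple q) (fun t : tup q =>
        row_const n (sg n.+1) (ta n.+1) (fun i => tht n i.+1) * trap_integrand m n k' sg ta tht t)
        (trap_value m n.+1 k' sg ta tht).
    move=> h; have -> : trap_value m n.+1 k' sg ta tht =
        row_const n (sg n.+1) (ta n.+1) (fun i => tht n i.+1) * trap_value m n k' sg ta tht.
      rewrite /trap_value big_nat_recr //= mulrA; exact: mulrC.
    exact: hasCZ.
  pose rk := real_part k; pose rs j := real_part (sigma j); pose rt j := real_part (tau j).
  pose rth j i := real_part (theta j i).
  have rE j : rt j.+1 - (rs j.+1 + \sum_(i < j) rth j i.+1) =
      real_part (tau j.+1 - (sigma j.+1 + \sum_(i < j) theta j i.+1)).
    by rewrite /rt /rs /rth (real_part_sum j (fun i => theta j i.+1)) -!(real_partN, real_partD).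
  have hr : hasC (lebesgue_tuple q) (fun t : tup q =>
        row_const n (rs n.+1) (rt n.+1) (fun i => rth n i.+1) * trap_integrand m n rk rs rt rth t)
        (trap_value m n.+1 rk rs rt rth).
    apply: rec; apply: ih => //; last by move=> j jn; rewrite rE; exact: t0'.
    by rewrite /rt /rs /rk -!(real_partN, real_partD, real_partMn).
  have hn (t : tup q) : hasC (lebesgue_tuple n.+1) (fun x : tup n.+1 =>
      (normc (trap_integrand m n.+1 k sigma tau theta (t ++ x)))%:C)
      (row_const n (rs n.+1) (rt n.+1) (fun i => rth n i.+1) * trap_integrand m n rk rs rt rth t).
    rewrite (_ : (fun _ => _) = (fun x : tup n.+1 =>
      trap_integrand m n.+1 rk rs rt rth (t ++ x))); last first.
      apply/funext => x; rewrite !trap_integrand_cat ?size_tuple //.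
      rewrite normcM_complex [X in X * _ = _]normcM_complex.
      by rewrite normC_trap_prefix normC_link_weight normC_row_integrand.
    by apply: sec => //; rewrite rE.
  apply: (hasC_fubini (f := fun z : tup q * tup n.+1 =>
      trap_integrand m n.+1 k sigma tau theta (z.1 ++ z.2))
    (cmeasurable_comp (cmeasurable_trap_integrand _ m n.+1 k sigma tau theta)
      (@measurable_cat_tuple R q n.+1))
    (fun t : tup q => sec k sigma tau theta t s0n thn t0n)
    (fun t : tup q => (hn t).1) hr.1).
  by apply: rec; apply: ih.
(* The base of the induction, [m = n + 1]: the trapezoid is a single row and the integral is
   Selberg's. *)
have -> : trap_value m n.+1 k sigma tau theta = selberg_value m k (sigma m) (tau m).
  by rewrite /trap_value -mE big_geq // mulr1.
rewrite -mE trap_size_base in s0 *.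
rewrite (_ : (fun _ => _) = (fun t : tup m => selberg_integrand m k (sigma m) (tau m) t)).
  by apply: hasC_selberg => //; apply: s0; rewrite leqnn.
apply/funext => t; rewrite /trap_integrand /trap_prefix big_geq // mulr1.
rewrite trap_row_base ?size_tuple // /selberg_integrand.
by case: ifP => _; [exact: mulrC|rewrite mul0r].
Qed.

End trapezoid_integral_value.

(** * The region of integration and its null boundary *)

Section distinct_entries.
Context {R : realType}.
Notation lambda := (@lebesgue_measure R).
Notation tup n := (n.-tuple (measurableTypeR R)).

Lemma measurable_uniq n : measurable_fun setT (fun t : tup n => uniq ((0 : R) :: t)).
Proof.
have mn i : measurable_fun setT (fun t : tup n => (0 :: t)`_i : R).
  by case: i => [|i] /=; [exact: measurable_cst|exact: measurable_nth].
rewrite (_ : (fun _ => _) = (fun t : tup n => \big[andb/true]_(j < n.+1)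
    \big[andb/true]_(i < j) ~~ ((0 :: t)`_i == ((0 :: t)`_j : R)))); last first.
  apply/funext => t; rewrite big_andE; apply/idP/forallP => [ut j|h].
    rewrite big_andE; apply/forallP => i.
    rewrite nth_uniq ?neq_ltn ?ltn_ord //= size_tuple //.
    exact: ltn_trans (ltn_ord i) (ltn_ord j).
  rewrite -[uniq _]negbK; apply/negP => /(uniqPn 0)[i [j [ij]]].
  rewrite /= size_tuple => jn e.
  have := h (Ordinal jn); rewrite big_andE => /forallP/(_ (Ordinal ij)) /=.
  by rewrite e eqxx.
apply: (@measurable_big_and _ _ n.+1 (fun j (t : tup n) => \big[andb/true]_(i < j)
  ~~ ((0 :: t)`_i == ((0 :: t)`_j : R)))) => j.
apply: (@measurable_big_and _ _ j (fun i (t : tup n) =>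
  ~~ ((0 :: t)`_i == ((0 :: t)`_j : R)))) => i.
by apply: measurable_neg; exact: measurable_fun_eqr.
Qed.

(** By Tonelli's theorem: when the remaining entries are distinct and nonzero, the first entry only
    has to avoid a finite set, which is null on the line. The prepended 0 excludes zero entries. *)
Lemma ae_uniq n : {ae lebesgue_tuple n, forall t : tup n, uniq ((0 : R) :: t)}.
Proof.
elim: n => [|n ih]; first by apply: aeW => t; rewrite (tuple0 t).
pose f (t : tup n.+1) : \bar R := (if uniq ((0 : R) :: t) then 0 else 1)%:E.
have mf : measurable_fun setT f.
  apply/measurable_EFinP; apply: measurable_fun_ifT => //; exact: measurable_uniq.
have f0 t : (0 <= f t)%E by rewrite /f lee_fin; case: ifP.
have mfc : measurable_fun setT (fun z => f (tuple_cons z)).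
  by apply: (measurableT_comp mf); exact: measurable_tuple_cons.
have e : (\int[lebesgue_tuple n.+1]_t f t = 0)%E.
  rewrite tonelli_cons_swap //.
  rewrite (ge0_ae_eq_integral (g := cst 0%E)) ?integral0 //.
  - exact: (@measurable_fun_fubini_tonelli_G _ _ _ _ _ lambda
      (fun z : measurableTypeR R * tup n => f (tuple_cons z))).
  - by move=> t _; exact: integral_ge0.
  apply: filterS ih => t ut _ /=.
  rewrite (_ : (fun x => f (tuple_cons (x, t))) =
      (fun x => (\1_[set y : R | y \in (0 : R) :: t] x)%:E)); last first.
    apply/funext => x; rewrite /f indicE; congr (_%:E).
    rewrite (_ : (x \in [set y : R | y \in (0 : R) :: t]) = (x \in (0 : R) :: t)); last first.
      by apply/idP/idP => [/set_mem//|h]; exact/mem_set.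
    move: ut; rewrite tuple_consE /= !inE negb_or => /andP[t0 ut].
    by rewrite t0 ut andbT eq_sym; case: (x == 0); case: (x \in _).
  have ct : countable [set y : R | y \in (0 : R) :: t].
    exact: finite_set_countable.
  rewrite integral_indic // ?setIT; first exact: countable_lebesgue_measure0.
  exact: countable_measurable.
have /(ae_eq_integral_abs _ measurableT mf) : (\int[lebesgue_tuple n.+1]_t `|f t| = 0)%E.
  by rewrite -e; apply: eq_integral => t _; rewrite gee0_abs.
apply: filterS => t /(_ I); rewrite /f; case: ifP => // _ /= [] /eqP.
by rewrite oner_eq0.
Qed.

End distinct_entries.

Section measurable_rayleigh.
Context {R : realType}.
Notation tup n := (n.-tuple (measurableTypeR R)).

Lemma measurable_forall_nat d (T : measurableType d) (P : nat -> T -> Prop) :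
  (forall j, measurable [set z | P j z]) -> measurable [set z | forall j, P j z].
Proof.
move=> mP; rewrite (_ : [set z | _] = \bigcap_(j in setT) [set z | P j z]).
  exact: bigcapT_measurable.
by apply/seteqP; split => z /= h j => [_|]; [exact: h|exact: (h j I)].
Qed.

Lemma measurable_imply_set d (T : measurableType d) (b : bool) (P : T -> Prop) :
  measurable [set z | P z] -> measurable [set z | b -> P z].
Proof.
case: b => mP.
  rewrite (_ : [set z | _] = [set z | P z]) //; apply/seteqP; split => z h //.
  exact: (h isT).
by rewrite (_ : [set z | _] = setT) //; apply/seteqP; split.
Qed.

Lemma measurable_bool_set d (T : measurableType d) (P : T -> bool) :
  measurable_fun setT P -> measurable [set z | P z].
Proof.
move=> mP; rewrite (_ : [set z | _] = setT `&` P @^-1` [set true]); last first.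
  by rewrite setTI; apply/seteqP; split => z.
exact: mP.
Qed.

Lemma measurable_rayleigh_nonneg m n : measurable (rayleigh_nonneg m n : set (tup _)).
Proof.
have me j k : measurable_fun setT (fun t : tup (trap_size m n) => trap_entry m t j k : R).
  exact: measurable_nth.
apply: measurableI; first apply: measurableI.
- apply: measurable_forall_nat => j; apply: measurable_forall_nat => k.
  do 2 apply: measurable_imply_set.
  by apply: measurable_bool_set; exact: measurable_fun_ler.
- apply: measurable_forall_nat => j; apply: measurable_forall_nat => k.
  do 2 apply: measurable_imply_set.
  by apply: measurable_bool_set; apply: measurable_and; exact: measurable_fun_ler.
- apply: measurable_forall_nat => j; apply: measurable_forall_nat => k.
  do 2 apply: measurable_imply_set.
  by apply: measurable_bool_set; exact: measurable_fun_ler.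
Qed.

End measurable_rayleigh.

Section strict_trapezoids.
Context {R : realType}.
Notation tup n := (n.-tuple (measurableTypeR R)).
Implicit Types (x y t : seq R).

Lemma interlaced_upperP n (a : nat -> R) x :
  reflect (forall i, (i < n)%N -> a i < x`_i < a i.+1) (interlaced_upper n a x).
Proof.
apply: (iffP andP) => [[/interlacedP h1 h2] i ni|h].
  have [-> h] := h1 i ni; have [/h//|] := ltnP i.+1 n.
  rewrite leq_eqVlt => /predU1P[|ni']; last by lia.
  by move=> e; move: h2; rewrite e.
split; last by apply/implyP; case: n h => // n h _; have /andP[] := h n (ltnSn n).
by apply/interlacedP => i ni; have /andP[] := h i ni.
Qed.

(** The part of the region on which the computation takes place: [trap_prefix] vanishes
    elsewhere. *)
Definition strict_trap m n t : Prop := pos_increasing m (trap_row m t m) /\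
  forall j, (m <= j < n)%N -> pos_increasing j.+1 (trap_row m t j.+1) /\
    interlaced_upper j (nth 0 (trap_row m t j.+1)) (trap_row m t j).

Lemma strict_trap_row m n t j : strict_trap m n t -> (m <= j <= n)%N ->
  pos_increasing j (trap_row m t j).
Proof.
move=> [h1 h2] /andP[]; rewrite leq_eqVlt => /predU1P[<-//|].
by case: j => // j mj jn; have [|] := h2 j _; first by rewrite -ltnS mj.
Qed.

Lemma trap_prefix_strict m n k sigma tau theta t :
  trap_prefix m n k sigma tau theta t != 0 -> strict_trap m n t.
Proof.
rewrite /trap_prefix mulf_eq0 negb_or => /andP[h1 h2]; split.
  by move: h1; case: ifP => //; rewrite eqxx.
move=> j jn; apply/andP; rewrite -interlaced_row.
move: h2; rewrite prodf_seq_neq0 => /allP/(_ j); rewrite mem_index_iota => /(_ jn) /=.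
by rewrite mulf_eq0 negb_or /cross_row => /andP[_]; case: ifP => //; rewrite eqxx.
Qed.

Lemma trap_entryE m t j k : (1 <= k <= j)%N -> trap_entry m t j k = (trap_row m t j)`_k.-1.
Proof. by case: k => // k kj; rewrite nth_trap_row. Qed.

Lemma strict_trap_rayleigh m n (t : tup (trap_size m n)) :
  strict_trap m n t -> rayleigh_nonneg m n t.
Proof.
move=> st; have [_ h2] := st.
split; [split|] => j k jn kj.
- case: k kj => // k kj; have kj' : (1 <= k.+1 <= j)%N by apply: ltnW.
  rewrite (trap_entryE m t kj') (@trap_entryE m t j k.+2 kj).
  apply: ltW; have h := pos_increasing_upto (strict_trap_row st jn).
  exact: (h k k.+1).
- have [|_ /interlaced_upperP h] := h2 j _ => //.
  case: k kj => // k kj; have kj1 : (1 <= k.+1 <= j.+1)%N by apply: leqW.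
  rewrite (trap_entryE m t kj) (trap_entryE m t kj1) (@trap_entryE m t j.+1 k.+2 kj).
  by have /andP[/ltW h3 /ltW h4] := h k kj; apply/andP; split.
- rewrite (trap_entryE m t kj); case: k kj => // k kj.
  by apply: ltW; apply: (pos_increasing_gt0 (strict_trap_row st jn)).
Qed.

(** Every inequality of the region compares entries stored at different positions, or an entry with
    0; distinctness makes all of them strict. *)
Lemma rayleigh_strict_trap m n (t : tup (trap_size m n)) : (m <= n)%N ->
  uniq ((0 : R) :: t) -> rayleigh_nonneg m n t -> strict_trap m n t.
Proof.
move=> mn ut [[hr hi] h0].
have neq j i j' i' : (m <= j <= n)%N -> (i < j)%N -> (m <= j' <= n)%N -> (i' < j')%N ->
    (\sum_(m <= l < j) l + i)%N != (\sum_(m <= l < j') l + i')%N ->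
    (trap_row m t j)`_i != (trap_row m t j')`_i'.
  move=> jn ij jn' ij' e; rewrite !nth_trap_row // /trap_entry /=.
  rewrite nth_uniq ?size_tuple ?trap_pos_lt //.
  by move: ut => /= /andP[].
have gt0 j i : (m <= j <= n)%N -> (i < j)%N -> 0 < (trap_row m t j)`_i.
  move=> jn ij; rewrite lt_def nth_trap_row // h0 // andbT.
  move: ut => /= /andP[t0 _]; apply: contraNneq t0 => <-.
  by rewrite /trap_entry mem_nth // size_tuple trap_pos_lt.
have inc j : (m <= j <= n)%N -> pos_increasing j (trap_row m t j).
  move=> jn; apply/pos_increasingP => -[|i] ij; first exact: gt0.
  have ij' := ltnW ij.
  rewrite /= lt_neqAle neq ?eqn_add2l ?neq_ltn ?ltnSn //=.
  by rewrite !nth_trap_row //; exact: hr.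
split; first by apply: inc; rewrite leqnn.
move=> j /andP[mj jn]; split; first by apply: inc; rewrite leqW.
have jI : (m <= j <= n)%N by rewrite mj ltnW.
have jI' : (m <= j.+1 <= n)%N by rewrite leqW.
apply/interlaced_upperP => i ij.
have /andP[e1 e2] : trap_entry m t j.+1 i.+1 <= trap_entry m t j i.+1 <= trap_entry m t j.+1 i.+2.
  by apply: hi => //; rewrite mj.
have ij' : (i < j.+1)%N by exact: leqW.
(* Row [j + 1] starts [j] positions after row [j], hence its positions are disjoint from those of
   row [j]. *)
have sE : (\sum_(m <= l < j.+1) l = \sum_(m <= l < j) l + j)%N by rewrite big_nat_recr.
rewrite !lt_neqAle !nth_trap_row // e1 e2 !andbT.
rewrite -!nth_trap_row //; apply/andP; split; apply: neq => //.
  by rewrite sE; apply/eqP; lia.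
by rewrite sE; apply/eqP; lia.
Qed.

End strict_trapezoids.

(** * Integrand and value in the indexing of the theorem *)

Section rayleigh_integrand_rows.
Context {R : realType}.
Implicit Types (x y t : seq R).

Lemma big_nat1_ord (V : Type) (op : V -> V -> V) (idx : V) n (F : nat -> V) :
  \big[op/idx]_(1 <= i < n.+1) F i = \big[op/idx]_(i < n) F i.+1.
Proof. by rewrite big_add1 big_mkord. Qed.

Lemma prod_pairs_ord n (F : nat -> nat -> R[i]) :
  \prod_(1 <= b < n.+1) \prod_(1 <= a < b) F b a = \prod_(j < n) \prod_(i < j) F j.+1 i.+1.
Proof. by rewrite big_nat1_ord; apply: eq_bigr => j _; rewrite big_nat1_ord. Qed.

Lemma link_cross_rowE m j (sj sj1 tj tj1 : R[i]) (th : nat -> R[i]) t :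
  interlaced j.+1 (nth 0 (0 :: trap_row m t j)) (trap_row m t j.+1) ->
  link_weight j sj sj1 tj tj1 (fun i => th i.+1) (trap_row m t j) *
    cross_row j (fun i => th i.+1) (trap_row m t j) (trap_row m t j.+1) =
  (\prod_(1 <= a < j.+1)
     (cpowR (trap_entry m t j a) (sj - sj1 - th a)
      / cpowR (1 + trap_entry m t j a) (tj - tj1 + th a))) *
  ((\prod_(1 <= a < j.+1) \prod_(1 <= p < j.+2)
      cpowR `|trap_entry m t j a - trap_entry m t j.+1 p| (th a - 1))
   / (\prod_(1 <= b < j.+1) \prod_(1 <= a < b)
        cpowR (trap_entry m t j b - trap_entry m t j a) (th a + th b - 2))).
Proof.
move=> hI; rewrite /cross_row hI /link_weight prod_pairs_ord !big_nat1_ord.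
have -> : \prod_(i < j) (cpowR (trap_row m t j)`_i (sj - sj1 - th i.+1) *
      cpowR (1 + (trap_row m t j)`_i) (- (tj - tj1 + th i.+1))) =
    \prod_(i < j) (cpowR (trap_entry m t j i.+1) (sj - sj1 - th i.+1)
      / cpowR (1 + trap_entry m t j i.+1) (tj - tj1 + th i.+1)).
  by apply: eq_bigr => i _; rewrite nth_trap_row // (cpowRN (1 + _)).
have -> : cross_prod j j.+1 (nth 0 (trap_row m t j)) (fun i => th i.+1) (trap_row m t j.+1) =
    \prod_(i < j) \prod_(1 <= p < j.+2)
      cpowR `|trap_entry m t j i.+1 - trap_entry m t j.+1 p| (th i.+1 - 1).
  apply: eq_bigr => i _; rewrite big_nat1_ord; apply: eq_bigr => p _.
  by rewrite !nth_trap_row // distrC.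
have -> : \prod_(b < j) \prod_(a < b)
      cpowR ((trap_row m t j)`_b - (trap_row m t j)`_a) (- (th a.+1 + th b.+1 - (1 + 1))) =
    (\prod_(b < j) \prod_(a < b)
        cpowR (trap_entry m t j b.+1 - trap_entry m t j a.+1) (th a.+1 + th b.+1 - 2))^-1.
  rewrite -prodfV; apply: eq_bigr => b _; rewrite -prodfV; apply: eq_bigr => a _.
  rewrite !nth_trap_row //; last exact: ltn_trans (ltn_ord a) (ltn_ord b).
  by rewrite (cpowRN (_ - _)).
move: (\prod_(i < j) (_ / _)) (\prod_(i < j) \prod_(1 <= p < j.+2) _)
  (\prod_(b < j) \prod_(a < b) _)^-1 => A B C.
by ring.
Qed.

Lemma trap_integrandE m n k sigma tau theta t : (m <= n)%N -> strict_trap m n t ->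
  trap_integrand m n k sigma tau theta t =
  rayleigh_integrand m n k sigma tau theta (trap_entry m t).
Proof.
move=> mn [h1 h2]; rewrite /trap_integrand /trap_prefix h1 /rayleigh_integrand.
rewrite (eq_big_nat _ _ (F2 := fun j =>
  (\prod_(1 <= a < j.+1)
     (cpowR (trap_entry m t j a) (sigma j - sigma j.+1 - theta j a)
      / cpowR (1 + trap_entry m t j a) (tau j - tau j.+1 + theta j a))) *
  ((\prod_(1 <= a < j.+1) \prod_(1 <= p < j.+2)
      cpowR `|trap_entry m t j a - trap_entry m t j.+1 p| (theta j a - 1))
   / (\prod_(1 <= b < j.+1) \prod_(1 <= a < b)
        cpowR (trap_entry m t j b - trap_entry m t j a) (theta j a + theta j b - 2))))); last first.
  move=> j jn; apply: (link_cross_rowE _ _ _ _ (theta j)).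
  by rewrite interlaced_row; have [-> ->] := h2 j jn.
rewrite big_split /=.
have -> : pole_prod m (nth 0 (trap_row m t m)) (fun=> k) =
    \prod_(1 <= b < m.+1) \prod_(1 <= a < b)
       cpowR (trap_entry m t m b - trap_entry m t m a) (2 * k - 1).
  rewrite prod_pairs_ord; apply: eq_bigr => b _; apply: eq_bigr => a _.
  rewrite !nth_trap_row //; last exact: ltn_trans (ltn_ord a) (ltn_ord b).
  by rewrite mulrDl mul1r.
have -> : selberg_weight n (sigma n) (tau n) (trap_row m t n) =
    (\prod_(1 <= p < n.+1) (cpowR (trap_entry m t n p) (sigma n - 1) /
       cpowR (1 + trap_entry m t n p) (tau n))) *
    (\prod_(1 <= q < n.+1) \prod_(1 <= p < q) (trap_entry m t n q - trap_entry m t n p)%:C).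
  rewrite /selberg_weight; congr (_ * _).
    rewrite big_nat1_ord -big_split /=; apply: eq_bigr => i _.
    by rewrite nth_trap_row // (cpowRN (1 + _)).
  rewrite prod_pairs_ord /vdm rmorph_prod; apply: eq_bigr => b _.
  rewrite rmorph_prod; apply: eq_bigr => a _.
  by rewrite !nth_trap_row //; exact: ltn_trans (ltn_ord a) (ltn_ord b).
set A := \prod_(m <= j < n) \prod_(1 <= a < j.+1) (_ / _).
set B := \prod_(m <= j < n) (_ / _).
set C := \prod_(1 <= p < n.+1) (_ / _).
set D := \prod_(1 <= b < m.+1) _.
set E := \prod_(1 <= q < n.+1) \prod_(1 <= p < q) (_ - _)%:C.
by move: A B C D E => *; ring.
Qed.

End rayleigh_integrand_rows.

Section trapezoid_value.
Context {R : realType}.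

(** The factor of index 0 is split off: it becomes the factor of row [m] in the last product of the
    theorem, where the convention for row [m - 1] makes the sum of the thetas equal to
    [(m - 1) k]. *)
Lemma selberg_valueE m (k sigma tau : R[i]) : (0 < m)%N -> 0 < complex.Re k ->
  selberg_value m k sigma tau =
  (\prod_(1 <= j < m)
     (cGamma ((j + 1)%N%:R * k) * cGamma (sigma + j%:R * k)
      * cGamma (tau - sigma - (m + j - 1)%N%:R * k)
      / (cGamma k * cGamma (tau - j%:R * k)))) *
  (cGamma sigma * cGamma (tau - sigma - k *+ m.-1) / cGamma tau).
Proof.
case: m => // m _ k0; rewrite /selberg_value /= big_nat1_ord.
rewrite (big_ordS _ _ _ (fun j => cGamma (k *+ j.+1) / cGamma k)).
rewrite (big_ordS _ _ _ (fun j => cGamma (sigma + k *+ j) *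
  cGamma (tau - sigma - k *+ (m + j)) / cGamma (tau - k *+ j))).
rewrite mulr1n divff ?cGamma_neq0 // mul1r mulr0n addr0 subr0 addn0.
rewrite mulrCA -big_split /= mulrC; congr (_ * _); apply: eq_bigr => j _.
have -> : (m.+1 + j.+1 - 1)%N = (m + j.+1)%N by rewrite addSn subn1.
rewrite addn1 !mulr_natl invfM.
move: (cGamma k)^-1 (cGamma (tau - k *+ j.+1))^-1 => a b.
move: (cGamma (k *+ j.+2)) (cGamma (sigma + k *+ j.+1)) (cGamma (tau - sigma - k *+ (m + j.+1))).
by move=> *; ring.
Qed.

Lemma sum_theta_ext m (k : R[i]) (theta : nat -> nat -> R[i]) j : (m <= j)%N ->
  \sum_(1 <= a < j.+1) theta_ext m k theta j a = \sum_(i < j) theta j i.+1.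
Proof.
move=> mj; rewrite big_nat1_ord; apply: eq_bigr => i _.
by rewrite /theta_ext ltnNge mj.
Qed.

Lemma sum_theta_ext_base m (k : R[i]) (theta : nat -> nat -> R[i]) : (0 < m)%N ->
  \sum_(1 <= a < m) theta_ext m k theta m.-1 a = k *+ m.-1.
Proof.
case: m => // m _; rewrite big_nat1_ord (eq_bigr (fun=> k)).
  by rewrite sumr_const card_ord.
by move=> i _; rewrite /theta_ext /= ltnSn.
Qed.

Lemma trap_valueE m n (k : R[i]) (sigma tau : nat -> R[i]) (theta : nat -> nat -> R[i]) :
  (0 < m)%N -> (m <= n)%N -> 0 < complex.Re k ->
  trap_value m n k sigma tau theta =
    (\prod_(1 <= j < m)
       (cGamma ((j + 1)%N%:R * k) * cGamma (sigma m + j%:R * k)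
        * cGamma (tau m - sigma m - (m + j - 1)%N%:R * k)
        / (cGamma k * cGamma (tau m - j%:R * k))))
    * (\prod_(m <= j < n) \prod_(1 <= a < j.+1) cGamma (theta j a))
    * (\prod_(m <= j < n.+1)
         (cGamma (sigma j)
          * cGamma (tau j - sigma j
                    - \sum_(1 <= a < j) theta_ext m k theta j.-1 a)
          / cGamma (tau j))).
Proof.
move=> m0 mn k0; rewrite /trap_value selberg_valueE // [X in _ = _ * X]big_nat_recl //=.
rewrite sum_theta_ext_base //.
have -> : \prod_(m <= j < n) row_const j (sigma j.+1) (tau j.+1) (fun i => theta j i.+1) =
    (\prod_(m <= j < n) \prod_(1 <= a < j.+1) cGamma (theta j a)) *
    \prod_(m <= j < n) (cGamma (sigma j.+1) *
      cGamma (tau j.+1 - sigma j.+1 - \sum_(1 <= a < j.+1) theta_ext m k theta j a) /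
      cGamma (tau j.+1)).
  rewrite -big_split /=; apply: eq_big_nat => j /andP[mj _].
  rewrite /row_const sum_theta_ext // big_nat1_ord opprD addrA.
  move: (\prod_(i < j) _) (cGamma (tau j.+1 - sigma j.+1 - _)) (cGamma (sigma j.+1)) => A B C.
  by move: (cGamma (tau j.+1))^-1 => D; ring.
set A := \prod_(1 <= j < m) _; set B := \prod_(m <= j < n) \prod_(1 <= a < j.+1) _.
set C := \prod_(m <= j < n) (_ / _).
move: (cGamma (sigma m)) (cGamma (tau m - sigma m - k *+ m.-1)) (cGamma (tau m))^-1 => D E F.
by move: A B C => A B C; ring.
Qed.

End trapezoid_value.

Section measurable_rayleigh_integrand.
Context {R : realType}.
Notation tup n := (n.-tuple (measurableTypeR R)).

Lemma cmeasurableV d (T : measurableType d) (f : T -> R[i]) :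
  cmeasurable f -> cmeasurable (fun x => (f x)^-1).
Proof.
move=> [mf1 mf2].
have mN : measurable_fun setT (fun x =>
    (complex.Re (f x) ^+ 2 + complex.Im (f x) ^+ 2)^-1).
  by apply: measurable_funV; apply: measurable_funD; exact: measurable_funX.
split.
  rewrite (_ : (fun _ => _) = (fun x => complex.Re (f x) *
    (complex.Re (f x) ^+ 2 + complex.Im (f x) ^+ 2)^-1)); first exact: measurable_funM.
  by apply/funext => x; case: (f x) => a b.
rewrite (_ : (fun _ => _) = (fun x => - (complex.Im (f x) *
    (complex.Re (f x) ^+ 2 + complex.Im (f x) ^+ 2)^-1))).
  by apply: measurable_funN; exact: measurable_funM.
by apply/funext => x; case: (f x) => a b.
Qed.

Lemma measurable_in_set d (T : measurableType d) (D : set T) :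
  measurable D -> measurable_fun setT (fun x => x \in D).
Proof.
move=> mD; apply: (measurable_fun_bool true); rewrite setTI.
rewrite (_ : _ @^-1` _ = D) //; apply/seteqP.
by split => x /=; [exact: set_mem|exact: mem_set].
Qed.

Lemma cmeasurable_rayleigh_integrand N m n (k : R[i]) (sigma tau : nat -> R[i])
    (theta : nat -> nat -> R[i]) :
  cmeasurable (fun t : tup N => rayleigh_integrand m n k sigma tau theta (trap_entry m t)).
Proof.
have me j i : measurable_fun setT (fun t : tup N => trap_entry m t j i : R).
  exact: measurable_nth.
have mp (f : tup N -> R) s : measurable_fun setT f -> cmeasurable (fun t => cpowR (f t) s).
  exact: cmeasurable_cpowR.
apply: cmeasurableM; first apply: cmeasurableM; first apply: cmeasurableM;
  first apply: cmeasurableM.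
- apply: cmeasurable_prod => j; apply: cmeasurable_prod => a.
  apply: cmeasurableM; first exact: mp.
  by apply: cmeasurableV; apply: mp; exact: measurable_funD.
- apply: cmeasurable_prod => p; apply: cmeasurableM; first exact: mp.
  by apply: cmeasurableV; apply: mp; exact: measurable_funD.
- apply: cmeasurable_prod => b; apply: cmeasurable_prod => a.
  by apply: mp; exact: measurable_funB.
- apply: cmeasurable_prod => j; apply: cmeasurableM.
    apply: cmeasurable_prod => a; apply: cmeasurable_prod => p.
    by apply: mp; apply: measurableT_comp => //; exact: measurable_funB.
  apply: cmeasurableV; apply: cmeasurable_prod => b; apply: cmeasurable_prod => a.
  by apply: mp; exact: measurable_funB.
- apply: cmeasurable_prod => q; apply: cmeasurable_prod => p.
  by apply: cmeasurable_real; exact: measurable_funB.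
Qed.

End measurable_rayleigh_integrand.

Theorem mainTheorem4 (R : realType) (m n : nat)
    (kappa : R[i]) (sigma tau : nat -> R[i]) (theta : nat -> nat -> R[i])
    (m_ge1 : (1 <= m)%N) (m_le_n : (m <= n)%N)
    (kappa_gt0 : 0 < complex.Re kappa)
    (theta_gt0 : forall j a, (m <= j < n)%N -> (1 <= a <= j)%N ->
      0 < complex.Re (theta j a))
    (sigma_gt0 : forall j, (m <= j <= n)%N -> 0 < complex.Re (sigma j))
    (tau_gt0 : forall j, (m <= j <= n)%N ->
      0 < complex.Re (tau j - sigma j
                      - \sum_(1 <= a < j) theta_ext m kappa theta j.-1 a))
    (tau_m_gt0 : forall j, (1 <= j < m)%N ->
      0 < complex.Re (tau m - sigma m - (m + j - 1)%N%:R * kappa)) :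
  let mu := lebesgue_tuple (trap_size m n) in
  let f (t : (trap_size m n).-tuple (measurableTypeR R)) :=
    rayleigh_integrand m n kappa sigma tau theta (trap_entry m t) in
  cintegrable mu (rayleigh_nonneg m n) f /\
  cintegral mu (rayleigh_nonneg m n) f =
    (\prod_(1 <= j < m)
       (cGamma ((j + 1)%N%:R * kappa) * cGamma (sigma m + j%:R * kappa)
        * cGamma (tau m - sigma m - (m + j - 1)%N%:R * kappa)
        / (cGamma kappa * cGamma (tau m - j%:R * kappa))))
    * (\prod_(m <= j < n) \prod_(1 <= a < j.+1) cGamma (theta j a))
    * (\prod_(m <= j < n.+1)
         (cGamma (sigma j)
          * cGamma (tau j - sigma j
                    - \sum_(1 <= a < j) theta_ext m kappa theta j.-1 a)
          / cGamma (tau j))).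
Proof.
move=> mu f; rewrite -trap_valueE //.
apply: hasC_mkcond; first exact: measurable_rayleigh_nonneg.
apply: hasC_ae (hasC_trap m_ge1 m_le_n kappa_gt0 _ sigma_gt0 _ _).
- apply: cmeasurable_if; last exact: cmeasurable_cst.
    apply: measurable_in_set; exact: measurable_rayleigh_nonneg.
  exact: cmeasurable_rayleigh_integrand.
- apply: filterS (ae_uniq (trap_size m n)) => t ut.
  (* For distinct nonzero entries, a tuple in the region is strict, and there the two integrands
     agree; any other tuple lies outside the region, and both sides are 0. *)
  have [st|nst] := pselect (strict_trap m n t).
    by rewrite (mem_set (strict_trap_rayleigh st)) trap_integrandE.
  rewrite memNset; last by move=> /(rayleigh_strict_trap m_le_n ut).
  rewrite /trap_integrand.
  have [->|/trap_prefix_strict //] := eqVneq (trap_prefix m n kappa sigma tau theta t) 0.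
  by rewrite mul0r.
- by move=> j i jn ij; apply: theta_gt0.
(* Only the strongest of the conditions on [tau m] is needed, the one for [j = m - 1]. For [m = 1]
   there is no such [j], and the condition is that of row 1, with an empty sum. *)
- case: (ltnP 1 m) => m1.
    have := tau_m_gt0 m.-1; rewrite mulr_natl.
    have -> : (m + m.-1 - 1)%N = (m.-1 + m.-1)%N by lia.
    by apply; lia.
  have mE : m = 1%N by lia.
  have := tau_gt0 m; rewrite leqnn m_le_n => /(_ isT).
  by rewrite sum_theta_ext_base // mE /= !mulr0n.
- move=> j /andP[mj jn]; have := tau_gt0 j.+1; rewrite leqW // jn => /(_ isT) /=.
  by rewrite sum_theta_ext // opprD addrA.
Qed.
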